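(* Suppose Assumptions 1 and 2 of the context hold and $\kappa=\gamma^2\Delta<1$. Set $c_\gamma=\frac{2}{1-\gamma^2}$, $C_1=\frac{3c_\gamma^2\vartheta}{(1-\kappa)^3}$ and $K_0=1+8\sqrt{C_1\kappa\Delta/(\Delta-1)}$. Assume in addition: (i) $\sigma_t^2:=\operatorname{Var}_+\big(t(X)\big)>0$; (ii) the density of $\log\psi(X)$ under $X\sim\mathbb{P}_+$ is bounded below by some $\beta>0$ on $[-K_0,K_0]$. Then there are $c>0$ and $\ell_0$, explicit in the model constants and the absolute Berry--Esseen constant, such that $$\mathbb{P}\big(h_\ell\neq h_{\ell+1}\big)\;\ge\;c\,\kappa^{\ell/2}\qquad\text{for all }\ell\ge\ell_0.$$ Both regularity conditions (i) and (ii) hold, with explicit constants, for the Gaussian mixture $\mathbb{P}_\pm=\mathcal{N}(\pm\boldsymbol{\mu},\sigma^2I_d)$ with $\boldsymbol{\mu}\ne\mathbf{0}$ and $\sigma>0$.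
   Context: Parameters. Constants $a>b>0$; $\Delta=\frac{a+b}{2}$, assumed $>1$; $\gamma=\frac{a-b}{a+b}\in(0,1)$; $\kappa=\gamma^2\Delta$. Limit object $(T,o,y,X)$. $T$ is a Poisson Galton--Watson tree rooted at $o$: every vertex independently has $\mathrm{Poi}(\Delta)$ children. Labels $y_v\in\{\pm1\}$ follow a broadcast process: $y_o$ is uniform on $\{\pm1\}$ and, independently along edges and of the tree shape, each child has its parent's label with probability $\frac{1+\gamma}{2}$ and the opposite label with probability $\frac{1-\gamma}{2}$. Given the tree and labels, the features $X_v\in\mathbb{R}^d$ are independent with $X_v\sim\mathbb{P}_{y_v}$, where $\mathbb{P}_+,\mathbb{P}_-$ are two given probability laws on $\mathbb{R}^d$. $N_k$ is the set of vertices at graph distance exactly $k$ from $o$. All probabilities and expectations are on this object. Features and classifier. $\rho_\pm$ are the densities of $\mathbb{P}_\pm$ with respect to a common base measure $\mu$; $\psi=\rho_+/\rho_-$; $t(x)=\frac{\rho_+(x)-\rho_-(x)}{\rho_+(x)+\rho_-(x)}\in[-1,1]$, so $\log\psi=2\operatorname{artanh}(t)$. For $k\ge0$, $M_k(x)=2\operatorname{artanh}(\gamma^k t(x))$. For $\ell\ge 0$, $$T_\ell=\sum_{k=0}^{\ell}\sum_{v\in N_k}M_k(X_v),\qquad h_\ell=\operatorname{sgn}(T_\ell).$$ $\mathbb{E}_+$ and $\operatorname{Var}_+$ denote expectation and variance under $X\sim\mathbb{P}_+$. Assumption 1. $\mathbb{P}_+$ and $\mathbb{P}_-$ are mutually absolutely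 continuous, with densities $\rho_\pm$ with respect to $\mu$, and there is a $\mu$-measure-preserving involution $\tau:\mathbb{R}^d\to\mathbb{R}^d$ with $\rho_-(x)=\rho_+(\tau(x))$ for $\mu$-a.e. $x$. Assumption 2. $\vartheta:=\mathbb{E}_+[t(X)^2]>0$. ''Model constants'' means the quantities $\gamma,\Delta,\kappa,\vartheta,\sigma_t,\beta$ (and quantities computed from them such as $c_\gamma, C_1$); the absolute Berry--Esseen constant is the universal constant in the Berry--Esseen inequality for sums of independent, not necessarily identically distributed, random variables. *)

(* Defs.v *)
Set Warnings "-notation-overridden,-notation-incompatible-prefix".
From HB Require Import structures.
From mathcomp Require Import all_boot all_order all_algebra.
From mathcomp Require Import all_classical all_reals all_analysis.

Set Implicit Arguments.
Unset Strict Implicit.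
Unset Printing Implicit Defensive.

Import Order.TTheory GRing.Theory Num.Theory.
Import numFieldNormedType.Exports.

Local Open Scope classical_set_scope.
Local Open Scope ring_scope.

(* R^d is [d.-tuple R] with the product sigma-algebra; the label +1 is [true]
   and the label -1 is [false]. *)

Section Constants.
Variable R : realType.
Implicit Types a b gamma Delta theta : R.

Definition mean_degree a b : R := (a + b) / 2.

Definition edge_corr a b : R := (a - b) / (a + b).

Definition snr gamma Delta : R := gamma ^+ 2 * Delta.

Definition c_gamma gamma : R := 2 / (1 - gamma ^+ 2).

Definition C1 gamma Delta theta : R :=
  3 * c_gamma gamma ^+ 2 * theta / (1 - snr gamma Delta) ^+ 3.

Definition K0 gamma Delta theta : R :=
  1 + 8 * Num.sqrt (C1 gamma Delta theta * snr gamma Delta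
                    * Delta / (Delta - 1)).

Definition artanh (u : R) : R := ln ((1 + u) / (1 - u)) / 2.

End Constants.

Section Features.
Context {R : realType} {d : nat}.
Implicit Types (mu : {measure set (d.-tuple R) -> \bar R})
  (rho rhop rhom : d.-tuple R -> R) (P Pp Pm : probability (d.-tuple R) R).

Definition has_density mu P rho : Prop :=
  [/\ measurable_fun setT rho, (forall x, 0 <= rho x) &
      forall A, measurable A -> P A = (\int[mu]_(x in A) (rho x)%:E)%E].

Definition measure_preserving_involution mu (tau : d.-tuple R -> d.-tuple R) :
    Prop :=
  [/\ measurable_fun setT tau, involutive tau &
      forall A, measurable A -> mu (tau @^-1` A) = mu A].

Definition symmetric_densities mu Pp Pm rhop rhom : Prop :=
  [/\ Pp `<< Pm, Pm `<< Pp, has_density mu Pp rhop, has_density mu Pm rhom &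
      exists tau, measure_preserving_involution mu tau /\
        {ae mu, forall x, rhom x = rhop (tau x)}].

Definition psi rhop rhom x : R := rhop x / rhom x.

Definition tstat rhop rhom x : R :=
  (rhop x - rhom x) / (rhop x + rhom x).

(* [t] is bounded, so both moments are finite and [fine] loses nothing. *)
Definition theta Pp rhop rhom : R :=
  fine ('E_Pp[(fun x => tstat rhop rhom x ^+ 2)%R])%E.

Definition var_t Pp rhop rhom : R := fine ('V_Pp[tstat rhop rhom])%E.

Definition sigma_t Pp rhop rhom : R := Num.sqrt (var_t Pp rhop rhom).

(* A Lebesgue density is only determined almost everywhere, hence the
   quantification over its versions [f]. *)
Definition log_psi_density_ge Pp rhop rhom (K beta : R) : Prop :=
  exists f : R -> R,
    [/\ measurable_fun setT f,
        (forall z, 0 <= f z),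
        (forall A : set R, measurable A ->
           Pp [set x | A (ln (psi rhop rhom x))]
           = (\int[lebesgue_measure]_(z in A) (f z)%:E)%E) &
        forall z, - K <= z <= K -> beta <= f z].

Definition M gamma rhop rhom (k : nat) x : R :=
  2 * artanh (gamma ^+ k * tstat rhop rhom x).

End Features.

(* Vertices are Ulam-Harris words read from the vertex up to the root: [::] is
   the root and [i :: u] is the child of [u] with index [i]. When [c u] is the
   number of children of [u], [generation c k] lists, without repetition, the
   vertices of the tree at distance [k] from the root. *)
Definition vertex := seq nat.

Fixpoint generation (c : vertex -> nat) (k : nat) : seq vertex :=
  if k is k'.+1
  then [seq i :: u | u <- generation c k', i <- iota 0 (c u)]
  else [:: [::]].

Section Tree.
Context {R : realType} {d : nat} {dO : measure_display}
  {Omega : measurableType dO}.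
Implicit Types (P : probability Omega R) (gamma Delta : R)
  (Pp Pm : probability (d.-tuple R) R)
  (C : vertex -> Omega -> nat) (y : vertex -> Omega -> bool)
  (X : vertex -> Omega -> d.-tuple R).

(* Conditional probability of the label of [v] given that of its parent. *)
Definition label_prob gamma (s : vertex -> bool) (v : vertex) : R :=
  if v is _ :: u
  then (if s v == s u then (1 + gamma) / 2 else (1 - gamma) / 2)
  else 1 / 2.

(* The object (T, o, y, X). Offspring numbers, labels and features are carried
   by all words, and those of words outside the tree are never used: this does
   not change the law of the object. The law is given by its marginals on the
   finite sets [F] of words closed under taking parents: offspring numbers are
   i.i.d. Poisson, labels are broadcast from a uniform root label independently
   of the offspring numbers, and given both the features are independent with
   [X v] of law [Pp] or [Pm] according to the label of [v]. *)
Definition is_broadcast_tree P Delta gamma Pp Pm C y X : Prop :=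
  [/\ forall v n, measurable [set w | C v w = n],
      forall v s, measurable [set w | y v w = s],
      forall v, measurable_fun setT (X v) &
      forall (F : seq vertex) (n : vertex -> nat) (s : vertex -> bool)
        (A : vertex -> set (d.-tuple R)),
        uniq F ->
        (forall i u, i :: u \in F -> u \in F) ->
        (forall v, measurable (A v)) ->
        P [set w | forall v, v \in F ->
                     [/\ C v w = n v, y v w = s v & A v (X v w)]]
        = (\prod_(v <- F)
             (poisson_pmf Delta (n v) * label_prob gamma s v
              * fine ((if s v then Pp else Pm) (A v))))%:E].

Definition T_stat gamma rhop rhom C X (l : nat) (w : Omega) : R :=
  \sum_(k < l.+1) \sum_(v <- generation (C ^~ w) k)
    M gamma rhop rhom k (X v w).

Definition h gamma rhop rhom C X (l : nat) (w : Omega) : R :=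
  Num.sg (T_stat gamma rhop rhom C X l w).

End Tree.

Section Gaussian.
Context {R : realType} {d : nat}.

(* The law N(m, sigma^2 I_d): independent N(m_i, sigma^2) coordinates; the
   second parameter of [normal_prob] is the standard deviation. *)
Definition isotropic_gaussian (m : d.-tuple R) (sigma : R)
    (P : probability (d.-tuple R) R) : Prop :=
  forall A : 'I_d -> set R, (forall i, measurable (A i)) ->
    P [set x | forall i, A i (tnth x i)]
    = (\prod_(i < d) fine (normal_prob (tnth m i) sigma (A i)))%:E.

Definition eucl_norm (m : d.-tuple R) : R :=
  Num.sqrt (\sum_(i < d) tnth m i ^+ 2).

(* With r = |m| / sigma, log psi(X) has law N(2 r^2, 4 r^2) under P_+ and
   t = tanh (log psi / 2). *)
Definition gauss_var_t (r : R) : R :=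
  fine ('V_(normal_prob (2 * r ^+ 2) (2 * r))
          [(fun z => (expR z - 1) / (expR z + 1))%R])%E.

(* Minimum over [-K, K] of the density of N(2 r^2, 4 r^2): for K >= 0 it is
   attained at -K. *)
Definition gauss_beta (r K : R) : R := normal_pdf (2 * r ^+ 2) (2 * r) (- K).

End Gaussian.

(* Main.v *)
(* Multiplying every feature by its label shows that offspring numbers, flips (does a
   label agree with that of the parent?) and signed features y_v t(X_v) are mutually
   independent: by the involution tau the law of y_v t(X_v) does not depend on y_v.
   Given the tree and the labels, T_l = log psi(X_o) + S, where S
   collects levels 1 to l, and T_(l+1) = T_l + D. The sign changes as soon as the root
   term falls between -S - D and -S; when |S| <= K0 - 1 this has probability at least
   beta min(|D|, 1) by the density assumption. Given the tree, S and D are independent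
   sums; the second and fourth moments of D give
   E min(|D|, 1) >= const * sigma_t kappa^((l+1)/2) min(W, 1), where W is the size of
   generation l + 1 divided by its mean, and Chebyshev bounds P(|S| > K0 - 1). The
   resulting lower bound is minorised by a quadratic polynomial in W minus a multiple of
   the conditional second moment of S, and its mean is bounded below because K0 is large.

   For the Gaussian mixture, exp(-2 <m, x> / sigma^2) times the first law is the second
   law (check it on boxes), so log psi = 2 <m, x> / sigma^2 almost everywhere, which is
   normal as a sum of independent normal variables. *)
Require Import Defs.
From HB Require Import structures.
From mathcomp Require Import all_boot all_order all_algebra.
From mathcomp Require Import all_classical all_reals all_analysis.
From mathcomp Require Import measurable_realfun.
From mathcomp Require Import ring lra.

Set Implicit Arguments.
Unset Strict Implicit.
Unset Printing Implicit Defensive.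

Import Order.TTheory GRing.Theory Num.Theory.
Import numFieldNormedType.Exports.

Local Open Scope classical_set_scope.
Local Open Scope ring_scope.

(** * Independence *)

(** Two obstacles shape the proof. The sums run over random generations, so the variables are
    indexed by all words and conditioning is done by freezing: an integrand is read at a pair
    [(w1, w2)], where [w1] supplies the tree and the labels and [w2] the features. Independence of
    two sigma-algebras lets Tonelli integrate the two points separately, and no conditional
    expectation is formed. Next, averaging the features leaves a bound proportional to [min W 1]
    times [1 - rho], with [rho] the Chebyshev loss; both factors depend on the same tree and labels,
    so their means cannot be multiplied. A minorant that is additive in [W], [W^2] and [rho] needs
    separate means only. The condition [kappa < 1] enters through the mean of [rho]: above that
    threshold the squared sum of the labels over generation [k] outgrows [Delta^k]. Given the tree
    and the labels [D] is not centred, hence the scaling by its full second moment instead of its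
    variance. *)

Lemma measurable_forall_seq {d : measure_display} {T : measurableType d}
    {I : eqType} (F : seq I) (Q : I -> set T) :
  (forall j, j \in F -> measurable (Q j)) ->
  measurable [set w | forall j, j \in F -> Q j w].
Proof.
elim: F => [|i F IH] mQ.
  by rewrite (_ : [set w | _] = setT) //; apply/seteqP; split.
rewrite (_ : [set w | _] = Q i `&` [set w | forall j, j \in F -> Q j w]).
  apply: measurableI; first by apply: mQ; rewrite mem_head.
  by apply: IH => j jF; apply: mQ; rewrite in_cons jF orbT.
apply/seteqP; split=> w /=.
  move=> H; split; first by apply: H; rewrite mem_head.
  by move=> j jF; apply: H; rewrite in_cons jF orbT.
by move=> [H1 H2] j; rewrite in_cons => /orP[/eqP-> //|]; exact: H2.
Qed.

Section IndependentPair.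
Context {R : realType} {d d1 d2 : measure_display} {Omega : measurableType d}
  {T1 : measurableType d1} {T2 : measurableType d2}.
Variables (P : probability Omega R) (X : {mfun Omega >-> T1})
  (Y : {mfun Omega >-> T2}).
Hypothesis XY : forall A B, measurable A -> measurable B ->
  P (X @^-1` A `&` Y @^-1` B) = (P (X @^-1` A) * P (Y @^-1` B))%E.

Let pairing (w : Omega) : T1 * T2 := (X w, Y w).

Let pairing_measurable : measurable_fun setT pairing.
Proof. by apply: measurable_fun_pair; exact: measurable_funP. Qed.

HB.instance Definition _ := @isMeasurableFun.Build _ _ _ _ pairing
  pairing_measurable.

Lemma indep_pair_distribution S : measurable S ->
  (distribution P X \x distribution P Y)%E S = P (pairing @^-1` S).
Proof.
by move=> mS; rewrite (@product_measure_unique _ _ _ _ _ _ _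
  (distribution P pairing)) // => A B mA mB; rewrite /= XY.
Qed.

(** Independence in the form used from here on: once [X] is frozen at [w1], [Y] may be integrated
    over a second copy of [Omega]. This plays the part of conditioning on [X]. *)
Lemma integral_indep_pair (f : T1 * T2 -> \bar R) :
  measurable_fun setT f -> (forall z, 0 <= f z)%E ->
  (\int[P]_w f (X w, Y w) = \int[P]_w1 \int[P]_w2 f (X w1, Y w2))%E.
Proof.
move=> mf f0.
pose D : {measure set (T1 * T2) -> \bar R} := distribution P pairing.
transitivity (\int[D]_z f z)%E.
  by rewrite ge0_integral_distribution.
transitivity (\int[distribution P X \x distribution P Y]_z f z)%E.
  by apply: eq_measure_integral => S mS _; rewrite [RHS]indep_pair_distribution.
rewrite fubini_tonelli1 // ge0_integral_distribution //=; first last.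
- by move=> x; apply: integral_ge0.
- exact: measurable_fun_fubini_tonelli_F.
apply: eq_integral => w _ /=.
by rewrite /fubini_F ge0_integral_distribution //; exact: measurableT_comp.
Qed.

Lemma measurable_integral_indep_pair (f : T1 * T2 -> \bar R) :
  measurable_fun setT f -> (forall z, 0 <= f z)%E ->
  measurable_fun setT (fun w1 => \int[P]_w2 f (X w1, Y w2))%E.
Proof.
move=> mf f0.
rewrite (_ : (fun _ => _) = fubini_F (distribution P Y) f \o X).
  by apply: measurableT_comp => //; exact: measurable_fun_fubini_tonelli_F.
apply/funext => w /=.
by rewrite /fubini_F ge0_integral_distribution //; exact: measurableT_comp.
Qed.

End IndependentPair.

Section Independence.
Context {R : realType} {d : measure_display} {Omega : measurableType d}.
Variables (P : probability Omega R) (I : eqType) (Z : I -> {mfun Omega >-> R}).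
Implicit Types (J : set I) (F : seq I) (A : I -> set R).

Definition mutually_independent : Prop :=
  forall F A, uniq F -> (forall j, measurable (A j)) ->
  P [set w | forall j, j \in F -> A j (Z j w)]
  = (\prod_(j <- F) fine (P (Z j @^-1` A j)))%:E.

Definition cylinders J : set_system Omega :=
  [set B | exists F A, [/\ uniq F, forall j, j \in F -> J j,
     forall j, measurable (A j) & B = [set w | forall j, j \in F -> A j (Z j w)]]].

(* [Omega] with the sigma-algebra generated by the [Z j], [j] in [J]. *)
Local Notation sub_space J := (g_sigma_algebraType (cylinders J)).

(** The identity, typed as a random variable valued in the coarser space, so that independence of
    sigma-algebras becomes independence of a pair of variables. *)
Definition to_sub J : Omega -> sub_space J := id.

Lemma cylinders_measurable J : cylinders J `<=` measurable.
Proof.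
move=> _ [F [A [_ _ mA ->]]].
by apply: measurable_forall_seq => j _; rewrite -[X in measurable X]setTI; exact: measurable_funP.
Qed.

Lemma to_sub_measurable J : measurable_fun setT (to_sub J).
Proof.
move=> _ B mB; rewrite setTI.
exact: (smallest_sub (@sigma_algebra_measurable _ Omega)
  (@cylinders_measurable J)).
Qed.

HB.instance Definition _ J := @isMeasurableFun.Build _ _ _ _ (to_sub J)
  (@to_sub_measurable J).

Lemma cylindersT J : cylinders J setT.
Proof. by exists [::], (fun=> setT); split => //; apply/seteqP; split. Qed.

Lemma cylinders_setI J : setI_closed (cylinders J).
Proof.
move=> _ _ [F [A [uF JF mA ->]]] [F' [A' [uF' JF' mA' ->]]].
exists (undup (F ++ F')), (fun j => (if j \in F then A j else setT) `&`
  (if j \in F' then A' j else setT)); split.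
- exact: undup_uniq.
- by move=> j; rewrite mem_undup mem_cat => /orP[/JF|/JF'].
- by move=> j; apply: measurableI; case: ifP.
apply/seteqP; split=> w /=.
  by move=> [H H'] j jF; split; case: ifP => // ?; [exact: H|exact: H'].
move=> H; split=> j jF.
  by have := H j; rewrite mem_undup mem_cat jF /= => /(_ isT)[].
by have := H j; rewrite mem_undup mem_cat jF orbT /= => /(_ isT)[].
Qed.

Lemma sub_space_measurable J j : J j -> measurable_fun setT (Z j : sub_space J -> R).
Proof.
move=> Jj _ B mB; rewrite setTI; apply: sub_sigma_algebra.
exists [:: j], (fun=> B); split => //.
  by move=> i; rewrite inE => /eqP->.
apply/seteqP; split=> w /=; first by move=> Bw i; rewrite inE => /eqP->.
by apply; rewrite mem_head.
Qed.

Hypothesis indepZ : mutually_independent.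

Lemma cylinders_indep J J' B B' : J `&` J' = set0 ->
  cylinders J B -> cylinders J' B' -> P (B `&` B') = (P B * P B')%E.
Proof.
move=> JJ' [F [A [uF JF mA ->]]] [F' [A' [uF' JF' mA' ->]]].
have FF' j : j \in F -> j \in F' = false.
  move=> jF; apply/negP => jF'.
  have Jj : (J `&` J') j by split; [exact: JF|exact: JF'].
  by rewrite JJ' in Jj.
pose A2 j := if j \in F then A j else A' j.
have -> : [set w | forall j, j \in F -> A j (Z j w)] `&`
  [set w | forall j, j \in F' -> A' j (Z j w)] =
  [set w | forall j, j \in F ++ F' -> A2 j (Z j w)].
  apply/seteqP; split=> w /=.
    move=> [H H'] j; rewrite mem_cat /A2; case: ifP => [jF _|_ /=]; first exact: H.
    exact: H'.
  move=> H; split=> j jF; have := H j; rewrite mem_cat jF ?orbT /A2 => /(_ isT).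
    by rewrite jF.
  by case: ifP => // /FF'; rewrite jF.
rewrite !indepZ //; first last.
- by move=> j; rewrite /A2; case: ifP.
- rewrite cat_uniq uF uF' andbT /=; apply/hasPn => j jF'.
  by apply/negP => /FF'; rewrite jF'.
rewrite -EFinM big_cat /=; congr (_ * _)%:E.
  by apply: eq_big_seq => j jF; rewrite /A2 jF.
apply: eq_big_seq => j jF; rewrite /A2; case: ifP => // /FF'; by rewrite jF.
Qed.

(** First of two monotone-class steps, with [B] a fixed cylinder: both sides are finite measures in
    [B'], namely [P] restricted to [B] and [P] scaled by [P B]. They agree on the cylinders, which
    generate and are stable under intersection. *)
Lemma cylinder_sub_indep J J' B B' : J `&` J' = set0 ->
  cylinders J B -> <<s cylinders J' >> B' -> P (B `&` B') = (P B * P B')%E.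
Proof.
move=> JJ' cB; have mB := cylinders_measurable cB.
pose m1 := mrestr P mB.
have PBnn : (0 <= fine (P B))%R by rewrite fine_ge0.
pose m2 := mscale (NngNum PBnn) P.
move=> cB'.
have -> : P (B `&` B') = m1 B' by rewrite setIC.
transitivity (m2 B'); last first.
  transitivity ((fine (P B))%:E * P B')%E => //.
  by rewrite fineK // fin_num_measure.
apply: (g_sigma_algebra_measure_unique (cylinders J')
  (@cylinders_measurable J') (fun=> setT)) => //.
- by move=> _; exact: cylindersT.
- by rewrite bigcup_const.
- exact: cylinders_setI.
- move=> C cC; transitivity (P (B `&` C)); first by rewrite setIC.
  rewrite (cylinders_indep JJ') //.
  transitivity ((fine (P B))%:E * P C)%E => //.
  by rewrite fineK // fin_num_measure.
- by move=> _; rewrite (le_lt_trans (probability_le1 P _)) ?ltry //; exact: measurableI.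
Qed.

(** Second step: [B'] is now any set of its sigma-algebra and [B] varies; the previous lemma gives
    agreement on cylinders. *)
Lemma sub_indep J J' B B' : J `&` J' = set0 ->
  <<s cylinders J >> B -> <<s cylinders J' >> B' ->
  P (B `&` B') = (P B * P B')%E.
Proof.
move=> JJ' cB cB'.
have mB' : (measurable : set_system Omega) B'.
  by move: (to_sub_measurable measurableT cB'); rewrite setTI.
pose m1 := mrestr P mB'.
have PBnn : (0 <= fine (P B'))%R by rewrite fine_ge0.
pose m2 := mscale (NngNum PBnn) P.
have -> : P (B `&` B') = m1 B by [].
transitivity (m2 B); last first.
  transitivity ((fine (P B'))%:E * P B)%E => //.
  by rewrite fineK ?fin_num_measure// muleC.
apply: (g_sigma_algebra_measure_unique (cylinders J)
  (@cylinders_measurable J) (fun=> setT)) => //.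
- by move=> _; exact: cylindersT.
- by rewrite bigcup_const.
- exact: cylinders_setI.
- move=> C cC; transitivity (P (C `&` B')) => //.
  rewrite (cylinder_sub_indep JJ') //.
  transitivity ((fine (P B'))%:E * P C)%E => //.
  by rewrite fineK ?fin_num_measure// muleC.
- by move=> _; rewrite (le_lt_trans (probability_le1 P _)) ?ltry //; exact: measurableI.
Qed.

Lemma integral_sub_indep J J' (f : sub_space J * sub_space J' -> \bar R) :
  J `&` J' = set0 -> measurable_fun setT f -> (forall z, 0 <= f z)%E ->
  (\int[P]_w f (w, w) = \int[P]_w1 \int[P]_w2 f (w1, w2))%E.
Proof.
move=> JJ' mf f0.
apply: (integral_indep_pair (X := to_sub J) (Y := to_sub J')) => //.
by move=> A B mA mB; exact: (sub_indep JJ').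
Qed.

Lemma measurable_integral_sub J J' (f : sub_space J * sub_space J' -> \bar R) :
  measurable_fun setT f -> (forall z, 0 <= f z)%E ->
  measurable_fun (setT : set Omega) (fun w1 => \int[P]_w2 f (w1, w2))%E.
Proof.
move=> mf f0.
exact: (measurable_integral_indep_pair P (to_sub J) (to_sub J')).
Qed.

End Independence.

Notation sub_space Z J := (g_sigma_algebraType (cylinders Z J)).

(** * Means *)

Section Mean.
Context {R : realType} {d : measure_display} {Omega : measurableType d}.
Variable P : probability Omega R.
Implicit Types f g : Omega -> R.

(** Integrability and value in one predicate: sums, products and comparisons of means are then
    computed in [R] without finiteness side conditions. *)
Definition has_mean f (m : R) : Prop :=
  P.-integrable setT (EFin \o f) /\ (\int[P]_w (f w)%:E = m%:E)%E.

Lemma has_mean_measurable f m : has_mean f m -> measurable_fun setT f.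
Proof. by case=> /measurable_int/measurable_EFinP. Qed.

Lemma has_mean_uniq f m m' : has_mean f m -> has_mean f m' -> m = m'.
Proof. by move=> [_ fm] [_]; rewrite fm => -[]. Qed.

Lemma eq_has_mean f g m : f =1 g -> has_mean f m -> has_mean g m.
Proof. by move=> /funext ->. Qed.

Lemma has_mean_cst k : has_mean (fun=> k) k.
Proof.
split; first exact: finite_measure_integrable_cst.
rewrite (_ : (fun=> _) = cst k%:E) // integral_cst //.
by rewrite [X in (_ * X)%E](probability_setT P) mule1.
Qed.

Lemma has_meanD f g m n : has_mean f m -> has_mean g n ->
  has_mean (fun w => f w + g w) (m + n).
Proof.
move=> [fi fm] [gi gn]; split.
  by apply: eq_integrable (integrableD measurableT fi gi) => //.
by rewrite EFinD -fm -gn -integralD_EFin.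
Qed.

Lemma has_meanZ k f m : has_mean f m -> has_mean (fun w => k * f w) (k * m).
Proof.
move=> [fi fm]; split.
  by apply: eq_integrable (integrableZl measurableT k fi) => //.
by rewrite EFinM -fm -integralZl.
Qed.

Lemma has_meanN f m : has_mean f m -> has_mean (fun w => - f w) (- m).
Proof.
by move=> /(has_meanZ (-1)); rewrite mulN1r; apply: eq_has_mean => w; rewrite mulN1r.
Qed.

Lemma has_meanB f g m n : has_mean f m -> has_mean g n ->
  has_mean (fun w => f w - g w) (m - n).
Proof. by move=> fm /has_meanN; exact: has_meanD. Qed.

Lemma has_mean_sum (I : eqType) (s : seq I) (f : I -> Omega -> R) (m : I -> R) :
  (forall i, i \in s -> has_mean (f i) (m i)) ->
  has_mean (fun w => \sum_(i <- s) f i w) (\sum_(i <- s) m i).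
Proof.
elim: s => [|i s IH] H.
  by rewrite big_nil; apply: eq_has_mean (has_mean_cst 0) => w; rewrite big_nil.
rewrite big_cons; apply: (@eq_has_mean (fun w => f i w + \sum_(j <- s) f j w)).
  by move=> w; rewrite big_cons.
apply: has_meanD; first by apply: H; rewrite mem_head.
by apply: IH => j js; apply: H; rewrite in_cons js orbT.
Qed.

Lemma le_has_mean f g m n : (forall w, f w <= g w) ->
  has_mean f m -> has_mean g n -> m <= n.
Proof.
move=> fg [fi fm] [gi gn]; rewrite -lee_fin -fm -gn.
by apply: le_integral => // w _; rewrite lee_fin.
Qed.

Lemma has_mean_dominated f g n : measurable_fun setT f ->
  (forall w, `|f w| <= g w) -> has_mean g n -> exists m, has_mean f m.
Proof.
move=> mf fg [gi gn].
have fi : P.-integrable setT (EFin \o f).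
  apply: le_integrable gi => //; first exact/measurable_EFinP.
  by move=> w _; rewrite /= lee_fin (le_trans (fg w)) // ler_norm.
exists (fine (\int[P]_w (f w)%:E)); split => //.
by rewrite fineK // (integrable_fin_num _ fi).
Qed.

Lemma has_mean_bounded f B : measurable_fun setT f ->
  (forall w, `|f w| <= B) -> exists m, has_mean f m.
Proof. by move=> mf fB; exact: has_mean_dominated mf fB (has_mean_cst B). Qed.

Lemma ge0_has_mean f m : measurable_fun setT f -> (forall w, 0 <= f w) ->
  (\int[P]_w (f w)%:E = m%:E)%E -> has_mean f m.
Proof.
move=> mf f0 fm; split => //; apply/integrableP; split.
  exact/measurable_EFinP.
under eq_integral do rewrite /= ger0_norm //.
by rewrite fm ltry.
Qed.

Lemma has_mean_ge0 f m : (forall w, 0 <= f w) -> has_mean f m -> 0 <= m.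
Proof. by move=> f0 fm; exact: le_has_mean f0 (has_mean_cst 0) fm. Qed.

Lemma sqr_has_mean_le f m s : has_mean f m -> has_mean (fun w => f w ^+ 2) s ->
  m ^+ 2 <= s.
Proof.
move=> fm fs; rewrite -subr_ge0.
have H : has_mean (fun w => (f w - m) ^+ 2) (s - 2 * m * m + m ^+ 2).
  apply: eq_has_mean (has_meanD (has_meanB fs (has_meanZ (2 * m) fm))
    (has_mean_cst (m ^+ 2))) => w; ring.
have := has_mean_ge0 (fun w => sqr_ge0 _) H.
by congr (_ <= _); ring.
Qed.

(** Chebyshev: [1 - f^2 / K^2] is a pointwise lower bound of the indicator of [|f| <= K]. *)
Lemma has_mean_le_prob f (s K : R) : 0 < K -> has_mean (fun w => f w ^+ 2) s ->
  measurable_fun setT f ->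
  ((1 - s / K ^+ 2)%:E <= P [set w | (`|f w| <= K)%R])%E.
Proof.
move=> K0 fs mf.
have mS : measurable [set w | `|f w| <= K].
  rewrite -[X in measurable X]setTI; apply: measurable_fun_le => //.
  exact: measurableT_comp.
pose g w : R := \1_[set w | `|f w| <= K] w.
have [m gm] : exists m, has_mean g m.
  apply: (@has_mean_bounded g 1); first exact: measurable_indic.
  by move=> w; rewrite /g indicE ger0_norm // lern1 leq_b1.
have -> : P [set w | `|f w| <= K] = m%:E.
  by case: gm => _ <-; rewrite integral_indic // setIT.
rewrite lee_fin; apply: le_has_mean gm; last first.
  by rewrite [s / _]mulrC; exact: has_meanB (has_mean_cst 1) (has_meanZ (K ^+ 2)^-1 fs).
move=> w; rewrite /g indicE; case: (boolP (w \in _)) => [_|].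
  by rewrite lerBlDr lerDl mulr_ge0 ?invr_ge0 ?sqr_ge0.
rewrite notin_setE /= => /negP; rewrite -ltNge => fK.
rewrite subr_le0 mulrC ler_pdivlMr ?exprn_gt0 // mul1r -(ger0_norm (sqr_ge0 (f w))) normrX.
by rewrite lerXn2r ?nnegrE // ?ltW.
Qed.

End Mean.

(** * Moments of independent variables *)

Section IndependentMoments.
Context {R : realType} {d : measure_display} {Omega : measurableType d}.
Variables (P : probability Omega R) (I : eqType) (Z : I -> {mfun Omega >-> R}).
Hypothesis indepZ : mutually_independent P Z.
Implicit Types (J : set I) (f g : Omega -> R).

Definition sub_measurable J f := measurable_fun setT (f : sub_space Z J -> R).

Lemma sub_measurableW J f : sub_measurable J f -> measurable_fun setT f.
Proof.
by move=> mf; exact: (measurableT_comp mf (to_sub_measurable (J := J))).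
Qed.

Lemma sub_measurableS J J' f : J `<=` J' -> sub_measurable J f -> sub_measurable J' f.
Proof.
move=> JJ' mf; have mid : measurable_fun setT (id : sub_space Z J' -> sub_space Z J).
  move=> _ B mB; rewrite setTI.
  apply: (smallest_sub (@sigma_algebra_measurable _ (sub_space Z J')) _ mB).
  move=> _ [F [A [uF FJ mA ->]]]; apply: sub_sigma_algebra.
  by exists F, A; split => // j /FJ/JJ'.
exact: (measurableT_comp mf mid).
Qed.

Lemma sub_measurable_sum (K : eqType) J (s : seq K) (f : K -> Omega -> R) :
  (forall i, i \in s -> sub_measurable J (f i)) ->
  sub_measurable J (fun w => \sum_(i <- s) f i w).
Proof.
elim: s => [|i s IH] H.
  rewrite (_ : (fun=> _) = fun=> 0); last by apply/funext => w; rewrite big_nil.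
  exact: measurable_cst.
rewrite (_ : (fun=> _) = (f i \+ fun w => \sum_(j <- s) f j w)); last first.
  by apply/funext => w; rewrite big_cons.
apply: measurable_funD; first by apply: H; rewrite mem_head.
by apply: IH => j js; apply: H; rewrite in_cons js orbT.
Qed.

Lemma ge0_has_meanM J J' f g m n : J `&` J' = set0 ->
  sub_measurable J f -> sub_measurable J' g ->
  (forall w, 0 <= f w) -> (forall w, 0 <= g w) ->
  has_mean P f m -> has_mean P g n -> has_mean P (fun w => f w * g w) (m * n).
Proof.
move=> JJ' mf mg f0 g0 fm gn; apply: ge0_has_mean.
- by apply: measurable_funM; [exact: has_mean_measurable fm|exact: has_mean_measurable gn].
- by move=> w; rewrite mulr_ge0.
pose h (z : sub_space Z J * sub_space Z J') : \bar R := (f z.1 * g z.2)%:E.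
transitivity (\int[P]_w h (w, w))%E => //.
rewrite (integral_sub_indep indepZ) //; first last.
- by move=> z; rewrite lee_fin mulr_ge0.
- apply/measurable_EFinP; apply: measurable_funM.
    exact: (measurableT_comp mf measurable_fst).
  exact: (measurableT_comp mg measurable_snd).
rewrite /h /=.
under eq_integral => w1 _.
  under eq_integral do rewrite EFinM.
  rewrite ge0_integralZl_EFin //; first last.
  - exact/measurable_EFinP/(has_mean_measurable gn).
  - by move=> w _; rewrite lee_fin.
  rewrite gn.2; over.
rewrite ge0_integralZr ?lee_fin //; first by rewrite fm.2.
- exact/measurable_EFinP/(has_mean_measurable fm).
- by move=> w _; rewrite lee_fin.
- exact: has_mean_ge0 gn.
Qed.

(** Positive and negative parts reduce this to the Tonelli case; both stay measurable for the same
    sub-sigma-algebra. *)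
Lemma has_meanM J J' f g m n : J `&` J' = set0 ->
  sub_measurable J f -> sub_measurable J' g ->
  has_mean P f m -> has_mean P g n -> has_mean P (fun w => f w * g w) (m * n).
Proof.
move=> JJ' mf mg fm gn.
have pos K (h : Omega -> R) p : sub_measurable K h -> has_mean P h p ->
  [/\ sub_measurable K h^\+, sub_measurable K h^\-,
      exists p', has_mean P h^\+ p' & exists p', has_mean P h^\- p'].
  move=> mh hp; have hn := has_mean_measurable hp.
  have hint := integrable_norm hp.1.
  have hbig : exists p', has_mean P (fun w => `|h w|) p'.
    exists (fine (\int[P]_w (`|h w|)%:E)); split => //.
    by rewrite fineK // (integrable_fin_num _ hint).
  have [p' hp'] := hbig.
  split; [exact: measurable_funrpos|exact: measurable_funrneg| |].
  - apply: has_mean_dominated hp'; first exact: measurable_funrpos.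
    by move=> w; rewrite ger0_norm ?funrpos_ge0 // /funrpos ge_max ler_norm normr_ge0.
  - apply: has_mean_dominated hp'; first exact: measurable_funrneg.
    move=> w; rewrite ger0_norm ?funrneg_ge0 // /funrneg ge_max normr_ge0 andbT.
    by rewrite -normrN ler_norm.
have [mfp mfn [f1 hf1] [f2 hf2]] := pos _ _ _ mf fm.
have [mgp mgn [g1 hg1] [g2 hg2]] := pos _ _ _ mg gn.
have fE w : f w = f^\+ w - f^\- w by have /(congr1 (@^~ w)) := funrposBneg f.
have gE w : g w = g^\+ w - g^\- w by have /(congr1 (@^~ w)) := funrposBneg g.
have -> : m = f1 - f2.
  by apply: has_mean_uniq fm _; apply: eq_has_mean (has_meanB hf1 hf2).
have -> : n = g1 - g2.
  by apply: has_mean_uniq gn _; apply: eq_has_mean (has_meanB hg1 hg2).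
have M := ge0_has_meanM JJ'.
have H1 := M _ _ _ _ mfp mgp (funrpos_ge0 _) (funrpos_ge0 _) hf1 hg1.
have H2 := M _ _ _ _ mfp mgn (funrpos_ge0 _) (funrneg_ge0 _) hf1 hg2.
have H3 := M _ _ _ _ mfn mgp (funrneg_ge0 _) (funrpos_ge0 _) hf2 hg1.
have H4 := M _ _ _ _ mfn mgn (funrneg_ge0 _) (funrneg_ge0 _) hf2 hg2.
have -> : (f1 - f2) * (g1 - g2) = f1 * g1 - f1 * g2 - (f2 * g1 - f2 * g2) by ring.
apply: eq_has_mean (has_meanB (has_meanB H1 H2) (has_meanB H3 H4)) => w.
by rewrite (fE w) (gE w); ring.
Qed.

(** Tower property: [g w1] is the mean given the variables of [J], and the function of interest is
    the diagonal of [f]. *)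
Lemma has_mean_tower J J' (f : sub_space Z J * sub_space Z J' -> R)
    (g : Omega -> R) m : J `&` J' = set0 ->
  measurable_fun setT f -> (forall z, 0 <= f z) ->
  (forall w1, has_mean P (fun w2 => f (w1, w2)) (g w1)) ->
  has_mean P g m -> has_mean P (fun w => f (w, w)) m.
Proof.
move=> JJ' mf f0 fg gm; apply: ge0_has_mean => //.
  have mid : measurable_fun setT (fun w : Omega => (w, w) : sub_space Z J * sub_space Z J').
    by apply: measurable_fun_pair; exact: to_sub_measurable.
  exact: (measurableT_comp mf mid).
rewrite (integral_sub_indep indepZ (f := EFin \o f)) //=; last exact/measurable_EFinP.
by under eq_integral do rewrite (fg _).2; rewrite gm.2.
Qed.

(** A lower bound [g] of the conditional probability is enough, and it may take negative values:
    this is what allows a polynomial bound later. *)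
Lemma sub_indep_prob_ge J J' (V : set (sub_space Z J * sub_space Z J'))
    (g : Omega -> R) m : J `&` J' = set0 -> measurable V -> has_mean P g m ->
  (forall w1 : Omega, (g w1)%:E <= P [set w2 : Omega | V (w1, w2)])%E ->
  (m%:E <= P [set w : Omega | V (w, w)])%E.
Proof.
move=> JJ' mV gm gV.
have mid : measurable_fun setT (fun w : Omega => (w, w) : sub_space Z J * sub_space Z J').
  by apply: measurable_fun_pair; exact: to_sub_measurable.
have mslice w1 : measurable [set w2 : Omega | V (w1, w2)].
  have mp : measurable_fun setT (fun w2 : Omega => (w1, w2) : sub_space Z J * sub_space Z J').
    by apply: measurable_fun_pair; [exact: measurable_cst|exact: to_sub_measurable].
  by rewrite -[X in measurable X]setTI; exact: mp.
have mdiag : measurable [set w : Omega | V (w, w)].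
  by rewrite -[X in measurable X]setTI; exact: mid.
have sliceE w1 : (\int[P]_w2 (\1_V (w1, w2))%:E = P [set w2 : Omega | V (w1, w2)])%E.
  rewrite (_ : (fun w2 => _) = (fun w2 => (\1_[set w2 | V (w1, w2)] w2)%:E)).
    by rewrite integral_indic ?setIT.
  by apply/funext => w; rewrite !indicE.
have -> : P [set w | V (w, w)] = (\int[P]_w (\1_V (w, w))%:E)%E.
  rewrite (_ : (fun w => (\1_V (w, w))%:E) = (fun w => (\1_[set w | V (w, w)] w)%:E)).
    by rewrite integral_indic ?setIT.
  by apply/funext => w; rewrite !indicE.
have mVE : measurable_fun setT (fun z : sub_space Z J * sub_space Z J' => (\1_V z)%:E : \bar R).
  by apply/measurable_EFinP; exact: measurable_indic.
have V0 (z : sub_space Z J * sub_space Z J') : (0 <= (\1_V z)%:E :> \bar R)%E by rewrite lee_fin.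
rewrite (integral_sub_indep indepZ (f := fun z => (\1_V z)%:E)) //.
have mI := measurable_integral_sub P mVE V0.
have [gi <-] := gm; apply: le_integral => //; last by move=> w _; rewrite sliceE.
apply: (@le_integrable _ _ _ _ _ measurableT _ (cst 1%E)) => //.
  by move=> w _; rewrite sliceE gee0_abs //= normr1 probability_le1.
exact: finite_measure_integrable_cst.
Qed.

Variable W : I -> Omega -> R.
Hypothesis mW : forall j, sub_measurable [set j] (W j).

Lemma sub_measurable_sum_seq (F : seq I) :
  sub_measurable [set` F] (fun w => \sum_(j <- F) W j w).
Proof.
apply: sub_measurable_sum => j jF.
have H : [set j] `<=` [set` F] by move=> i /= ->.
exact: sub_measurableS H (@mW j).
Qed.

Let disj j (F : seq I) : j \notin F -> [set j] `&` [set` F] = set0.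
Proof.
move=> jF; rewrite -subset0 => i /= [->] jF'; by rewrite jF' in jF.
Qed.

Lemma has_mean_sum_sqr (F : seq I) (m s : I -> R) : uniq F ->
  (forall j, j \in F -> has_mean P (W j) (m j)) ->
  (forall j, j \in F -> has_mean P (fun w => W j w ^+ 2) (s j)) ->
  has_mean P (fun w => (\sum_(j <- F) W j w) ^+ 2)
    (\sum_(j <- F) (s j - m j ^+ 2) + (\sum_(j <- F) m j) ^+ 2).
Proof.
elim: F => [|i F IH] /=.
  move=> _ _ _; rewrite !big_nil.
  by rewrite (_ : 0 + 0 ^+ 2 = 0); [apply: eq_has_mean (has_mean_cst P 0) => w; rewrite big_nil; ring|ring].
move=> /andP[iF uF] Hm Hs.
have Hm' j : j \in F -> has_mean P (W j) (m j) by move=> jF; apply: Hm; rewrite in_cons jF orbT.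
have Hs' j : j \in F -> has_mean P (fun w => W j w ^+ 2) (s j).
  by move=> jF; apply: Hs; rewrite in_cons jF orbT.
have Hi := Hm i (mem_head _ _); have Hi2 := Hs i (mem_head _ _).
have HF := has_mean_sum Hm'.
have HiF := has_meanM (disj iF) (@mW i) (@sub_measurable_sum_seq F) Hi HF.
rewrite !big_cons.
have -> : s i - m i ^+ 2 + \sum_(j <- F) (s j - m j ^+ 2) +
    (m i + \sum_(j <- F) m j) ^+ 2 = s i + (2 * (m i * \sum_(j <- F) m j)) +
    (\sum_(j <- F) (s j - m j ^+ 2) + (\sum_(j <- F) m j) ^+ 2) by ring.
apply: eq_has_mean (has_meanD (has_meanD Hi2 (has_meanZ 2 HiF)) (IH uF Hm' Hs')) => w.
by rewrite big_cons; ring.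
Qed.

(** Induction on [(W + S)^4]. Cross terms with a first power vanish because both means are zero,
    [6 v_i V] is part of [3 (v_i + V)^2], and [W^4 <= B^2 W^2]. *)
Lemma has_mean_sum_pow4 (F : seq I) (v : I -> R) (B : R) : uniq F ->
  (forall j w, j \in F -> `|W j w| <= B) ->
  (forall j, j \in F -> has_mean P (W j) 0) ->
  (forall j, j \in F -> has_mean P (fun w => W j w ^+ 2) (v j)) ->
  exists2 q, has_mean P (fun w => (\sum_(j <- F) W j w) ^+ 4) q &
    q <= 3 * (\sum_(j <- F) v j) ^+ 2 + B ^+ 2 * \sum_(j <- F) v j.
Proof.
elim: F => [|i F IH] /=.
  move=> _ _ _; exists 0; last by rewrite big_nil expr0n /= !mulr0 addr0.
  by apply: eq_has_mean (has_mean_cst P 0) => w; rewrite big_nil expr0n.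
move=> /andP[iF uF] HB Hm Hv.
have Hm' j : j \in F -> has_mean P (W j) 0 by move=> jF; apply: Hm; rewrite in_cons jF orbT.
have Hv' j : j \in F -> has_mean P (fun w => W j w ^+ 2) (v j).
  by move=> jF; apply: Hv; rewrite in_cons jF orbT.
have [q Hq qle] := IH uF (fun j w jF => HB j w (mem_behead (s := i :: F) jF)) Hm' Hv'.
have Hi := Hm i (mem_head _ _); have Hi2 := Hv i (mem_head _ _).
have WB w : W i w ^+ 2 <= B ^+ 2.
  have := HB i w (mem_head _ _) => H.
  by rewrite -[W i w ^+ 2]ger0_norm ?sqr_ge0// normrX lerXn2r ?nnegrE// (le_trans _ H).
have mWi := sub_measurableW (@mW i).
pose S w := \sum_(j <- F) W j w.
have mS : sub_measurable [set` F] S := @sub_measurable_sum_seq F.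
have HS : has_mean P S 0.
  have := has_mean_sum Hm'; by rewrite big1.
have HS2 : has_mean P (fun w => S w ^+ 2) (\sum_(j <- F) v j).
  have := has_mean_sum_sqr uF Hm' Hv'; rewrite [\sum_(j <- F) 0]big1 // expr0n /= addr0.
  by under eq_bigr do rewrite subr0.
have HW3 : exists m3, has_mean P (fun w => W i w ^+ 3) m3.
  apply: (@has_mean_bounded _ _ _ _ _ (B ^+ 3)); first exact: measurable_funX.
  move=> w; have H := HB i w (mem_head _ _); rewrite normrX.
  by rewrite lerXn2r ?nnegrE// (le_trans _ H).
have [m3 HWi3] := HW3.
have [q4 HWi4 q4le] : exists2 q4, has_mean P (fun w => W i w ^+ 4) q4 & q4 <= B ^+ 2 * v i.
  have [q4 HWi4] : exists q4, has_mean P (fun w => W i w ^+ 4) q4.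
    apply: (@has_mean_bounded _ _ _ _ _ (B ^+ 4)); first exact: measurable_funX.
    move=> w; have H := HB i w (mem_head _ _); rewrite normrX.
    by rewrite lerXn2r ?nnegrE// (le_trans _ H).
  exists q4 => //; apply: le_has_mean HWi4 (has_meanZ (B ^+ 2) Hi2) => w.
  have -> : W i w ^+ 4 = W i w ^+ 2 * W i w ^+ 2 by ring.
  by rewrite ler_wpM2r ?sqr_ge0.
(* This moment only has to exist, since it gets multiplied by a zero mean; [|x|^3 <= x^4 + x^2]
   suffices. *)
have HS3 : exists s3, has_mean P (fun w => S w ^+ 3) s3.
  have HD := has_meanD Hq HS2.
  apply: (has_mean_dominated _ _ HD).
    exact/measurable_funX/(sub_measurableW mS).
  move=> w; rewrite -/(S w) normrX -[S w ^+ 4]ger0_norm ?exprn_even_ge0 //.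
  rewrite -[S w ^+ 2]ger0_norm ?sqr_ge0 // !normrX.
  move: (normr_ge0 (S w)); move: `|S w| => x x0.
  rewrite -subr_ge0.
  have -> : x ^+ 4 + x ^+ 2 - x ^+ 3 = x ^+ 2 * ((x - 1/2) ^+ 2 + 3/4) by field.
  by rewrite mulr_ge0 ?sqr_ge0 // addr_ge0 ?sqr_ge0 //; lra.
have [s3 HSs3] := HS3.
have mX n : sub_measurable [set` F] (fun w => S w ^+ n) by exact: measurable_funX.
have mY n : sub_measurable [set i] (fun w => W i w ^+ n) by apply: measurable_funX; exact: (@mW i).
have E1 := has_meanM (disj iF) (@mY 3%N) mS HWi3 HS.
have E2 := has_meanM (disj iF) (@mY 2%N) (@mX 2%N) Hi2 HS2.
have E3 := has_meanM (disj iF) (@mW i) (@mX 3%N) Hi HSs3.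
exists (q4 + 4 * (m3 * 0) + 6 * (v i * \sum_(j <- F) v j) + 4 * (0 * s3) + q).
  apply: eq_has_mean (has_meanD (has_meanD (has_meanD (has_meanD HWi4
    (has_meanZ 4 E1)) (has_meanZ 6 E2)) (has_meanZ 4 E3)) Hq) => w.
  by rewrite big_cons -/(S w); ring.
rewrite big_cons.
have v0 : 0 <= v i by exact: has_mean_ge0 (fun w => sqr_ge0 _) Hi2.
move: qle; set V := \sum_(j <- F) v j => qle.
have := sqr_ge0 (v i).
nra.
Qed.

Lemma mutually_independent_comp (K : eqType) (tau : K -> I) : injective tau ->
  mutually_independent P (fun v => Z (tau v)).
Proof.
move=> inj F A uF mA.
(* The sets are transported along [tau] without an inverse: [A' (tau v)] is [A v], and [A' j] is the
   full set when [j] is not the image of an element of [F]. *)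
pose A' j := [set r | forall v, v \in F -> [set r' | tau v = j -> A v r'] r].
have A'E v : v \in F -> A' (tau v) = A v.
  move=> vF; apply/seteqP; split=> r /=; first by apply.
  by move=> Ar u _ /inj ->.
have mA' j : measurable (A' j).
  apply: measurable_forall_seq => v _; case: (eqVneq (tau v) j) => [E|/eqP E].
    by rewrite [X in measurable X](_ : _ = A v) //; apply/seteqP; split=> r //=; apply.
  by rewrite [X in measurable X](_ : _ = setT) //; apply/seteqP; split=> r //= _ /E.
have := indepZ (F := map tau F) (A := A') _ mA'; rewrite map_inj_uniq // => /(_ uF).
rewrite big_map => H.
rewrite (eq_big_seq (fun v => fine (P (Z (tau v) @^-1` A' (tau v))))); last first.
  by move=> v vF; rewrite A'E.
rewrite -H; congr (P _); apply/seteqP; split=> w /=.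
  by move=> Aw _ /mapP[v vF ->]; rewrite A'E //; exact: Aw.
by move=> Aw v vF; rewrite -A'E //; apply: Aw; exact: map_f.
Qed.

End IndependentMoments.

Lemma has_mean_lin_sqr {R : realType} {d} {Omega : measurableType d}
    (P : probability Omega R) (I K : eqType) (Z : I -> {mfun Omega >-> R})
    (tau : K -> I) (F : seq K) (a : K -> R) (m s : R) :
  mutually_independent P Z -> injective tau -> uniq F ->
  (forall v, v \in F -> has_mean P (Z (tau v)) m) ->
  (forall v, v \in F -> has_mean P (fun w => Z (tau v) w ^+ 2) s) ->
  has_mean P (fun w => (\sum_(v <- F) a v * Z (tau v) w) ^+ 2)
    ((s - m ^+ 2) * \sum_(v <- F) a v ^+ 2 + m ^+ 2 * (\sum_(v <- F) a v) ^+ 2).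
Proof.
move=> indepZ inj uF Hm Hs.
have mW v : sub_measurable (fun v => Z (tau v)) [set v] (fun w => a v * Z (tau v) w).
  apply: measurable_funM => //.
  exact: (@sub_space_measurable _ _ _ _ (fun v => Z (tau v)) [set v] v erefl).
have := has_mean_sum_sqr (mutually_independent_comp indepZ inj) mW uF
  (fun v vF => has_meanZ (a v) (Hm v vF)).
move=> /(_ (fun v => a v ^+ 2 * s)) H.
rewrite (_ : _ + _ = \sum_(v <- F) (a v ^+ 2 * s - (a v * m) ^+ 2) +
    (\sum_(v <- F) a v * m) ^+ 2).
  apply: H => v vF; apply: eq_has_mean (has_meanZ (a v ^+ 2) (Hs v vF)) => w.
  by rewrite exprMn.
rewrite -mulr_suml exprMn mulrC [m ^+ 2 * _]mulrC; congr (_ + _).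
rewrite mulr_suml; apply: eq_bigr => v _; ring.
Qed.

(** * Offspring numbers, flips and signed features *)

(* Finite sets of words closed under taking parents, children before parents. *)
Fixpoint leaf_first (F : seq vertex) : bool :=
  if F is v :: F' then
    [&& v \notin F', (if v is _ :: u then u \in F' else true) & leaf_first F']
  else true.

Lemma leaf_first_uniq F : leaf_first F -> uniq F.
Proof. by elim: F => //= v F IH /and3P[-> _ /IH]. Qed.

Lemma leaf_first_closed F i u : leaf_first F -> i :: u \in F -> u \in F.
Proof.
elim: F => //= v F IH /and3P[vF pv lF]; rewrite !in_cons => /orP[/eqP E|/IH->//].
  by move: pv; rewrite -E => ->; rewrite orbT.
by rewrite orbT.
Qed.

Lemma leaf_first_ex (L : seq vertex) :
  exists2 F, leaf_first F & {subset L <= F}.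
Proof.
elim: L => [|v L [F lF LF]]; first by exists [::].
suff [F' [lF' FF' vF']] : exists F', [/\ leaf_first F', {subset F <= F'} & v \in F'].
  by exists F' => // u; rewrite in_cons => /orP[/eqP->//|/LF/FF'].
elim: v => [|i u [F' [lF' FF' uF']]].
  have [nF|nF] := boolP ([::] \in F); first by exists F; split.
  exists ([::] :: F); split=> [|u uF|]; rewrite ?mem_head //= ?nF //.
  by rewrite in_cons uF orbT.
have [vF|vF] := boolP (i :: u \in F'); first by exists F'; split.
exists ((i :: u) :: F'); split=> [|x xF|]; rewrite ?mem_head //= ?vF ?uF' //.
by rewrite in_cons FF' ?orbT.
Qed.

(* Besides the offspring numbers ([cnt]), the independent variables of the tree are
   the flips ([flp]: the label of a vertex times that of its parent) and the signed
   features ([ftr]: [t (X v)] times the label of [v]). *)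
Definition index : eqType := (vertex + vertex + vertex)%type.
Definition cnt (v : vertex) : index := inl (inl v).
Definition flp (v : vertex) : index := inl (inr v).
Definition ftr (v : vertex) : index := inr v.

Section TreeLaw.
Context {R : realType} {d : nat} {dO : measure_display}
  {Omega : measurableType dO}.
Variables (P : probability Omega R) (Delta gamma : R)
  (Pp Pm : probability (d.-tuple R) R)
  (C : vertex -> Omega -> nat) (y : vertex -> Omega -> bool)
  (X : vertex -> Omega -> d.-tuple R).
Hypothesis tree : is_broadcast_tree P Delta gamma Pp Pm C y X.
Variable t : d.-tuple R -> R.
Hypothesis mt : measurable_fun setT t.
Hypothesis tsym : forall A : set R, measurable A ->
  Pm [set x | A (- t x)] = Pp [set x | A (t x)].
Hypothesis Delta_gt0 : 0 < Delta.

(** At the root the label itself counts as a flip, so that every label is the product of the flips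
    on the path to the root. *)
Definition flip (v : vertex) (w : Omega) : bool :=
  if v is _ :: u then y v w == y u w else y v w.

Definition feature (v : vertex) (w : Omega) : R :=
  if y v w then t (X v w) else - t (X v w).

Definition flip_pmf (v : vertex) (f : bool) : R :=
  if v is _ :: _ then (if f then (1 + gamma) / 2 else (1 - gamma) / 2) else 1 / 2.

Definition flip_law (v : vertex) (b : set bool) : R :=
  (if `[< b true >] then flip_pmf v true else 0) +
  (if `[< b false >] then flip_pmf v false else 0).

Definition count_law (a : set nat) : R := fine (poisson_prob Delta 0 a).

Definition feature_law (A : set R) : R := fine (Pp [set x | A (t x)]).

Lemma count_measurable v (a : set nat) : measurable [set w | a (C v w)].
Proof.
have [mC _ _ _] := tree.
rewrite (_ : [set w | _] = \bigcup_(n in a) [set w | C v w = n]).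
  by apply: bigcup_measurable.
by apply/seteqP; split=> w /=; [by exists (C v w)|case=> n an /= ->].
Qed.

Lemma label_measurable v (b : set bool) : measurable [set w | b (y v w)].
Proof.
have [_ my _ _] := tree.
rewrite (_ : [set w | _] = ((if `[< b true >] then [set w | y v w = true] else set0)
  `|` (if `[< b false >] then [set w | y v w = false] else set0))).
  by apply: measurableU; case: ifP.
apply/seteqP; split=> w /=.
  by case E: (y v w) => bE; [left|right]; case: asboolP.
by move=> []; case: asboolP => // ? /= ->.
Qed.

Lemma label_fun_measurable v : measurable_fun setT (y v).
Proof. by move=> _ B _; rewrite setTI; exact: label_measurable. Qed.

Lemma flip_measurable v (b : set bool) : measurable [set w | b (flip v w)].
Proof.
case: v => [|i u]; first exact: label_measurable.
rewrite (_ : [set w | _] =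
  ([set w | y u w] `&` [set w | [set e | b (e == true)] (y (i :: u) w)]) `|`
  ([set w | ~~ y u w] `&` [set w | [set e | b (e == false)] (y (i :: u) w)])).
  apply: measurableU; apply: measurableI; try exact: label_measurable.
  exact: (label_measurable u [set e | ~~ e]).
apply/seteqP; split=> w /=; first by case: (y u w) => bE; [left|right].
by case: (y u w) => /= -[] [].
Qed.

Lemma feature_measurable v : measurable_fun setT (feature v).
Proof.
have [_ _ mX _] := tree.
have mtX : measurable_fun setT (fun w => t (X v w)) by exact: measurableT_comp.
rewrite /feature; apply: measurable_fun_ifT => //.
  exact: label_fun_measurable.
exact: measurable_funN.
Qed.

Lemma feature_measurable_set v (A : set R) : measurable A ->
  measurable [set w | A (feature v w)].
Proof. by move=> mA; rewrite -[X in measurable X]setTI; exact: feature_measurable. Qed.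

(* On [F2] offspring numbers and labels are prescribed exactly, as in
   [is_broadcast_tree]; on [F1] only sets of offspring numbers and of flips are.
   Since no vertex of [F1] has a child in [F2], the vertices of a leaf-first list
   can be summed out one at a time, moving them from [F2] to [F1]. *)
Definition exact_event (F1 F2 : seq vertex) (a : vertex -> set nat)
    (b : vertex -> set bool) (n : vertex -> nat) (s : vertex -> bool)
    (A : vertex -> set R) : set Omega :=
  [set w | forall v, v \in F1 -> a v (C v w) /\ b v (flip v w)] `&`
  [set w | forall v, v \in F2 -> C v w = n v /\ y v w = s v] `&`
  [set w | forall v, v \in F1 ++ F2 -> A v (feature v w)].

Lemma exact_event_measurable F1 F2 a b n s A : (forall v, measurable (A v)) ->
  measurable (exact_event F1 F2 a b n s A).
Proof.
move=> mA; apply: measurableI; first apply: measurableI.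
- apply: measurable_forall_seq => v _; apply: measurableI.
    exact: count_measurable.
  exact: flip_measurable.
- apply: measurable_forall_seq => v _; apply: measurableI.
    exact: (count_measurable v [set n v]).
  exact: (label_measurable v [set s v]).
- by apply: measurable_forall_seq => v _; exact: feature_measurable_set.
Qed.

Definition set_at {T : Type} (f : vertex -> T) v x u := if u == v then x else f u.

(** The parent of [v] is in [F2], where its label is prescribed; prescribing the label of [v]
    therefore prescribes its flip as well. *)
Lemma exact_event_rcons F1 F2 v a b n s A m e :
  leaf_first (v :: F2) ->
  exact_event (rcons F1 v) F2 a b n s A `&` [set w | C v w = m]
    `&` [set w | y v w = e] =
  if `[< a v m /\ b v (if v is _ :: u then e == s u else e) >]
  then exact_event F1 (v :: F2) a b (set_at n v m) (set_at s v e) A else set0.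
Proof.
move=> /= /and3P[vF pv lF].
have flipE w : exact_event (rcons F1 v) F2 a b n s A w \/
    (forall u, u \in F2 -> y u w = s u) -> y v w = e ->
    flip v w = (if v is _ :: u then e == s u else e).
  move=> H; rewrite /flip; case: {vF}v pv H => [_ _ -> //|i u uF H ->].
  case: H => [[[_ H] _]|H]; first by rewrite (H u uF).2.
  by rewrite H.
apply/seteqP; split=> w /=.
  move=> [[Ew Cm] ye].
  have [[H1 H2] H3] := Ew.
  have := H1 v; rewrite mem_rcons mem_head => /(_ isT) [av bv].
  rewrite (flipE w (or_introl Ew) ye) Cm in av bv.
  case: asboolP => [_|]; last by case.
  split; first split.
  - by move=> u uF; apply: H1; rewrite mem_rcons in_cons uF orbT.
  - move=> u; rewrite in_cons /set_at; case: eqVneq => [-> _|_ /= /H2//].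
    by rewrite Cm ye.
  - by move=> u uF; apply: H3; rewrite cat_rcons.
case: asboolP => // -[av bv] [[H1 H2] H3].
have [Cm ye] : C v w = m /\ y v w = e.
  by have := H2 v; rewrite mem_head /set_at eqxx => /(_ isT).
have yF u : u \in F2 -> C u w = n u /\ y u w = s u.
  move=> uF; have := H2 u; rewrite in_cons uF orbT /set_at => /(_ isT).
  by case: eqVneq => // E; rewrite -E uF in vF.
split; last by [].
split; last by [].
split; first split.
- move=> u; rewrite mem_rcons in_cons => /orP[/eqP->|]; last exact: H1.
  rewrite Cm (flipE w _ ye) //; right=> x xF; exact: (yF x xF).2.
- exact: yF.
- by move=> u uF; apply: H3; rewrite -cat_rcons.
Qed.

Definition exact_law (n : vertex -> nat) (s : vertex -> bool)
    (A : vertex -> set R) v : R :=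
  poisson_pmf Delta (n v) * label_prob gamma s v * feature_law (A v).

Definition free_law (a : vertex -> set nat) (b : vertex -> set bool)
    (A : vertex -> set R) v : R :=
  count_law (a v) * flip_law v (b v) * feature_law (A v).

Lemma exact_event_prob F1 F2 a b n s A : leaf_first (F1 ++ F2) ->
  (forall v, measurable (A v)) ->
  P (exact_event F1 F2 a b n s A) =
  ((\prod_(v <- F1) free_law a b A v) * \prod_(v <- F2) exact_law n s A v)%:E.
Proof.
move=> + mA; elim/last_ind: F1 F2 n s => [|F1 v IH] F2 n s lF.
  have [_ _ _ law] := tree.
  (* Under a prescribed label, an event on the signed feature is an event on the feature, and [tsym]
     gives it the same probability for both labels. Hence [feature_law] does not involve [s]. *)
  pose A' v := if s v then [set x | A v (t x)] else [set x | A v (- t x)].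
  have mA' v : measurable (A' v).
    rewrite /A'; case: (s v); rewrite -[X in measurable X]setTI.
      by apply: mt.
    by apply: (measurable_funN mt).
  have := law F2 n s A' (leaf_first_uniq lF)
    (fun i u => @leaf_first_closed F2 i u lF) mA'.
  rewrite big_nil mul1r => H.
  transitivity (P [set w | forall v, v \in F2 -> [/\ C v w = n v, y v w = s v
     & A' v (X v w)]]).
    congr (P _); apply/seteqP; split=> w /=.
      move=> [[_ H2] H3] v vF; have [-> yv] := H2 v vF; split => //.
      by have := H3 v vF; rewrite /feature /A' yv; case: (s v).
    move=> H2; split; first by split=> // v vF; have [] := H2 v vF.
    move=> v vF; have [_ yv] := H2 v vF.
    by rewrite /feature /A' yv; case: (s v).
  rewrite H; congr _%:E; apply: eq_bigr => v _; rewrite /exact_law.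
  congr (_ * _); rewrite /A' /feature_law; case: (s v) => //=.
  by rewrite tsym.
rewrite cat_rcons in lF.
have lvF : leaf_first (v :: F2) by elim: F1 {IH} lF => //= u F1 IH /and3P[_ _]; exact: IH.
have vF2 : v \notin F2 by case/and3P: lvF.
pose K := (\prod_(u <- F1) free_law a b A u) *
  (feature_law (A v) * \prod_(u <- F2) exact_law n s A u).
pose fl e := if v is _ :: u then e == s u else e.
have EP m e : P (exact_event (rcons F1 v) F2 a b n s A `&` [set w | C v w = m]
    `&` [set w | y v w = e]) =
    ((if `[< a v m >] then poisson_pmf Delta m else 0) *
     ((if `[< b v (fl e) >] then flip_pmf v (fl e) else 0) * K))%:E.
  rewrite exact_event_rcons //.
  case: (asboolP (_ /\ _)) => [[am bm]|nab]; last first.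
    rewrite measure0; case: asboolP => am; last by rewrite mul0r.
    case: asboolP => bm; last by rewrite mul0r mulr0.
    by case: nab.
  case: asboolP => // _; case: asboolP => // _.
  rewrite IH // big_cons /K; congr _%:E.
  have -> : \prod_(u <- F2) exact_law (set_at n v m) (set_at s v e) A u =
      \prod_(u <- F2) exact_law n s A u.
    apply: eq_big_seq => u uF; rewrite /exact_law /set_at.
    have uv : u == v = false by apply: contraNF vF2 => /eqP <-.
    rewrite uv; congr (_ * _ * _); case: u uF uv => //= i u uF uv.
    have -> : (u == v) = false; last by rewrite uv.
    apply: contraNF vF2 => /eqP <-; apply: (leaf_first_closed _ uF).
    by move: lvF => /= /and3P[].
  rewrite /exact_law {1}/set_at eqxx.
  have -> : label_prob gamma (set_at s v e) v = flip_pmf v (fl e).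
    rewrite /fl /label_prob /set_at /flip_pmf; move: vF2 lvF; clear.
    case: v => // i u vF2 lvF; rewrite eqxx.
    have -> : (u == i :: u) = false by apply/eqP => /(congr1 size)/=/n_Sn.
    by case: eqP.
  by ring.
have mE := exact_event_measurable (rcons F1 v) F2 a b n s mA.
have EP2 m : P (exact_event (rcons F1 v) F2 a b n s A `&` [set w | C v w = m]) =
    ((if `[< a v m >] then poisson_pmf Delta m else 0) * (flip_law v (b v) * K))%:E.
  have mEm : measurable (exact_event (rcons F1 v) F2 a b n s A `&` [set w | C v w = m]).
    by apply: measurableI => //; exact: (count_measurable v [set m]).
  have my e : measurable [set w | y v w = e] by exact: (label_measurable v [set e]).
  have -> : exact_event (rcons F1 v) F2 a b n s A `&` [set w | C v w = m] =
      (exact_event (rcons F1 v) F2 a b n s A `&` [set w | C v w = m] `&` [set w | y v w = true])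
      `|` (exact_event (rcons F1 v) F2 a b n s A `&` [set w | C v w = m]
        `&` [set w | y v w = false]).
    apply/seteqP; split=> w /=; last by case=> -[].
    by move=> H; case: (y v w); [left|right].
  rewrite measureU; [|exact: measurableI|exact: measurableI|]; last first.
    by rewrite -subset0 => w /= [[_ ->] [_]].
  rewrite [X in (X + _)%E]EP [X in (_ + X)%E]EP -EFinD -mulrDr -mulrDl.
  (* The label of the parent only permutes the two values of the flip, so the sum over both labels
     of [v] does not depend on it. *)
  congr (_ * (_ * _))%:E; rewrite /flip_law /fl.
  case: v {fl vF2 lvF K EP mE mEm my IH lF} => // i u.
  by case: (s u) => /=; [|rewrite addrC].
have -> : exact_event (rcons F1 v) F2 a b n s A =
   \bigcup_(m in a v) (exact_event (rcons F1 v) F2 a b n s A `&` [set w | C v w = m]).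
  rewrite -setI_bigcupr; apply/seteqP; split=> w /=; last by case.
  move=> Ew; split=> //; exists (C v w) => //.
  by have [[H1 _] _] := Ew; have [] := H1 v; rewrite ?mem_rcons ?mem_head.
rewrite measure_bigcup; first last.
- by move=> m m' _ _ [w /= [[_ <-] [_ <-]]].
- by move=> m _; apply: measurableI => //; exact: (count_measurable v [set m]).
rewrite (eq_eseriesr (g := fun m =>
    ((flip_law v (b v) * K)%:E * (poisson_pmf Delta m)%:E)%E)); last first.
  by move=> m /set_mem am; rewrite [LHS]EP2; case: asboolP => // _; rewrite mulrC EFinM.
rewrite nneseriesZl; last by move=> m _; rewrite lee_fin poisson_pmf_ge0.
rewrite nneseries_esum; last by move=> m _; rewrite lee_fin poisson_pmf_ge0.
have -> : (\esum_(m in [set x | x \in a v]) (poisson_pmf Delta m)%:E =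
    (count_law (a v))%:E)%E.
  rewrite /count_law fineK ?fin_num_measure // /poisson_prob Delta_gt0.
  by rewrite set_mem_set.
rewrite -EFinM big_rcons /= /K /free_law; congr _%:E; ring.
Qed.

Definition tree_var (j : index) (w : Omega) : R :=
  match j with
  | inl (inl v) => (C v w)%:R
  | inl (inr v) => if flip v w then 1 else - 1
  | inr v => feature v w
  end.

Lemma tree_var_measurable j : measurable_fun setT (tree_var j).
Proof.
case: j => [[v|v]|v]; last exact: feature_measurable.
  by move=> _ B _; rewrite setTI; exact: (count_measurable v [set n | B n%:R]).
by move=> _ B _; rewrite setTI; exact: (flip_measurable v [set e | B (if e then 1 else - 1)]).
Qed.

Definition tree_rv (j : index) : {mfun Omega >-> R} :=
  HB.pack (tree_var j) (isMeasurableFun.Build _ _ _ _ (tree_var j) (tree_var_measurable j)).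

Definition index_law (j : index) (A : set R) : R :=
  match j with
  | inl (inl v) => count_law [set n | A n%:R]
  | inl (inr v) => flip_law v [set e | A (if e then 1 else - 1)]
  | inr v => feature_law A
  end.

Lemma index_lawT j : index_law j setT = 1.
Proof.
case: j => [[v|v]|v] /=.
- by rewrite /count_law (_ : [set n | _] = setT) ?probability_setT.
- rewrite /flip_law !asboolT //.
  by case: v => [|i u] /=; field.
- by rewrite /feature_law (_ : [set n | _] = setT) ?probability_setT.
Qed.

(** A finite set of indices is padded to a parent-closed set of words; the added indices carry the
    full set, of mass 1. *)
Lemma tree_joint_law (F : seq index) (A : index -> set R) : uniq F ->
  (forall j, measurable (A j)) ->
  P [set w | forall j, j \in F -> A j (tree_rv j w)] =
  (\prod_(j <- F) index_law j (A j))%:E.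
Proof.
move=> uF mA.
pose word (j : index) : vertex :=
  match j with inl (inl v) => v | inl (inr v) => v | inr v => v end.
have [V lV FV] := leaf_first_ex (map word F).
pose A' j := if j \in F then A j else setT.
have mA' j : measurable (A' j) by rewrite /A'; case: ifP.
have wV j : j \in F -> word j \in V by move=> jF; apply/FV/map_f.
transitivity (P (exact_event V [::] (fun v => [set n | A' (cnt v) n%:R])
   (fun v => [set e | A' (flp v) (if e then 1 else - 1)]) (fun=> 0%N) (fun=> true)
   (fun v => A' (ftr v)))).
  congr (P _); apply/seteqP; split=> w /=.
    move=> H; split; first split=> //.
      move=> v _; split; rewrite /A'; case: ifP => // jF.
        exact: (H (cnt v) jF).
      exact: (H (flp v) jF).
    move=> v _; rewrite /A'; case: ifP => // jF; exact: (H (ftr v) jF).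
  move=> [[H1 _] H2] j jF; have := wV j jF.
  case: j jF => [[v|v]|v] jF vV.
  - by have [+ _] := H1 v vV; rewrite /A' /= /cnt jF.
  - by have [_ +] := H1 v vV; rewrite /A' /= /flp jF.
  - by have := H2 v; rewrite cats0 => /(_ vV); rewrite /A' /ftr jF.
rewrite exact_event_prob ?cats0 // big_nil mulr1; congr _%:E.
pose V3 := map cnt V ++ map flp V ++ map ftr V.
transitivity (\prod_(j <- V3) index_law j (A' j)).
  by rewrite !big_cat !big_map /= -!big_split /=; apply: eq_bigr => v _; rewrite mulrA.
have uV3 : uniq V3.
  have uV := leaf_first_uniq lV.
  rewrite !cat_uniq !map_inj_uniq ?uV /=; try by move=> ? ? [].
  rewrite andbT; apply/andP; split; apply/hasPn => j.
    by rewrite mem_cat => /orP[] /mapP[v _ ->]; apply/mapP => -[].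
  by move=> /mapP[v _ ->]; apply/mapP => -[].
transitivity (\prod_(j <- V3 | j \in F) index_law j (A j)).
  rewrite [RHS]big_mkcond; apply: eq_bigr => j _; rewrite /A'; case: ifP => // _.
  exact: index_lawT.
rewrite -big_filter; apply: perm_big; apply: uniq_perm => //.
  exact: filter_uniq.
move=> j; rewrite mem_filter; case jF: (j \in F) => //=.
have := wV j jF; rewrite !mem_cat.
by case: {jF} j => [[v|v]|v] vV; apply/or3P;
  [constructor 1|constructor 2|constructor 3]; exact: map_f.
Qed.

Lemma tree_var_law j (A : set R) : measurable A ->
  P (tree_rv j @^-1` A) = (index_law j A)%:E.
Proof.
move=> mA; have := @tree_joint_law [:: j] (fun=> A) isT (fun=> mA).
rewrite big_seq1 => <-; congr (P _); apply/seteqP; split=> w /=.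
  by move=> Aw i; rewrite inE => /eqP ->.
by apply; rewrite mem_head.
Qed.

Lemma tree_independent : mutually_independent P tree_rv.
Proof.
move=> F A uF mA; rewrite tree_joint_law //; congr _%:E.
by apply: eq_bigr => j _; rewrite tree_var_law.
Qed.

End TreeLaw.

(** * Moments of offspring numbers, flips and features *)

Lemma has_mean_same_law {R : realType} {d1 d2 : measure_display}
    {T1 : measurableType d1} {T2 : measurableType d2}
    (P1 : probability T1 R) (P2 : probability T2 R)
    (X1 : {mfun T1 >-> R}) (X2 : {mfun T2 >-> R}) (f : R -> R) (m : R) :
  (forall A, measurable A -> P1 (X1 @^-1` A) = P2 (X2 @^-1` A)) ->
  measurable_fun setT f ->
  has_mean P1 (fun w => f (X1 w)) m -> has_mean P2 (fun w => f (X2 w)) m.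
Proof.
move=> law mf [fi fm].
have mfE : measurable_fun setT (EFin \o f) by exact/measurable_EFinP.
have abs : (\int[P2]_w `|(f (X2 w))%:E| = \int[P1]_w `|(f (X1 w))%:E|)%E.
  transitivity (\int[distribution P2 X2]_z `|(f z)%:E|)%E.
    by rewrite ge0_integral_distribution //; exact: measurableT_comp.
  rewrite (eq_measure_integral (distribution P1 X1)).
    by rewrite ge0_integral_distribution //; exact: measurableT_comp.
  by move=> A mA _; exact/esym/law.
have fi2 : P2.-integrable setT (fun w => (f (X2 w))%:E).
  apply/integrableP; split; first exact/measurable_EFinP/measurableT_comp.
  by rewrite abs; case/integrableP: fi.
split=> //; rewrite -fm.
transitivity (\int[distribution P2 X2]_z (f z)%:E)%E.
  by rewrite integral_distribution.
rewrite (eq_measure_integral (distribution P1 X1)).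
  by rewrite integral_distribution.
by move=> A mA _; exact/esym/law.
Qed.

(** Factorial moments, because [n ^_ k / n! = 1 / (n - k)!] turns the series into [r^k] times the
    total mass. *)
Lemma poisson_ffact_series {R : realType} (r : R) (k : nat) : 0 < r ->
  (\sum_(n <oo) ((n ^_ k)%:R * poisson_pmf r n)%:E = (r ^+ k)%:E)%E.
Proof.
move=> r0.
have f0 n : (0 <= ((n ^_ k)%:R * poisson_pmf r n)%:E)%E.
  by rewrite lee_fin mulr_ge0 // poisson_pmf_ge0.
rewrite (nneseries_split 0 k) // add0n big_nat_cond big1 ?add0e; last first.
  by move=> n; rewrite andbT => nk; rewrite ffact_small // mul0r.
rewrite -(nneseries_addn k f0).
rewrite (eq_eseriesr (g := fun n => ((r ^+ k)%:E * (poisson_pmf r n)%:E)%E)); last first.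
  move=> n _; rewrite -EFinM /poisson_pmf r0; congr _%:E.
  have := ffact_fact (leq_addl n k); rewrite addnK => <-.
  have n0 : (n`!)%:R != 0 :> R by rewrite pnatr_eq0 -lt0n fact_gt0.
  have k0 : ((n + k) ^_ k)%:R != 0 :> R.
    by rewrite pnatr_eq0 -lt0n ffact_gt0 leq_addl.
  by rewrite natrM exprD; field; rewrite n0 k0.
rewrite nneseriesZl; last by move=> n _; rewrite lee_fin poisson_pmf_ge0.
rewrite nneseries_esumT; last by move=> n; rewrite lee_fin poisson_pmf_ge0.
have := probability_setT (poisson_prob r 0); rewrite /= /poisson_prob r0 => ->.
by rewrite mule1.
Qed.

Section TreeMoments.
Context {R : realType} {d : nat} {dO : measure_display}
  {Omega : measurableType dO}.
Variables (P : probability Omega R) (Delta gamma : R)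
  (Pp Pm : probability (d.-tuple R) R)
  (C : vertex -> Omega -> nat) (y : vertex -> Omega -> bool)
  (X : vertex -> Omega -> d.-tuple R).
Hypothesis tree : is_broadcast_tree P Delta gamma Pp Pm C y X.
Variable t : d.-tuple R -> R.
Hypothesis mt : measurable_fun setT t.
Hypothesis tsym : forall A : set R, measurable A ->
  Pm [set x | A (- t x)] = Pp [set x | A (t x)].
Hypothesis Delta_gt0 : 0 < Delta.

Let Z := tree_rv tree mt.

Lemma count_pmf v n : P [set w | C v w = n] = (poisson_pmf Delta n)%:E.
Proof.
transitivity (P (Z (cnt v) @^-1` [set n%:R])).
  congr (P _); apply/seteqP; split=> w /=; first by move=> ->.
  by move/eqP; rewrite eqr_nat => /eqP.
rewrite (tree_var_law tree mt tsym Delta_gt0) //; congr _%:E => /=.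
rewrite /count_law /poisson_prob Delta_gt0.
rewrite (_ : [set m | _] = [set n]).
  by rewrite esum_set1 // lee_fin poisson_pmf_ge0.
by apply/seteqP; split=> m /=; [move/eqP; rewrite eqr_nat => /eqP|move=> ->].
Qed.

Lemma count_ffact_mean v k :
  has_mean P (fun w => ((C v w) ^_ k)%:R : R) (Delta ^+ k).
Proof.
have mC (a : set nat) : measurable [set w | a (C v w)] := count_measurable tree v a.
have mf : measurable_fun setT (fun w => ((C v w) ^_ k)%:R : R).
  by move=> _ B _; rewrite setTI; exact: (mC [set n | B (n ^_ k)%:R]).
apply: ge0_has_mean => //.
have UC : \bigcup_n [set w | C v w = n] = setT.
  by apply/seteqP; split=> w // _; exists (C v w).
rewrite -UC ge0_integral_bigcup //; first last.
- by move=> m n _ _ [w /= [<- <-]].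
- by apply/measurable_EFinP; rewrite UC.
- by move=> n; exact: (mC [set n]).
rewrite -poisson_ffact_series //; apply: eq_eseriesr => n _.
rewrite (eq_integral (cst ((n ^_ k)%:R%:E : \bar R))); last first.
  by move=> w /set_mem /= ->.
rewrite integral_cst; last exact: (mC [set n]).
by rewrite EFinM; congr (_ * _)%E; exact: count_pmf.
Qed.

Lemma count_mean v : has_mean P (Z (cnt v)) Delta.
Proof.
rewrite -[Delta]expr1; apply: eq_has_mean (count_ffact_mean v 1) => w.
by rewrite ffactn1.
Qed.

Lemma count_sqr_mean v :
  has_mean P (fun w => Z (cnt v) w ^+ 2) (Delta ^+ 2 + Delta).
Proof.
have := has_meanD (count_ffact_mean v 2) (count_ffact_mean v 1).
rewrite expr1; apply: eq_has_mean => w; rewrite ffactnSr ffactn1 /=.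
by case: (C v w) => [|n]; [ring|rewrite subn1 /= natrM -natr1; ring].
Qed.

Lemma flip_mean i u : has_mean P (Z (flp (i :: u))) gamma.
Proof.
pose E := [set w | flip y (i :: u) w].
have mE : measurable E := flip_measurable tree (i :: u) [set e | e].
have PE : P E = ((1 + gamma) / 2)%:E.
  transitivity (P (Z (flp (i :: u)) @^-1` [set 1])).
    congr (P _); apply/seteqP; split=> w /=; rewrite /E /=; first by move=> ->.
    by case: ifP => // _ /eqP; rewrite eqNr oner_eq0.
  rewrite (tree_var_law tree mt tsym Delta_gt0) //; congr _%:E => /=.
  rewrite /flip_law asboolT // asboolF ?addr0 //= => /eqP.
  by rewrite eqNr oner_eq0.
have HE : has_mean P (\1_E : Omega -> R) ((1 + gamma) / 2).
  split; first exact: integrable_indic.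
  by rewrite integral_indic // setIT.
have := has_meanB (has_meanZ 2 HE) (has_mean_cst P 1).
rewrite (_ : 2 * _ - 1 = gamma); last by field.
apply: eq_has_mean => w; rewrite indicE /E /=.
case: (boolP (w \in _)); rewrite ?notin_setE ?in_setE /=.
  by move=> ->; ring.
by move/negP/negbTE => ->; ring.
Qed.

Lemma feature_mean v (f : R -> R) m : measurable_fun setT f ->
  has_mean Pp (fun x => f (t x)) m -> has_mean P (fun w => f (Z (ftr v) w)) m.
Proof.
move=> mf.
have mt' := isMeasurableFun.Build _ _ _ _ t mt.
pose t' : {mfun (d.-tuple R) >-> R} := HB.pack t mt'.
apply: (@has_mean_same_law _ _ _ _ _ Pp P t' (Z (ftr v))) => // A mA.
rewrite (tree_var_law tree mt tsym Delta_gt0) //= /feature_law fineK //.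
by rewrite fin_num_measure // -[X in measurable X]setTI; exact: mt.
Qed.

End TreeMoments.

(** * Branching moments *)

Section Generation.
Implicit Types (c : vertex -> nat) (u v : vertex).

Lemma big_generationS {R : nmodType} c k (f : vertex -> R) :
  \sum_(v <- generation c k.+1) f v =
  \sum_(u <- generation c k) \sum_(i <- iota 0 (c u)) f (i :: u).
Proof. by rewrite /= big_allpairs_dep. Qed.

Lemma size_generation_vertex c k v : v \in generation c k -> size v = k.
Proof.
elim: k v => [|k IH] v /=; first by rewrite inE => /eqP ->.
by move=> /allpairsPdep[u [i [uk _ ->]]] /=; rewrite (IH u).
Qed.

Lemma generation_uniq c k : uniq (generation c k).
Proof.
elim: k => //= k IH; apply: allpairs_uniq_dep => //.
  by move=> u _; exact: iota_uniq.
by move=> [u i] [u' i'] _ _ /= [-> ->].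
Qed.

Lemma generationS_cons c k v : v \in generation c k.+1 ->
  exists i u, v = i :: u /\ u \in generation c k.
Proof. by move=> /= /allpairsPdep[u [i [uk _ ->]]]; exists i, u. Qed.

Lemma size_generationS c k :
  size (generation c k.+1) = (\sum_(u <- generation c k) c u)%N.
Proof.
rewrite /= size_allpairs_dep sumnE big_map.
by apply: eq_bigr => u _; rewrite size_iota.
Qed.

(** The index set varies with [w]. Peeling off the last generation moves the variation into an inner
    sum, where the countably many values of [c u] are treated one by one. *)
Lemma measurable_sum_generation {R : realType} {d} {T : measurableType d}
    (c : vertex -> T -> nat) (f : vertex -> T -> R) k :
  (forall v n, (size v < k)%N -> measurable [set w | c v w = n]) ->
  (forall v, size v = k -> measurable_fun setT (f v)) ->
  measurable_fun setT (fun w => \sum_(v <- generation (c ^~ w) k) f v w).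
Proof.
elim: k f => [|k IH] f mc mf.
  rewrite (_ : (fun _ => _) = f [::]); first exact: mf.
  by apply/funext => w; rewrite big_seq1.
rewrite (_ : (fun _ => _) = fun w => \sum_(u <- generation (c ^~ w) k)
    \sum_(i <- iota 0 (c u w)) f (i :: u) w); last first.
  by apply/funext => w; rewrite big_generationS.
apply: (IH (fun u w => \sum_(i <- iota 0 (c u w)) f (i :: u) w)) => [v n vk|u uk].
  by apply: mc; rewrite ltnW.
have mS n : measurable_fun setT (fun w => \sum_(i <- iota 0 n) f (i :: u) w).
  by apply: measurable_sum => i; apply: mf; rewrite /= uk.
move=> _ B mB; rewrite setTI.
rewrite (_ : _ @^-1` B = \bigcup_n ([set w | c u w = n] `&`
    (fun w => \sum_(i <- iota 0 n) f (i :: u) w) @^-1` B)).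
  apply: bigcup_measurable => n _; apply: measurableI; first by apply: mc; rewrite uk.
  by rewrite -[X in measurable X]setTI; exact: mS.
apply/seteqP; split=> w /=; first by move=> Bw; exists (c u w).
by move=> [n _ [<-]].
Qed.

End Generation.

Fixpoint path_prod {R : pzSemiRingType} (e : vertex -> R) (v : vertex) : R :=
  if v is _ :: u then e v * path_prod e u else e v.

Section BranchingMoments.
Context {R : realType} {dO : measure_display} {Omega : measurableType dO}.
Variables (P : probability Omega R) (Z : index -> {mfun Omega >-> R})
  (C : vertex -> Omega -> nat) (Delta gamma : R).
Hypothesis indepZ : mutually_independent P Z.
Hypothesis countE : forall v w, Z (cnt v) w = (C v w)%:R.
Hypothesis flip_sqr : forall v w, Z (flp v) w ^+ 2 = 1.
Hypothesis count_mean : forall v, has_mean P (Z (cnt v)) Delta.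
Hypothesis count_sqr_mean : forall v,
  has_mean P (fun w => Z (cnt v) w ^+ 2) (Delta ^+ 2 + Delta).
Hypothesis flip_mean : forall i u, has_mean P (Z (flp (i :: u))) gamma.

Definition spin v w : R := path_prod (fun u => Z (flp u) w) v.

Definition gen_size k w : R := (size (generation (C ^~ w) k))%:R.

Definition gen_spin k w : R := \sum_(v <- generation (C ^~ w) k) spin v w.

Lemma spin_sqr v w : spin v w ^+ 2 = 1.
Proof.
by elim: v => [|i u IH]; rewrite /spin /= ?exprMn ?flip_sqr // mul1r IH.
Qed.

(** What determines generation [k] with its labels: offspring numbers of smaller depth and flips up
    to depth [k]. A new generation is revealed in two steps, first the offspring numbers at depth
    [k], then the flips at depth [k + 1]; the next three sets describe these steps. *)
Definition past k : set index := [set j | match j with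
  | inl (inl u) => (size u < k)%N | inl (inr u) => (size u <= k)%N
  | inr _ => False end].

Definition counts_at k : set index := [set j | match j with
  | inl (inl u) => size u = k | _ => False end].

Definition past_counts k : set index := [set j | match j with
  | inl (inl u) => (size u <= k)%N | inl (inr u) => (size u <= k)%N
  | inr _ => False end].

Definition flips_at k : set index := [set j | match j with
  | inl (inr u) => size u = k | _ => False end].

Lemma sub_Z (J : set index) j : J j -> measurable_fun setT (Z j : sub_space Z J -> R).
Proof. exact: sub_space_measurable. Qed.

Lemma sub_count (J : set index) v (n : nat) : J (cnt v) ->
  measurable ([set w | C v w = n] : set (sub_space Z J)).
Proof.
move=> Jv; rewrite (_ : [set w | _] = Z (cnt v) @^-1` [set n%:R]).
  by rewrite -[X in measurable X]setTI; exact: (sub_Z Jv).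
apply/seteqP; split=> w /=; rewrite countE; first by move=> ->.
by move/eqP; rewrite eqr_nat => /eqP.
Qed.

Lemma sub_spin (J : set index) v :
  (forall u, (size u <= size v)%N -> J (flp u)) ->
  measurable_fun setT (spin v : sub_space Z J -> R).
Proof.
elim: v => [|i u IH] H; first exact: (sub_Z (H [::] isT)).
apply: measurable_funM; first exact: (sub_Z (H (i :: u) (leqnn _))).
by apply: IH => u' uu'; apply: H; exact: leqW.
Qed.

(** The tree and [a] are read at one point and [b] at another; this joint measurability is what
    Tonelli asks for once the tree is frozen. *)
Lemma measurable_gen_sum2 (J J' : set index) k (a b : vertex -> Omega -> R) :
  (forall v, (size v < k)%N -> J (cnt v)) ->
  (forall v, size v = k -> sub_measurable Z J (a v)) ->
  (forall v, size v = k -> sub_measurable Z J' (b v)) ->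
  measurable_fun setT (fun z : sub_space Z J * sub_space Z J' =>
    \sum_(v <- generation (C ^~ z.1) k) a v z.1 * b v z.2).
Proof.
move=> Jk ma mb.
pose T : measurableType _ := (sub_space Z J * sub_space Z J')%type.
apply: (@measurable_sum_generation R _ T (fun v z => C v z.1)
  (fun v z => a v z.1 * b v z.2)) => [v n vk|v vk].
  rewrite -[X in measurable X]setTI.
  exact: (@measurable_fst _ _ (sub_space Z J) (sub_space Z J') measurableT
    [set w | C v w = n] (sub_count n (Jk v vk))).
apply: measurable_funM.
  exact: (measurableT_comp (@ma v vk) measurable_fst).
exact: (measurableT_comp (@mb v vk) measurable_snd).
Qed.

(** Given the past, the offspring numbers are independent with mean and variance both [Delta]. Used
    with [a = 1] for the sizes and with [a] the spins. *)
Lemma count_step k (a : vertex -> Omega -> R) m q :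
  (forall v, size v = k -> sub_measurable Z (past k) (a v)) ->
  has_mean P (fun w => \sum_(v <- generation (C ^~ w) k) a v w ^+ 2) m ->
  has_mean P (fun w => (\sum_(v <- generation (C ^~ w) k) a v w) ^+ 2) q ->
  has_mean P (fun w => (\sum_(v <- generation (C ^~ w) k) a v w * Z (cnt v) w) ^+ 2)
    (Delta * m + Delta ^+ 2 * q).
Proof.
move=> ma am aq.
pose f (z : sub_space Z (past k) * sub_space Z (counts_at k)) : R :=
  (\sum_(v <- generation (C ^~ z.1) k) a v z.1 * Z (cnt v) z.2) ^+ 2.
have JJ' : past k `&` counts_at k = set0.
  by rewrite -subset0; case=> [[u|u]|u] [] //= + E; rewrite E ltnn.
apply: (has_mean_tower indepZ (f := f) JJ' _ _ _
  (has_meanD (has_meanZ Delta am) (has_meanZ (Delta ^+ 2) aq))).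
- apply: measurable_funX.
  apply: (measurable_gen_sum2 (b := fun v => Z (cnt v))) => // v vk.
  exact: (@sub_Z (counts_at k) (cnt v) vk).
- by move=> z; exact: sqr_ge0.
move=> w1; rewrite /f /=.
have := has_mean_lin_sqr (tau := cnt) (a ^~ w1) indepZ _ (generation_uniq (C ^~ w1) k)
  (fun v _ => count_mean v) (fun v _ => count_sqr_mean v).
rewrite (_ : Delta ^+ 2 + Delta - Delta ^+ 2 = Delta); last by ring.
by apply=> u v [].
Qed.

Lemma gen_sizeS k w :
  gen_size k.+1 w = \sum_(v <- generation (C ^~ w) k) Z (cnt v) w.
Proof.
rewrite /gen_size size_generationS natr_sum.
by apply: eq_bigr => v _; rewrite countE.
Qed.

Lemma gen_size_mean k : has_mean P (gen_size k) (Delta ^+ k).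
Proof.
elim: k => [|k IH].
  by rewrite expr0; apply: eq_has_mean (has_mean_cst P 1) => w.
pose f (z : sub_space Z (past k) * sub_space Z (counts_at k)) : R :=
  \sum_(v <- generation (C ^~ z.1) k) Z (cnt v) z.2.
have JJ' : past k `&` counts_at k = set0.
  by rewrite -subset0; case=> [[u|u]|u] [] //= + E; rewrite E ltnn.
rewrite exprS.
have := has_mean_tower indepZ (f := f) JJ' _ _ _ (has_meanZ Delta IH).
move=> H; apply: eq_has_mean (H _ _ _) => [w| |z|w1].
- by rewrite gen_sizeS.
- rewrite /f (_ : (fun _ => _) = fun z => \sum_(v <- generation (C ^~ z.1) k) 1 * Z (cnt v) z.2).
    apply: (measurable_gen_sum2 (a := fun _ _ => 1) (b := fun v => Z (cnt v))) => // v vk.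
      exact: measurable_cst.
    exact: (@sub_Z (counts_at k) (cnt v) vk).
  by apply/funext => z; apply: eq_bigr => v _; rewrite mul1r.
- by apply: sumr_ge0 => v _; rewrite countE.
rewrite /f /= /gen_size.
rewrite (_ : Delta * _ = \sum_(v <- generation (C ^~ w1) k) Delta).
  by apply: has_mean_sum => v _; exact: count_mean.
by rewrite big_const_seq count_predT iter_addr addr0 mulr_natr.
Qed.

(** Solves [s' = Delta^(k+1) + Delta^2 s]. After division by [Delta^(2k)] it stays below
    [Delta / (Delta - 1)], the constant [Q] of the lower bound. *)
Lemma gen_size_sqr_mean k : Delta != 1 ->
  has_mean P (fun w => gen_size k w ^+ 2)
    (Delta / (Delta - 1) * Delta ^+ (2 * k) - Delta ^+ k / (Delta - 1)).
Proof.
move=> D1; have D0 : Delta - 1 != 0 by rewrite subr_eq0.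
elim: k => [|k IH].
  rewrite muln0 !expr0 mulr1 -mulrBl divff //.
  by apply: eq_has_mean (has_mean_cst P 1) => w; rewrite /gen_size /= expr1n.
have sz w : \sum_(v <- generation (C ^~ w) k) (1 : R) = gen_size k w.
  by rewrite big_const_seq count_predT iter_addr addr0.
have := @count_step k (fun _ _ => 1) (Delta ^+ k)
  (Delta / (Delta - 1) * Delta ^+ (2 * k) - Delta ^+ k / (Delta - 1)) _ _ _.
move=> H.
rewrite (_ : _ - _ = Delta * Delta ^+ k + Delta ^+ 2 *
   (Delta / (Delta - 1) * Delta ^+ (2 * k) - Delta ^+ k / (Delta - 1))); last first.
  rewrite mulnS exprD (exprS Delta k).
  by move: (Delta ^+ (2 * k)) (Delta ^+ k) => p q; field.
apply: eq_has_mean (H _ _ _) => [w|v _| |].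
- by rewrite gen_sizeS; congr (_ ^+ 2); apply: eq_bigr => v _; rewrite mul1r.
- exact: measurable_cst.
- apply: eq_has_mean (gen_size_mean k) => w; rewrite -sz.
  by apply: eq_bigr => v _; rewrite expr1n.
- by apply: eq_has_mean IH => w; rewrite sz.
Qed.

(** Solves [s' = Delta^(k+1) + gamma^2 Delta^2 s]. For [kappa = gamma^2 Delta < 1] it is at most
    [Delta^k / (1 - kappa)], the order that independent labels would give. *)
Lemma gen_spin_sqr_mean k : gamma ^+ 2 * Delta != 1 ->
  has_mean P (fun w => gen_spin k w ^+ 2)
    (Delta ^+ k * (1 - (gamma ^+ 2 * Delta) ^+ k.+1) / (1 - gamma ^+ 2 * Delta)).
Proof.
move=> D1; have D0 : 1 - gamma ^+ 2 * Delta != 0 by rewrite subr_eq0 eq_sym.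
elim: k => [|k IH].
  rewrite expr0 expr1 mul1r divff //.
  apply: eq_has_mean (has_mean_cst P 1) => w.
  by rewrite /gen_spin /= big_seq1 spin_sqr.
pose tail (v : vertex) : vertex := behead v.
pose f (z : sub_space Z (past_counts k) * sub_space Z (flips_at k.+1)) : R :=
  (\sum_(v <- generation (C ^~ z.1) k.+1) spin (tail v) z.1 * Z (flp v) z.2) ^+ 2.
have JJ' : past_counts k `&` flips_at k.+1 = set0.
  by rewrite -subset0; case=> [[u|u]|u] [] //= + E; rewrite E ltnn.
have mspin v : size v = k -> sub_measurable Z (past k) (spin v).
  by move=> vk; apply: sub_spin => u; rewrite vk.
have step := count_step mspin _ IH.
have {}step := step (Delta ^+ k) _.
have E1 : has_mean P (fun w => \sum_(v <- generation (C^~ w) k) spin v w ^+ 2) (Delta ^+ k).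
  apply: eq_has_mean (gen_size_mean k) => w; under eq_bigr do rewrite spin_sqr.
  by rewrite big_const_seq count_predT iter_addr addr0.
have {}step := step E1.
(* Given its parent, a spin has mean [gamma] times that of the parent and square 1: the variances
   contribute [1 - gamma^2] per vertex, and the squared mean is [gamma^2] times the quantity of
   [count_step]. *)
have G := has_meanD (has_meanZ (1 - gamma ^+ 2) (gen_size_mean k.+1))
  (has_meanZ (gamma ^+ 2) step).
have := has_mean_tower indepZ (f := f) JJ' _ _ _ G.
rewrite (_ : (1 - gamma ^+ 2) * _ + _ = Delta ^+ k.+1 * (1 - (gamma ^+ 2 * Delta) ^+ k.+2) /
  (1 - gamma ^+ 2 * Delta)); last first.
  rewrite (exprS Delta k) !(exprS (gamma ^+ 2 * Delta) k.+1).
  by move: (Delta ^+ k) ((gamma ^+ 2 * Delta) ^+ k.+1) => p q; field.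
move=> H; apply: eq_has_mean (H _ _ _) => [w| |z|w1].
- rewrite /f /gen_spin; congr (_ ^+ 2); apply: eq_big_seq => v /generationS_cons[i [u [-> _]]].
  by rewrite /= mulrC.
- apply: measurable_funX.
  apply: (measurable_gen_sum2 (a := fun v => spin (tail v)) (b := fun v => Z (flp v))) => v vk //.
    by apply: sub_spin => u; rewrite /tail size_behead vk.
  exact: (@sub_Z (flips_at k.+1) (flp v) vk).
- exact: sqr_ge0.
rewrite /f /=.
have := has_mean_lin_sqr (m := gamma) (s := 1) (tau := flp) (fun v => spin (tail v) w1) indepZ
  _ (generation_uniq (C ^~ w1) k.+1).
move=> /(_ _ _ _) H1.
rewrite (_ : (1 - gamma ^+ 2) * _ + _ = (1 - gamma ^+ 2) * (\sum_(v <- generation (C^~ w1) k.+1) spin (tail v) w1 ^+ 2) +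
   gamma ^+ 2 * (\sum_(v <- generation (C^~ w1) k.+1) spin (tail v) w1) ^+ 2).
  apply: H1; first by move=> ? ? [].
    by move=> v /generationS_cons[i [u [-> _]]]; exact: flip_mean.
  move=> v _; apply: eq_has_mean (has_mean_cst P 1) => w; by rewrite flip_sqr.
congr (_ * _ + _ * _ ^+ 2).
  under [RHS]eq_bigr do rewrite spin_sqr.
  by rewrite big_const_seq count_predT iter_addr addr0.
rewrite big_generationS; apply: eq_bigr => u _.
rewrite /tail /= big_const_seq count_predT iter_addr addr0 size_iota.
by rewrite countE mulr_natr.
Qed.

End BranchingMoments.

(** * Real inequalities *)

Section RealAnalysis.
Context {R : realType}.
Implicit Types u x y s : R.

Lemma le_of_eq x y : x = y -> x <= y.
Proof. by move=> ->. Qed.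

(** The formula [x * expR (- ln (x ^+ 2))] is also right at 0, where the factor [x] vanishes and the
    inverse is 0 by convention. *)
Lemma measurable_invr : measurable_fun setT (@GRing.inv R).
Proof.
rewrite (_ : @GRing.inv R = fun x => x * expR (- ln (x ^+ 2))).
  apply: measurable_funM => //; apply: measurableT_comp => //.
  apply: measurable_funN; apply: measurableT_comp; first exact: measurable_ln.
  exact: measurable_funX.
apply/funext => x; have [->|x0] := eqVneq x 0; first by rewrite invr0 mul0r.
rewrite expRN lnK ?posrE ?exprn_even_gt0 //.
by field.
Qed.

Lemma measurable_artanh : measurable_fun setT (@artanh R).
Proof.
apply: measurable_funM => //; apply: measurableT_comp; first exact: measurable_ln.
apply: measurable_funM; first exact: measurable_funD.
apply: measurableT_comp; first exact: measurable_invr.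
exact: measurable_funB.
Qed.

(** At [1] and [-1] the conventions [x / 0 = 0] and [ln 0 = 0] make [artanh] vanish, so oddness
    holds on the closed interval. The root term needs the endpoints, as no power of [gamma] shrinks
    [t] there. *)
Lemma artanhN u : `|u| <= 1 -> artanh (- u) = - artanh u.
Proof.
move=> u1; rewrite /artanh opprK.
have [->|n1] := eqVneq u 1; first by rewrite subrr mul0r invr0 mulr0 !ln0 // mul0r oppr0.
have [->|m1] := eqVneq u (-1).
  by rewrite opprK subrr mul0r invr0 mulr0 !ln0 // mul0r oppr0.
have /andP[h1 h2] : -1 < u < 1.
  by move: u1; rewrite ler_norml !le_eqVlt eq_sym (negbTE m1) (negbTE n1).
rewrite -mulNr -lnV ?posrE; last by rewrite divr_gt0 //; lra.
by rewrite invf_div.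
Qed.

Lemma artanh_le u : `|u| < 1 -> artanh u <= u / (1 - u).
Proof.
rewrite ltr_norml => /andP[h1 h2].
have d0 : 0 < 1 - u by lra.
have -> : u / (1 - u) = (2 * u / (1 - u)) / 2 by field; lra.
rewrite /artanh ler_pM2r //.
have -> : (1 + u) / (1 - u) = 1 + 2 * u / (1 - u) by field; lra.
apply: le_ln1Dx; rewrite ltr_pdivlMr //; lra.
Qed.

(** [artanh_le] at [u] and at [- u] gives the two sides; the error is quadratic because
    [u / (1 - u) - u = u^2 / (1 - u)]. *)
Lemma artanh_near u : `|u| < 1 -> `|artanh u - u| <= u ^+ 2 / (1 - `|u|).
Proof.
move=> u1; have hi := artanh_le u1.
have := @artanh_le (- u); rewrite normrN => /(_ u1).
rewrite artanhN; last exact: ltW.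
rewrite opprK => lo.
have n0 := normr_ge0 u; have := ler_norm u; have := ler_norm (- u).
rewrite normrN; move: u1 n0; set n := `|u| => u1 n0 h1 h2.
have s0 := sqr_ge0 u.
rewrite ler_norml; apply/andP; split.
  have : u ^+ 2 / (1 + u) <= u ^+ 2 / (1 - n).
    by rewrite ler_wpM2l // lef_pV2 ?posrE; lra.
  have : - u / (1 + u) = - u + u ^+ 2 / (1 + u) by field; lra.
  lra.
have : u ^+ 2 / (1 - u) <= u ^+ 2 / (1 - n).
  by rewrite ler_wpM2l // lef_pV2 ?posrE; lra.
have : u / (1 - u) = u + u ^+ 2 / (1 - u) by field; lra.
lra.
Qed.

Lemma artanh_bound u : `|u| < 1 -> `|artanh u| <= `|u| / (1 - `|u|).
Proof.
move=> u1; have near := artanh_near u1.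
have : `|artanh u| <= `|artanh u - u| + `|u| by rewrite -{1}(subrK u (artanh u)) ler_normD.
have n0 := normr_ge0 u.
have -> : `|u| / (1 - `|u|) = `|u| ^+ 2 / (1 - `|u|) + `|u| by field; lra.
have -> : `|u| ^+ 2 = u ^+ 2 by rewrite -normrX ger0_norm ?sqr_ge0.
lra.
Qed.

(* Second and fourth moments bound [E min(|D|, 1)] from below, in place of a
   Berry-Esseen estimate for [D]. *)
Lemma min1_ge_quartic x s : 0 < s ->
  Num.min s 1 * ((x / s) ^+ 2 - (x / s) ^+ 4) <= Num.min `|x| 1.
Proof.
move=> s0; set u := x / s.
have xE : `|x| = `|u| * s by rewrite /u normrM normfV (gtr0_norm s0) divfK // gt_eqF.
have : u ^+ 2 - u ^+ 4 <= Num.min `|u| 1.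
  have n0 := normr_ge0 u.
  have -> : u ^+ 2 = `|u| ^+ 2 by rewrite -normrX ger0_norm ?sqr_ge0.
  have -> : u ^+ 4 = `|u| ^+ 4 by rewrite -normrX ger0_norm ?exprn_even_ge0.
  move: n0; set n := `|u| => n0; rewrite le_min.
  have -> : n ^+ 2 - n ^+ 4 = n * n * (1 - n) * (1 + n) by ring.
  have [n1|n1] := lerP n 1.
    apply/andP; split.
      have : n * ((1 - n * (1 - n) * (1 + n))) >= 0.
        apply: mulr_ge0 => //.
        have : n * (1 - n) * (1 + n) <= 1; last lra.
        have : 0 <= n * (1 - n) by apply: mulr_ge0; lra.
        have := sqr_ge0 (n - 1/2); have := sqr_ge0 n; nra.
      lra.
    have := sqr_ge0 (n ^+ 2 - 1/2); nra.
  have neg : n * n * (1 - n) * (1 + n) <= 0.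
    have a1 : 0 <= n * n * (n - 1) * (n + 1) by rewrite !mulr_ge0 //; lra.
    have -> : n * n * (1 - n) * (1 + n) = - (n * n * (n - 1) * (n + 1)) by ring.
    lra.
  by apply/andP; split; lra.
have m0 : 0 < Num.min s 1 by rewrite lt_min s0 ltr01.
move=> h; apply: (le_trans (ler_wpM2l (ltW m0) h)).
rewrite le_min; apply/andP; split.
  rewrite xE mulrC; apply: ler_pM.
  - by rewrite le_min normr_ge0 ler01.
  - exact: ltW.
  - by rewrite ge_min lexx.
  - by rewrite ge_min lexx.
apply: mulr_ile1.
- exact: ltW.
- by rewrite le_min normr_ge0 ler01.
- by rewrite ge_min lexx orbT.
- by rewrite ge_min lexx orbT.
Qed.

(** Cauchy-Schwarz with free weights; in the induction the cross term [2 y A] is absorbed by the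
    square [(p A - Q y)^2 / (Q p)]. *)
Lemma sqr_sum_weighted (I : Type) (F : seq I) (x q : I -> R) :
  (forall i, 0 < q i) ->
  (\sum_(i <- F) x i) ^+ 2 <= (\sum_(i <- F) q i) * \sum_(i <- F) x i ^+ 2 / q i.
Proof.
move=> q0; elim: F => [|i F IH]; first by rewrite !big_nil expr0n /= mul0r.
rewrite !big_cons; move: IH.
set A := \sum_(j <- F) x j; set Q := \sum_(j <- F) q j.
set B := \sum_(j <- F) _.
have Q0 : 0 <= Q by apply: sumr_ge0 => j _; exact: ltW.
have B0 : 0 <= B by apply: sumr_ge0 => j _; rewrite mulr_ge0 ?sqr_ge0 // invr_ge0 ltW.
have qi := q0 i; move: (x i) (q i) qi => y p p0 IH.
have -> : (p + Q) * (y ^+ 2 / p + B) = y ^+ 2 + Q * B + (p * B + Q * (y ^+ 2 / p)).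
  by field; lra.
suff : 2 * (y * A) <= p * B + Q * (y ^+ 2 / p) by nra.
have [Q1|Q1] := eqVneq Q 0.
  have A0 : A = 0.
    by apply/eqP; rewrite -sqrf_eq0 eq_le sqr_ge0 andbT; move: IH; rewrite Q1 mul0r.
  by rewrite A0 Q1 !mulr0 mul0r addr0 mulr_ge0 // ltW.
have QQ : 0 < Q by rewrite lt_neqAle eq_sym Q1.
have AB : A ^+ 2 / Q <= B by rewrite ler_pdivrMr // mulrC.
have : 0 <= (p * A - Q * y) ^+ 2 / (Q * p) by rewrite mulr_ge0 ?sqr_ge0 // invr_ge0 mulr_ge0 // ltW.
have -> : (p * A - Q * y) ^+ 2 / (Q * p) = p * (A ^+ 2 / Q) - 2 * (y * A) + Q * (y ^+ 2 / p).
  by field; rewrite gt_eqF // gt_eqF.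
have : p * (A ^+ 2 / Q) <= p * B by rewrite ler_wpM2l // ltW.
lra.
Qed.

End RealAnalysis.

(** * Sign changes *)

Lemma measurable_neqr {R : realType} {d} {T : measurableType d} (f g : T -> R) :
  measurable_fun setT f -> measurable_fun setT g ->
  measurable [set x | f x <> g x].
Proof.
move=> mf mg; rewrite (_ : [set x | _] = (f \- g) @^-1` (~` [set 0])).
  rewrite -[X in measurable X]setTI; apply: measurable_funB => //.
  exact: measurableC.
by apply/seteqP; split=> x /=; [move=> fg /subr0_eq|move=> fg E; apply: fg; rewrite E subrr].
Qed.

Section FlipBound.
Context {R : realType} {d : measure_display} {Omega : measurableType d}.
Variable P : probability Omega R.

Lemma measurable_sgr : measurable_fun setT (@Num.sg R).
Proof.
rewrite (_ : @Num.sg R = (\1_`]0, +oo[ \- \1_`]-oo, 0[)); last first.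
  apply/funext => x /=; rewrite !indicE !mem_setE !in_itv /= andbT.
  by case: sgrP => _; rewrite ?subr0 ?sub0r.
by apply: measurable_funB; exact: measurable_indic.
Qed.

Lemma interval_prob_ge (L : {mfun Omega >-> R}) (f : R -> R) (K beta x s : R) :
  measurable_fun setT f -> (forall z, 0 <= f z) ->
  (forall A, measurable A -> P (L @^-1` A) =
     (\int[lebesgue_measure]_(z in A) (f z)%:E)%E) ->
  (forall z, - K <= z <= K -> beta <= f z) -> 0 <= beta ->
  - K <= x -> x + s <= K -> 0 <= s ->
  ((beta * s)%:E <= P (L @^-1` `]x, (x + s)%R[))%E.
Proof.
move=> mf f0 law fb b0 Kx xK s0.
rewrite law //.
apply: (@le_trans _ _ (\int[lebesgue_measure]_(z in `]x, (x + s)%R[) beta%:E)%E).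
  rewrite integral_cst // [X in (_ <= _ * X)%E](_ : _ =
      lebesgue_measure (`]x, (x + s)%R[ : set R)) // lebesgue_measure_itv /=.
  rewrite EFinM lte_fin ltrDl.
  case: ltP => [_|s1]; first by rewrite -EFinB addrC addKr.
  have -> : s = 0 by apply/eqP; rewrite eq_le s1.
  by rewrite !mule0.
apply: ge0_le_integral => //.
  by apply/measurable_EFinP; exact: measurable_funTS.
move=> z /=; rewrite in_itv /= => /andP[h1 h2]; rewrite lee_fin; apply: fb.
by apply/andP; split; lra.
Qed.

(* The sign changes when [e * L] lies between [- r - dd] and [- r]; capping [|dd|]
   at [1] keeps this interval inside [[-K, K]]. *)
Lemma sign_change_prob_ge (L : {mfun Omega >-> R}) (f : R -> R)
    (K beta e r dd : R) :
  measurable_fun setT f -> (forall z, 0 <= f z) ->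
  (forall A, measurable A -> P (L @^-1` A) =
     (\int[lebesgue_measure]_(z in A) (f z)%:E)%E) ->
  (forall z, - K <= z <= K -> beta <= f z) -> 0 <= beta ->
  e ^+ 2 = 1 -> `|r| <= K - 1 ->
  ((beta * Num.min `|dd| 1)%:E <=
   P [set w | Num.sg (e * L w + r)%R <> Num.sg (e * L w + r + dd)%R])%E.
Proof.
move=> mf f0 law fb b0 e1 rK.
have mS : measurable [set w | Num.sg (e * L w + r) <> Num.sg (e * L w + r + dd)].
  apply: measurable_neqr; apply: measurableT_comp; try exact: measurable_sgr.
    by apply: measurable_funD => //; apply: measurable_funM.
  by apply: measurable_funD => //; apply: measurable_funD => //; apply: measurable_funM.
set s := Num.min `|dd| 1.
have s0 : 0 <= s by rewrite le_min normr_ge0 ler01.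
have s1 : s <= 1 by rewrite ge_min lexx orbT.
have sd : s <= `|dd| by rewrite ge_min lexx.
move: rK; rewrite ler_norml => /andP[r1 r2].
have main x : - K <= x -> x + s <= K -> (forall z, x < z < x + s ->
    Num.sg (e * z + r) <> Num.sg (e * z + r + dd)) ->
  ((beta * s)%:E <=
   P [set w | Num.sg (e * L w + r)%R <> Num.sg (e * L w + r + dd)%R])%E.
  move=> h1 h2 h3.
  apply: (le_trans (interval_prob_ge mf f0 law fb b0 h1 h2 s0)).
  apply: le_measure; rewrite ?inE //.
    by rewrite -[X in measurable X]setTI; exact: measurable_funP.
  by move=> w /=; rewrite in_itv /=; exact: h3.
have sgneg (a b : R) : a < 0 -> 0 < b -> Num.sg a <> Num.sg b.
  by move=> a0 b0'; rewrite ltr0_sg // gtr0_sg // => /eqP; rewrite eqNr oner_eq0.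
have [d0|d0] := lerP 0 dd; last first.
  rewrite ltr0_norm // in sd.
  move/eqP: e1; rewrite sqrf_eq1 => /orP[] /eqP e1; rewrite e1 in main *.
    apply: (main (- r)); [lra|lra|move=> z /andP[h1 h2]].
    by apply/nesym/sgneg; lra.
  apply: (main (r - s)); [lra|lra|move=> z /andP[h1 h2]].
  by apply/nesym/sgneg; lra.
rewrite ger0_norm // in sd.
move/eqP: e1; rewrite sqrf_eq1 => /orP[] /eqP e1; rewrite e1 in main *.
  apply: (main (- r - s)); [lra|lra|move=> z /andP[h1 h2]].
  by apply/sgneg; lra.
apply: (main r); [lra|lra|move=> z /andP[h1 h2]].
by apply/sgneg; lra.
Qed.

Variables (I : eqType) (T : I -> {mfun Omega >-> R}).
Hypothesis indepT : mutually_independent P T.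

(** The root [o] is outside [J], so [S] and [D] can be frozen and the root term alone integrated.
    Where [|S| > K - 1] the indicator makes the bound trivial. *)
Lemma flip_prob_ge (o : I) (L : {mfun Omega >-> R}) (f : R -> R) (J : set I)
    (K beta e m : R) (S D : Omega -> R) :
  measurable_fun setT f -> (forall z, 0 <= f z) ->
  (forall A, measurable A -> P (L @^-1` A) =
     (\int[lebesgue_measure]_(z in A) (f z)%:E)%E) ->
  (forall z, - K <= z <= K -> beta <= f z) -> 0 <= beta -> e ^+ 2 = 1 ->
  ~ J o -> sub_measurable T [set o] L ->
  sub_measurable T J S -> sub_measurable T J D ->
  has_mean P (fun w => Num.min `|D w| 1 * \1_[set w | `|S w| <= K - 1] w) m ->
  ((beta * m)%:E <=
   P [set w | Num.sg (e * L w + S w)%R <> Num.sg (e * L w + S w + D w)%R])%E.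
Proof.
move=> mf f0 law fb b0 e1 Jo mL mS mD hm.
pose A (z : sub_space T J * sub_space T [set o]) : R := Num.sg (e * L z.2 + S z.1).
pose B (z : sub_space T J * sub_space T [set o]) : R := Num.sg (e * L z.2 + S z.1 + D z.1).
pose V := [set z | A z <> B z].
have mL2 : measurable_fun setT (fun z : sub_space T J * sub_space T [set o] => e * L z.2).
  by apply: measurable_funM => //; exact: (measurableT_comp mL measurable_snd).
have mS1 : measurable_fun setT (fun z : sub_space T J * sub_space T [set o] => S z.1).
  exact: (measurableT_comp mS measurable_fst).
have mD1 : measurable_fun setT (fun z : sub_space T J * sub_space T [set o] => D z.1).
  exact: (measurableT_comp mD measurable_fst).
have mV : measurable V.
  apply: measurable_neqr; apply: measurableT_comp; try exact: measurable_sgr.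
    exact: measurable_funD.
  by apply: measurable_funD => //; apply: measurable_funD.
have disj : J `&` [set o] = set0 by rewrite -subset0 => i /= [Ji E]; rewrite E in Ji.
apply: (sub_indep_prob_ge indepT disj mV (has_meanZ beta hm)) => w1.
rewrite indicE; case: (boolP (_ \in _)) => [|_]; last by rewrite !mulr0.
rewrite in_setE /= => rK; rewrite mulr1.
exact: sign_change_prob_ge mf f0 law fb b0 e1 rK.
Qed.

Variable W : I -> Omega -> R.
Hypothesis mW : forall j, sub_measurable T [set j] (W j).

(** The sum keeps its mean [M], so it is scaled by [M^2 + V] with [V] its variance, and a nonzero
    mean does no harm. The assumption [B^2 <= V] excludes domination by a single term and bounds the
    centred fourth moment by [4 V^2]. *)
Lemma anticoncentration (F : seq I) (m s : I -> R) (B s0 : R) : uniq F ->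
  (forall j, j \in F -> has_mean P (W j) (m j)) ->
  (forall j, j \in F -> has_mean P (fun w => W j w ^+ 2) (s j)) ->
  (forall j w, j \in F -> `|W j w - m j| <= B) ->
  0 < s0 <= 1 ->
  s0 ^+ 2 <= \sum_(j <- F) (s j - m j ^+ 2) ->
  B ^+ 2 <= \sum_(j <- F) (s j - m j ^+ 2) ->
  exists2 q, has_mean P (fun w => Num.min `|\sum_(j <- F) W j w| 1) q & s0 / 128 <= q.
Proof.
move=> uF hm hs hB /andP[s00 s01]; set V := \sum_(j <- F) _ => s0V BV.
pose Y j w := W j w - m j.
have mY j : sub_measurable T [set j] (Y j).
  by apply: measurable_funB; [exact: (@mW j)|exact: measurable_cst].
have hY j : j \in F -> has_mean P (Y j) 0.
  by move=> jF; rewrite -(subrr (m j)); exact: has_meanB (hm j jF) (has_mean_cst _ _).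
have hY2 j : j \in F -> has_mean P (fun w => Y j w ^+ 2) (s j - m j ^+ 2).
  move=> jF; rewrite (_ : _ - _ = s j - 2 * m j * m j + m j ^+ 2); last by ring.
  apply: eq_has_mean (has_meanD (has_meanB (hs j jF) (has_meanZ (2 * m j) (hm j jF)))
    (has_mean_cst _ (m j ^+ 2))) => w; rewrite /Y; ring.
have [q4 hq4 q4le] := has_mean_sum_pow4 indepT mY uF
   (fun j w jF => hB j w jF) hY hY2.
have hD2 := has_mean_sum_sqr indepT mW uF hm hs.
rewrite -/V in q4le hD2; set M := \sum_(j <- F) m j in hD2.
pose D w := \sum_(j <- F) W j w.
have mD : measurable_fun setT D := sub_measurableW (@sub_measurable_sum_seq _ _ _ _ _ _ mW F).
have [q hq] : exists q, has_mean P (fun w => Num.min `|D w| 1) q.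
  apply: (@has_mean_bounded _ _ _ _ _ 1).
    by apply: measurable_minr => //; exact: measurableT_comp.
  move=> w; rewrite ger0_norm; first by rewrite ge_min lexx orbT.
  by rewrite le_min normr_ge0 ler01.
exists q => //.
have V0 : 0 < V by apply: lt_le_trans s0V; rewrite exprn_gt0.
have [d4 hd4 d4le] : exists2 d4, has_mean P (fun w => D w ^+ 4) d4 & d4 <= 8 * (M ^+ 4 + q4).
  have pw w : D w ^+ 4 <= 8 * (M ^+ 4 + (\sum_(j <- F) Y j w) ^+ 4).
    have -> : D w = M + \sum_(j <- F) Y j w.
      by rewrite /D /Y sumrB /M addrC subrK.
    move: (\sum_(j <- F) _) => y.
    rewrite -subr_ge0 (_ : _ - _ =
      (M - y) ^+ 2 * (7 * M ^+ 2 + 10 * M * y + 7 * y ^+ 2)); last by ring.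
    rewrite mulr_ge0 ?sqr_ge0 //.
    have := sqr_ge0 (M + y); have := sqr_ge0 M; have := sqr_ge0 y; nra.
  have H := has_meanZ 8 (has_meanD (has_mean_cst P (M ^+ 4)) hq4).
  have [d4 hd4] : exists d4, has_mean P (fun w => D w ^+ 4) d4.
    apply: has_mean_dominated H; first exact: measurable_funX.
    by move=> w; rewrite ger0_norm ?exprn_even_ge0.
  by exists d4 => //; exact: le_has_mean pw hd4 H.
(* With this scale the normalised second moment is [1/64] and the fourth is at most
   [32 / 64^2 = 1/128]; their difference gives the constant [1/128]. *)
pose s2 := 64 * (M ^+ 2 + V).
have s2V : V <= s2 by rewrite /s2; have := sqr_ge0 M; lra.
have s20 : 0 < s2 by lra.
pose sq := Num.sqrt s2.
have sq0 : 0 < sq by rewrite sqrtr_gt0.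
have sqE : sq ^+ 2 = s2 by rewrite sqr_sqrtr // ltW.
have s0sq : s0 <= sq.
  have h1 := ltW s00; have h2 := ltW sq0.
  by rewrite -(@ler_pXn2r _ 2) ?nnegrE // sqE; lra.
have H := has_meanZ (Num.min sq 1) (has_meanB (has_meanZ (sq ^+ 2)^-1 hD2)
   (has_meanZ (sq ^+ 4)^-1 hd4)).
have := le_has_mean _ H hq.
move=> H2; have {}H2 := H2 _.
have pw w : Num.min sq 1 * ((sq ^+ 2)^-1 * (\sum_(j <- F) W j w) ^+ 2 -
    (sq ^+ 4)^-1 * D w ^+ 4) <= Num.min `|D w| 1.
  have := min1_ge_quartic (D w) sq0; rewrite !expr_div_n.
  by rewrite ![_ / sq ^+ _]mulrC.
apply: le_trans (H2 pw).
have lemin : s0 <= Num.min sq 1 by rewrite le_min s0sq s01.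
apply: ler_pM => //; first exact: ltW.
have sq4 : sq ^+ 4 = s2 ^+ 2 by rewrite -sqE -exprM.
rewrite sqE sq4.
have -> : s2^-1 * (V + M ^+ 2) = 64^-1 by rewrite /s2; field; rewrite /s2 in s20; lra.
have : (s2 ^+ 2)^-1 * d4 <= 32 / 64 ^+ 2.
  rewrite mulrC ler_pdivrMr ?exprn_gt0 //.
  have -> : 32 / 64 ^+ 2 * s2 ^+ 2 = 32 * (M ^+ 2 + V) ^+ 2 by rewrite /s2; field.
  have h1 : q4 <= 4 * V ^+ 2.
    have : B ^+ 2 * V <= V ^+ 2 by rewrite expr2 ler_pM2r.
    lra.
  have := sqr_ge0 M; move: (sqr_ge0 V) V0; nra.
lra.
Qed.

End FlipBound.

(** * Moments of the log-likelihood terms *)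

Definition llr_term {R : realType} (gamma : R) (k : nat) (x : R) : R :=
  2 * artanh (gamma ^+ k * x).

Lemma measurable_llr_term {R : realType} (gamma : R) k :
  measurable_fun setT (llr_term gamma k).
Proof.
apply: measurable_funM => //; apply: measurableT_comp; first exact: measurable_artanh.
exact: measurable_funM.
Qed.

Section FeatureMoments.
Context {R : realType} {d : measure_display} {E : measurableType d}.
Variables (Pp : probability E R) (t : E -> R) (gamma theta m1 : R).
Hypothesis mt : measurable_fun setT t.
Hypothesis t1 : forall x, `|t x| <= 1.
Hypothesis gamma01 : 0 < gamma < 1.
Hypothesis hm1 : has_mean Pp t m1.
Hypothesis htheta : has_mean Pp (fun x => t x ^+ 2) theta.

Let b : R := 2 / (1 - gamma).

Let g0 : 0 < gamma. Proof. by case/andP: gamma01. Qed.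
Let g1 : gamma < 1. Proof. by case/andP: gamma01. Qed.

(** For [k > 0] the argument of [artanh] is at most [gamma] in absolute value, away from the
    singularities. The root term [k = 0] has no such bound and is handled through its density. *)
Lemma llr_term_le k x : (0 < k)%N -> `|x| <= 1 ->
  `|llr_term gamma k x| <= b * gamma ^+ k * `|x|.
Proof.
move=> k0 x1.
have gk : gamma ^+ k <= gamma by rewrite ler_iXnr // ltW.
have gk0 : 0 < gamma ^+ k by rewrite exprn_gt0.
have n : `|gamma ^+ k * x| = gamma ^+ k * `|x| by rewrite normrM gtr0_norm.
have nn : 0 <= `|x| := normr_ge0 x.
have le : gamma ^+ k * `|x| <= gamma.
  by apply: le_trans gk; rewrite ler_piMr // ltW.
have := @artanh_bound _ (gamma ^+ k * x); rewrite n => /(_ (le_lt_trans le g1)) h.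
rewrite /llr_term normrM ger0_norm // /b.
have : gamma ^+ k * `|x| / (1 - gamma ^+ k * `|x|) <= gamma ^+ k * `|x| / (1 - gamma).
    apply: ler_wpM2l; first by rewrite mulr_ge0 // ltW.
    by move: le; move: (gamma ^+ k * `|x|) => y le; rewrite lef_pV2 ?posrE; move: g0 g1; lra.
move=> h2; apply: (@le_trans _ _ (2 * (gamma ^+ k * `|x| / (1 - gamma)))); first lra.
by apply: le_of_eq; ring.
Qed.

Lemma llr_term_near k x : (0 < k)%N -> `|x| <= 1 ->
  `|llr_term gamma k x - 2 * gamma ^+ k * x| <= 2 * gamma ^+ k * (gamma ^+ k / (1 - gamma)).
Proof.
move=> k0 x1.
have gk : gamma ^+ k <= gamma by rewrite ler_iXnr // ltW.
have gk0 : 0 < gamma ^+ k by rewrite exprn_gt0.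
have n : `|gamma ^+ k * x| = gamma ^+ k * `|x| by rewrite normrM gtr0_norm.
have nn : 0 <= `|x| := normr_ge0 x.
have le : gamma ^+ k * `|x| <= gamma.
  by apply: le_trans gk; rewrite ler_piMr // ltW.
have := @artanh_near _ (gamma ^+ k * x); rewrite n => /(_ (le_lt_trans le g1)) h.
rewrite /llr_term -mulrA -mulrBr normrM ger0_norm // -[2 * _ * _]mulrA ler_pM2l //.
apply: (le_trans h); rewrite exprMn mulrA -expr2 ler_pM //.
- by rewrite mulr_ge0 // sqr_ge0.
- by rewrite invr_ge0 subr_ge0 (le_trans le) // ltW.
- rewrite ler_piMr ?sqr_ge0 // -[x ^+ 2]ger0_norm ?sqr_ge0 // normrX.
  by rewrite exprn_ile1.
- by move: le; move: (gamma ^+ k * `|x|) => y le; rewrite lef_pV2 ?posrE; move: g0 g1; lra.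
Qed.

Lemma llr_term_moments k : (0 < k)%N -> exists mk sk,
  [/\ has_mean Pp (fun x => llr_term gamma k (t x)) mk,
      has_mean Pp (fun x => llr_term gamma k (t x) ^+ 2) sk,
      sk <= b ^+ 2 * gamma ^+ (2 * k) * theta,
      mk ^+ 2 <= sk & `|mk| <= b * gamma ^+ k] /\
  (forall sg : R, 0 <= sg -> sg ^+ 2 = theta - m1 ^+ 2 ->
    gamma ^+ k / (1 - gamma) <= sg / 2 ->
    gamma ^+ (2 * k) * sg ^+ 2 <= sk - mk ^+ 2).
Proof.
move=> k0.
have gk0 : 0 < gamma ^+ k by rewrite exprn_gt0.
have b0 : 0 < b by rewrite /b divr_gt0 // subr_gt0.
have bk0 : 0 <= b * gamma ^+ k by rewrite mulr_ge0 ?(ltW b0) ?(ltW gk0).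
have mg : measurable_fun setT (fun x => llr_term gamma k (t x)).
  by apply: measurableT_comp => //; exact: measurable_llr_term.
have gle x : `|llr_term gamma k (t x)| <= b * gamma ^+ k.
  apply: (le_trans (llr_term_le k0 (t1 x))).
  by rewrite ler_piMr.
have [mk hmk] := has_mean_bounded Pp mg gle.
have gsq x : llr_term gamma k (t x) ^+ 2 <= b ^+ 2 * gamma ^+ (2 * k) * t x ^+ 2.
  have -> : b ^+ 2 * gamma ^+ (2 * k) * t x ^+ 2 = (b * gamma ^+ k * `|t x|) ^+ 2.
    by rewrite !exprMn -exprM mulnC -[t x ^+ 2]ger0_norm ?sqr_ge0 // normrX.
  have h := llr_term_le k0 (t1 x).
  rewrite -[_ ^+ 2]ger0_norm ?sqr_ge0 // normrX lerXn2r ?nnegrE //.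
  exact: le_trans h.
have hb := has_meanZ (b ^+ 2 * gamma ^+ (2 * k)) htheta.
have [sk hsk] : exists sk, has_mean Pp (fun x => llr_term gamma k (t x) ^+ 2) sk.
  apply: has_mean_dominated hb; first exact: measurable_funX.
  by move=> x; rewrite ger0_norm ?sqr_ge0.
exists mk, sk; split; first split => //.
- exact: le_has_mean gsq hsk hb.
- exact: sqr_has_mean_le hmk hsk.
- rewrite ler_norml; apply/andP; split.
    apply: le_has_mean (has_mean_cst Pp _) hmk => x.
    by have := gle x; rewrite ler_norml => /andP[].
  apply: le_has_mean hmk (has_mean_cst Pp _) => x.
  by have := gle x; rewrite ler_norml => /andP[].
move=> sg sg0 sgE eps.
set e := gamma ^+ k / (1 - gamma) in eps.
have e0 : 0 <= e by rewrite /e mulr_ge0 ?(ltW gk0) // invr_ge0 subr_ge0 ltW.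
pose G := gamma ^+ k.
have hv : has_mean Pp (fun x => (llr_term gamma k (t x) - mk) ^+ 2) (sk - mk ^+ 2).
  have -> : sk - mk ^+ 2 = sk - 2 * mk * mk + mk ^+ 2 by ring.
  apply: eq_has_mean (has_meanD (has_meanB hsk (has_meanZ (2 * mk) hmk))
    (has_mean_cst Pp (mk ^+ 2))) => x; ring.
(* From [(p + q)^2 >= p^2 / 2 - q^2] with [p = 2 G t - mk] and [q] the linearisation error: the
   variance is at least [2 G^2 sg^2 - 4 G^2 e^2], and [e <= sg / 2] leaves [G^2 sg^2]. *)
have hl : has_mean Pp (fun x => 2^-1 * (2 * G * t x - mk) ^+ 2 - (2 * G * e) ^+ 2)
    (2^-1 * (4 * G ^+ 2 * theta - 4 * G * mk * m1 + mk ^+ 2) - (2 * G * e) ^+ 2).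
  apply: has_meanB; last exact: has_mean_cst.
  apply: has_meanZ.
  apply: eq_has_mean (has_meanD (has_meanB (has_meanZ (4 * G ^+ 2) htheta)
    (has_meanZ (4 * G * mk) hm1)) (has_mean_cst Pp (mk ^+ 2))) => x; ring.
have pw x : 2^-1 * (2 * G * t x - mk) ^+ 2 - (2 * G * e) ^+ 2 <=
    (llr_term gamma k (t x) - mk) ^+ 2.
  have := llr_term_near k0 (t1 x); rewrite -/G -/e.
  set h := llr_term gamma k (t x); move=> hh.
  have h2 : (h - 2 * G * t x) ^+ 2 <= (2 * G * e) ^+ 2.
    rewrite -[_ ^+ 2]ger0_norm ?sqr_ge0 // normrX lerXn2r ?nnegrE //.
    exact: le_trans hh.
  have -> : h - mk = (2 * G * t x - mk) + (h - 2 * G * t x) by ring.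
  move: h2; move: (2 * G * t x - mk) (h - 2 * G * t x) => p q h2.
  have := sqr_ge0 (p + 2 * q); nra.
have := le_has_mean pw hl hv; apply: le_trans.
have -> : gamma ^+ (2 * k) = G ^+ 2 by rewrite /G -exprM mulnC.
have e2 : e ^+ 2 <= sg ^+ 2 / 4.
  have -> : sg ^+ 2 / 4 = (sg / 2) ^+ 2 by field.
  by rewrite lerXn2r ?nnegrE //; lra.
have -> : theta = sg ^+ 2 + m1 ^+ 2 by rewrite sgE; ring.
have G2 := sqr_ge0 G.
have h3 : G ^+ 2 * e ^+ 2 <= G ^+ 2 * (sg ^+ 2 / 4) by rewrite ler_wpM2l.
have := sqr_ge0 (2 * G * m1 - mk); nra.
Qed.

End FeatureMoments.

(** * Sign change on a fixed labelled tree *)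

Section ConditionalFlip.
Context {R : realType} {dO : measure_display} {Omega : measurableType dO}.
Variables (P : probability Omega R) (T : vertex -> {mfun Omega >-> R}).
Hypothesis indepT : mutually_independent P T.
Variables (gamma : R) (mu sq : nat -> R).
Hypothesis T_mean : forall v k, (0 < k)%N ->
  has_mean P (fun w => llr_term gamma k (T v w)) (mu k).
Hypothesis T_sqr_mean : forall v k, (0 < k)%N ->
  has_mean P (fun w => llr_term gamma k (T v w) ^+ 2) (sq k).
Hypothesis mu_sq : forall k, (0 < k)%N -> mu k ^+ 2 <= sq k.
Variables (f : R -> R) (K beta : R).
Hypothesis mf : measurable_fun setT f.
Hypothesis f0 : forall z, 0 <= f z.
Hypothesis root_law : forall A : set R, measurable A ->
  P [set w | A (llr_term gamma 0 (T [::] w))] =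
  (\int[lebesgue_measure]_(z in A) (f z)%:E)%E.
Hypothesis fb : forall z, - K <= z <= K -> beta <= f z.
Hypothesis beta0 : 0 <= beta.
Hypothesis K1 : 1 < K.

Variables (c : vertex -> nat) (sgn : vertex -> R) (l : nat).
Hypothesis sgn_sqr : forall v, sgn v ^+ 2 = 1.

Definition level (k : nat) (w : Omega) : R :=
  \sum_(v <- generation c k) sgn v * llr_term gamma k (T v w).

(** The second moment of levels [1] to [l] is their variance plus their squared mean; each variance
    is enlarged here to a second moment. *)
Definition inner_bound : R :=
  \sum_(k < l) (size (generation c k.+1))%:R * sq k.+1 +
  (\sum_(k < l) mu k.+1 * \sum_(v <- generation c k.+1) sgn v) ^+ 2.

(** The level is read off as [size v], so one family indexed by vertices covers every generation. *)
Let W (v : vertex) (w : Omega) : R := sgn v * llr_term gamma (size v) (T v w).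

Let mW v : sub_measurable T [set v] (W v).
Proof.
apply: measurable_funM => //; apply: measurableT_comp.
  exact: measurable_llr_term.
exact: (@sub_space_measurable _ _ _ _ T [set v] v erefl).
Qed.

Let F1 : seq vertex := flatten [seq generation c k.+1 | k <- iota 0 l].
Let F2 : seq vertex := generation c l.+1.

Let F1_size v : v \in F1 -> (0 < size v <= l)%N.
Proof.
move=> /flattenP[s /mapP[k]]; rewrite mem_iota add0n => /andP[_ kl] -> vk.
by rewrite (size_generation_vertex vk).
Qed.

Let F1_uniq : uniq F1.
Proof.
rewrite /F1; elim: l => // n IH.
have -> : [seq generation c k.+1 | k <- iota 0 n.+1] =
    rcons [seq generation c k.+1 | k <- iota 0 n] (generation c n.+1).
  by rewrite -[in LHS]addn1 iotaD add0n map_cat -cats1.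
rewrite flatten_rcons cat_uniq IH generation_uniq andbT.
apply/hasPn => v vn; apply/negP => /flattenP[s /mapP[k]].
rewrite mem_iota add0n => /andP[_ kn] -> vk.
by move: kn; rewrite -ltnS -(size_generation_vertex vk) (size_generation_vertex vn) ltnn.
Qed.

Let big_F1 (h : vertex -> R) :
  \sum_(v <- F1) h v = \sum_(k < l) \sum_(v <- generation c k.+1) h v.
Proof.
rewrite big_flatten big_map.
by rewrite -[in RHS](big_mkord xpredT (fun k => \sum_(v <- generation c k.+1) h v))
  /index_iota subn0.
Qed.

Let levelE k w : level k w = \sum_(v <- generation c k) W v w.
Proof.
by apply: eq_big_seq => v vk; rewrite /W (size_generation_vertex vk).
Qed.

Let W_mean v : v != [::] -> has_mean P (W v) (sgn v * mu (size v)).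
Proof. by move=> v0; apply: has_meanZ; apply: T_mean; case: v v0. Qed.

Let W_sqr_mean v : v != [::] -> has_mean P (fun w => W v w ^+ 2) (sq (size v)).
Proof.
move=> v0; have := T_sqr_mean v (k := size v); case: v v0 => // i u _ /(_ isT).
by apply: eq_has_mean => w; rewrite /W [RHS]exprMn sgn_sqr mul1r.
Qed.

(** Levels up to [l] and level [l + 1] involve disjoint sets of vertices, so the mean of
    [min(|D|, 1)] times the indicator of [|S| <= K - 1] is a product, estimated by anticoncentration
    and by Chebyshev. *)
Lemma conditional_flip_prob_ge (B s0 : R) :
  (forall v w, `|llr_term gamma l.+1 (T v w) - mu l.+1| <= B) ->
  0 < s0 <= 1 ->
  s0 ^+ 2 <= (size (generation c l.+1))%:R * (sq l.+1 - mu l.+1 ^+ 2) ->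
  B ^+ 2 <= (size (generation c l.+1))%:R * (sq l.+1 - mu l.+1 ^+ 2) ->
  ((beta * (s0 / 128 * (1 - inner_bound / (K - 1) ^+ 2)))%:E <=
   P [set w | Num.sg (\sum_(k < l.+1) level k w)%R <>
              Num.sg (\sum_(k < l.+2) level k w)%R])%E.
Proof.
move=> hB /andP[s00 s01] hs0 hB2.
pose S w := \sum_(v <- F1) W v w.
pose D w := \sum_(v <- F2) W v w.
have SE w : \sum_(k < l.+1) level k w = sgn [::] * llr_term gamma 0 (T [::] w) + S w.
  rewrite big_ord_recl /level /= big_seq1; congr (_ + _).
  by rewrite /S big_F1; apply: eq_bigr => k _; rewrite -levelE.
have DE w : \sum_(k < l.+2) level k w = sgn [::] * llr_term gamma 0 (T [::] w) + S w + D w.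
  by rewrite big_ord_recr /= SE levelE.
rewrite (_ : [set w | _] = [set w | Num.sg (sgn [::] * llr_term gamma 0 (T [::] w) + S w)
   <> Num.sg (sgn [::] * llr_term gamma 0 (T [::] w) + S w + D w)]); last first.
  by apply/seteqP; split=> w /=; rewrite SE DE.
have F1n v : v \in F1 -> v != [::] by move=> /F1_size; case: v.
have F2n v : v \in F2 -> v != [::] by move=> /size_generation_vertex; case: v.
have mS : sub_measurable T [set` F1] S := @sub_measurable_sum_seq _ _ _ _ _ _ mW F1.
have mD : sub_measurable T [set` F2] D := @sub_measurable_sum_seq _ _ _ _ _ _ mW F2.
have S2 := has_mean_sum_sqr indepT mW F1_uniq (fun v vF => W_mean (F1n v vF))
  (fun v vF => W_sqr_mean (F1n v vF)).
set s2 := (X in has_mean P _ X) in S2.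
have s2le : s2 <= inner_bound.
  rewrite /s2 /inner_bound; apply: lerD.
    rewrite big_F1; apply: ler_sum => k _.
    rewrite mulr_natl -[X in _ <= X]addr0 -iter_addr -(count_predT (generation c k.+1)) -big_const_seq.
    rewrite big_seq [X in _ <= X]big_seq; apply: ler_sum => v vk.
    by rewrite (size_generation_vertex vk) gerBl sqr_ge0.
  rewrite big_F1; apply: le_of_eq; congr (_ ^+ 2); apply: eq_bigr => k _.
  rewrite mulr_sumr; apply: eq_big_seq => v vk.
  by rewrite (size_generation_vertex vk) mulrC.
have VE : \sum_(v <- F2) (sq (size v) - (sgn v * mu (size v)) ^+ 2) =
    (size (generation c l.+1))%:R * (sq l.+1 - mu l.+1 ^+ 2).
  rewrite mulr_natl -[RHS]addr0 -iter_addr -(count_predT (generation c l.+1)) -big_const_seq.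
  apply: eq_big_seq => v vk; rewrite (size_generation_vertex vk) exprMn.
  by rewrite sgn_sqr mul1r.
have hBW v w : v \in F2 -> `|W v w - sgn v * mu (size v)| <= B.
  move=> vF; rewrite /W (size_generation_vertex vF) -mulrBr normrM.
  have -> : `|sgn v| = 1.
    by apply/eqP; rewrite -sqrp_eq1 // -normrX sgn_sqr normr1.
  by rewrite mul1r.
have s001 : 0 < s0 <= 1 by rewrite s00.
have := anticoncentration indepT mW (generation_uniq c l.+1)
  (fun v vF => W_mean (F2n v vF)) (fun v vF => W_sqr_mean (F2n v vF)) hBW s001.
rewrite VE => /(_ hs0 hB2) [q hq qge].
pose ind w : R := \1_[set w | `|S w| <= K - 1] w.
have mind : sub_measurable T [set` F1] ind.
  apply: measurable_indic.
  rewrite -[X in measurable X]setTI; apply: measurable_fun_le => //.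
  exact: measurableT_comp.
have [p hp] : exists p, has_mean P ind p.
  apply: (@has_mean_bounded _ _ _ _ _ 1); first exact: sub_measurableW mind.
  by move=> w; rewrite /ind indicE ger0_norm // lern1 leq_b1.
have p0 : 0 <= p by apply: has_mean_ge0 hp => w.
have pge : 1 - inner_bound / (K - 1) ^+ 2 <= p.
  have K0 : 0 < K - 1 by rewrite subr_gt0.
  have := has_mean_le_prob K0 S2 (sub_measurableW mS).
  have -> : P [set w | `|S w| <= K - 1] = p%:E.
    case: hp => _ <-; rewrite /ind integral_indic ?setIT //.
    rewrite -[X in measurable X]setTI; apply: measurable_fun_le => //.
    exact: measurableT_comp (sub_measurableW mS).
  rewrite lee_fin; apply: le_trans; rewrite lerD2l lerN2.
  by rewrite ler_pM2r // invr_gt0 exprn_gt0.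
have disj : [set` F2] `&` [set` F1] = set0.
  rewrite -subset0 => v /= [v2 /F1_size]; rewrite (size_generation_vertex v2).
  by rewrite ltnn andbF.
have hqp : has_mean P (fun w => Num.min `|D w| 1 * ind w) (q * p).
  apply: (has_meanM indepT disj _ mind hq hp).
  by apply: measurable_minr => //; exact: measurableT_comp.
pose J := [set v : vertex | v != [::]].
have J1 : [set` F1] `<=` J by move=> v /F1n.
have J2 : [set` F2] `<=` J by move=> v /F2n.
pose L : {mfun Omega >-> R} := HB.pack (fun w => llr_term gamma 0 (T [::] w))
  (isMeasurableFun.Build _ _ _ _ _
    (measurableT_comp (measurable_llr_term gamma 0) (measurable_funP (T [::])))).
have mL : sub_measurable T [set ([::] : vertex)] L.
  apply: measurableT_comp; first exact: measurable_llr_term.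
  exact: (@sub_space_measurable _ _ _ _ T [set ([::] : vertex)] [::] erefl).
have Jn : ~ J [::] by move=> /=.
have := flip_prob_ge (L := L) indepT mf f0 root_law fb beta0 (sgn_sqr [::]) Jn mL
  (sub_measurableS J1 mS) (sub_measurableS J2 mD) hqp.
apply: le_trans; rewrite lee_fin ler_wpM2l //.
have q0 : 0 <= q by apply: le_trans qge; rewrite mulr_ge0 // ltW.
apply: (@le_trans _ _ (s0 / 128 * p)).
  by rewrite ler_wpM2l // mulr_ge0 // ltW.
by rewrite ler_wpM2r.
Qed.

End ConditionalFlip.

(** * Log-likelihood ratio statistics *)

Section Expectation.
Context {R : realType} {d : measure_display} {E : measurableType d}.
Variable P : probability E R.

Lemma has_mean_expectation (X : E -> R) m : has_mean P X m -> ('E_P[X] = m%:E)%E.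
Proof. by move=> [_ Xm]; rewrite unlock. Qed.

Lemma has_mean_variance (X : E -> R) m s : has_mean P X m ->
  has_mean P (fun x => X x ^+ 2) s -> ('V_P[X] = (s - m ^+ 2)%:E)%E.
Proof.
move=> Xm Xs; rewrite /variance unlock (has_mean_expectation Xm) /=.
apply: has_mean_expectation.
have -> : s - m ^+ 2 = s - 2 * m * m + m ^+ 2 by ring.
apply: eq_has_mean (has_meanD (has_meanB Xs (has_meanZ (2 * m) Xm))
  (has_mean_cst P (m ^+ 2))) => x.
rewrite -[RHS]/((X x - m) * (X x - m)); ring.
Qed.

End Expectation.

Section Densities.
Context {R : realType} {d : nat}.
Variables (rhop rhom : d.-tuple R -> R).
Hypothesis mp : measurable_fun setT rhop.
Hypothesis mm : measurable_fun setT rhom.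
Hypothesis p0 : forall x, 0 <= rhop x.
Hypothesis m0 : forall x, 0 <= rhom x.

Lemma tstat_measurable : measurable_fun setT (tstat rhop rhom).
Proof.
apply: measurable_funM; first exact: measurable_funB.
apply: measurableT_comp; first exact: measurable_invr.
exact: measurable_funD.
Qed.

Lemma tstat_le1 x : `|tstat rhop rhom x| <= 1.
Proof.
rewrite /tstat; have := p0 x; have := m0 x; move: (rhop x) (rhom x) => p m hm hp.
have [E|n0] := eqVneq (p + m) 0; first by rewrite E invr0 mulr0 normr0.
have pm : 0 < p + m by rewrite lt_neqAle eq_sym n0 addr_ge0.
rewrite normrM normfV (gtr0_norm pm) ler_pdivrMr // mul1r ler_norml.
by apply/andP; split; lra.
Qed.

(* Also true when one of the densities vanishes: both sides are then [0]. *)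
Lemma llr_term0_tstat gamma x :
  llr_term gamma 0 (tstat rhop rhom x) = ln (psi rhop rhom x).
Proof.
rewrite /llr_term /artanh expr0 mul1r [2 * _]mulrC divfK // /tstat /psi.
have := p0 x; have := m0 x; move: (rhop x) (rhom x) => p m hm hp.
have [E|n0] := eqVneq (p + m) 0.
  have [-> ->] : p = 0 /\ m = 0 by split; lra.
  by rewrite subrr !mul0r addr0 subr0 divr1 ln1 ln0.
have [E|m1] := eqVneq m 0.
  move: n0; rewrite E addr0 => pn0.
  by rewrite subr0 divff // subrr !invr0 !mulr0 ln0.
congr ln; field; rewrite m1 n0 ?andbT /=.
by rewrite (_ : p + m - (p - m) = 2 * m) ?mulf_neq0 //; ring.
Qed.

Variables (mu : {measure set (d.-tuple R) -> \bar R}) (Pp Pm : probability (d.-tuple R) R).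

(** [tau] exchanges the two densities almost everywhere, so [t (tau x) = - t x] there. The change of
    variables along [tau] turns the integral of [rhom] into one of [rhop] over the preimage set. *)
Lemma tstat_symmetry (A : set R) : symmetric_densities mu Pp Pm rhop rhom ->
  measurable A ->
  Pm [set x | A (- tstat rhop rhom x)] = Pp [set x | A (tstat rhop rhom x)].
Proof.
move=> [_ _ [_ _ Pdp] [_ _ Pdm] [tau [[mtau invt mpt] aetau]]] mA.
have mt := tstat_measurable.
set t := tstat rhop rhom in mt *.
pose B := [set x | A (- t x)].
have mB : measurable B.
  by rewrite -[B]setTI; apply: (measurable_funN mt).
pose D := tau @^-1` B.
have mD : measurable D by rewrite -[D]setTI; exact: mtau.
have mD' : measurable [set x | A (t x)] by rewrite -[X in measurable X]setTI; exact: mt.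
have aetau2 : {ae mu, forall x, rhom (tau x) = rhop x}.
  case: aetau => N [mN N0 subN]; exists (tau @^-1` N); split.
  - by rewrite -[X in measurable X]setTI; exact: mtau.
  - by rewrite mpt.
  - by move=> x /= Hx; apply: subN => /= H; apply: Hx; rewrite H invt.
have aet : {ae mu, forall x, t (tau x) = - t x}.
  apply: filterS2 aetau aetau2 => x h1 h2.
  by rewrite /t /tstat -h1 h2 -mulNr opprB addrC [rhom x + _]addrC.
transitivity (Pp D).
  rewrite Pdm // Pdp //.
  transitivity (\int[mu]_(x in B) (rhop (tau x))%:E)%E.
    apply: ge0_ae_eq_integral => //.
    - exact/measurable_EFinP/measurable_funTS.
    - apply/measurable_EFinP/measurable_funTS; exact: measurableT_comp.
    - by move=> x _; rewrite lee_fin.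
    - by move=> x _; rewrite lee_fin.
    - by apply: filterS aetau => x h1 _; rewrite h1.
  transitivity (\int[pushforward mu tau]_(x in D) (rhop x)%:E)%E.
    rewrite [RHS]ge0_integral_pushforward //; first last.
    - by move=> x _; rewrite lee_fin.
    - exact/measurable_EFinP/measurable_funTS.
    congr (integral mu _ _); apply/seteqP; split=> x; rewrite /D /= invt //.
  by apply: eq_measure_integral => S mS _; exact: mpt.
rewrite !Pdp // integral_mkcond [RHS]integral_mkcond.
apply: ge0_ae_eq_integral => //.
- apply/(measurable_restrictT _ _).1 => //; exact/measurable_EFinP/measurable_funTS.
- apply/(measurable_restrictT _ _).1 => //; exact/measurable_EFinP/measurable_funTS.
- by move=> x _; apply: erestrict_ge0 => y _; rewrite lee_fin.
- by move=> x _; apply: erestrict_ge0 => y _; rewrite lee_fin.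
apply: filterS aet => x tx _; rewrite /patch /D /B.
by congr (if _ then _ else _); apply/idP/idP; rewrite !inE /= tx opprK.
Qed.

End Densities.

Section Inequalities.
Context {R : realType}.

Lemma geometric_sum_le (x : R) l : 0 <= x < 1 -> \sum_(k < l) x ^+ k.+1 <= x / (1 - x).
Proof.
move=> /andP[x0 x1]; have d0 : 0 < 1 - x by rewrite subr_gt0.
have : \sum_(k < l) x ^+ k.+1 = x * (1 - x ^+ l) / (1 - x).
  elim: l => [|l IH]; first by rewrite big_ord0 expr0 subrr mulr0 mul0r.
  rewrite big_ord_recr /= IH exprS; move: (x ^+ l) => y; field; exact: lt0r_neq0.
move=> ->; rewrite ler_pM2r ?invr_gt0 // ler_piMr // gerBl exprn_ge0 //.
Qed.

(* [min W 1] is not integrated directly: its quadratic minorant only needs the first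
   two moments of the normalised generation size [W], and [Q] bounds the second. *)
Lemma quadratic_minorant (W rho Q : R) : 0 <= W -> 0 <= rho -> 1 <= Q ->
  (W - 3 / 8 * W ^+ 2 / Q - 2 * Q * rho <= 0) \/
  (W - 3 / 8 * W ^+ 2 / Q - 2 * Q * rho <= Q * (Num.min W 1 * (1 - rho))).
Proof.
move=> W0 r0 Q1.
have Q0 : 0 < Q by lra.
have peak : W - 3 / 8 * W ^+ 2 / Q <= 2 / 3 * Q.
  rewrite -subr_ge0 (_ : _ - _ = 3 / 8 * (W - 4 / 3 * Q) ^+ 2 / Q); last by field; exact: lt0r_neq0.
  apply: divr_ge0; last exact: ltW.
  by apply: mulr_ge0; [lra|exact: sqr_ge0].
have sq0 : 0 <= 3 / 8 * W ^+ 2 / Q.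
  apply: divr_ge0; last exact: ltW.
  by apply: mulr_ge0; [lra|exact: sqr_ge0].
have [r1|r1] := lerP 1 rho; first by left; nra.
right; have [W1|W1] := lerP W 1.
  have : W * rho <= Q * rho by rewrite ler_wpM2r //; lra.
  have : W * (1 - rho) <= Q * (W * (1 - rho)).
    by rewrite ler_peMl // mulr_ge0 //; lra.
  nra.
nra.
Qed.

Lemma power_le_eventually (x e : R) : 1 < x -> 0 < e ->
  exists n0 : nat, forall n, (n0 <= n)%N -> e <= x ^+ n.
Proof.
move=> x1 e0; exists (Num.bound (e / (x - 1))) => n n0.
have bern : 1 + n%:R * (x - 1) <= x ^+ n.
  elim: {n0} n => [|n IH]; first by rewrite mul0r addr0 expr0.
  rewrite exprS -natr1; have n0 : 0 <= n%:R :> R by [].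
  have : x * (1 + n%:R * (x - 1)) <= x * x ^+ n by rewrite ler_wpM2l //; lra.
  have : 0 <= n%:R * (x - 1) ^+ 2 by rewrite mulr_ge0 // sqr_ge0.
  move: (x ^+ n) (n%:R) n0 IH => y m m0 IH; nra.
apply: le_trans bern; have d0 : 0 < x - 1 by lra.
have := archi_boundP (ltW (divr_gt0 e0 d0)); rewrite ltr_pdivrMr // => h.
have : (Num.bound (e / (x - 1)))%:R * (x - 1) <= n%:R * (x - 1).
  by rewrite ler_wpM2r ?ler_nat // ltW.
lra.
Qed.

(* The left-hand side bounds the second moment of the inner levels; the last factor
   is [(K0 - 1)^2], so that Chebyshev loses only [5 / (48 Q)]. *)
Lemma inner_ratio_le (gamma kappa theta Q q : R) : 0 < gamma < 1 -> 0 < kappa < 1 ->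
  0 < theta -> 1 <= Q ->
  q = (1 + kappa) / 2 ->
  (2 / (1 - gamma)) ^+ 2 * theta * (kappa / (1 - kappa) +
     q / (1 - q) * ((kappa / q) / (1 - kappa / q) / (1 - kappa)))
  <= 5 / (48 * Q) * (64 * (3 * (2 / (1 - gamma ^+ 2)) ^+ 2 * theta / (1 - kappa) ^+ 3
     * kappa * Q)).
Proof.
move=> /andP[g0 g1] /andP[k0 k1] t0 Q1 qE.
have Q0 : 0 < Q by lra.
have q0 : 0 < q by lra.
have dk : 0 < 1 - kappa by lra.
have -> : kappa / (1 - kappa) + q / (1 - q) * ((kappa / q) / (1 - kappa / q) / (1 - kappa)) =
   kappa * ((1 - kappa) ^+ 2 + 2 * (1 + kappa)) / (1 - kappa) ^+ 3.
  by rewrite qE; field; repeat (apply/andP; split); apply: lt0r_neq0; lra.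
have -> : 5 / (48 * Q) * (64 * (3 * (2 / (1 - gamma ^+ 2)) ^+ 2 * theta / (1 - kappa) ^+ 3
     * kappa * Q)) = (2 / (1 - gamma)) ^+ 2 * theta * (kappa * (20 / (1 + gamma) ^+ 2) / (1 - kappa) ^+ 3).
  have -> : 1 - gamma ^+ 2 = (1 - gamma) * (1 + gamma) by ring.
  by field; repeat (apply/andP; split); apply: lt0r_neq0; lra.
rewrite ler_wpM2l //; first by rewrite mulr_ge0 ?sqr_ge0 // ltW.
rewrite ler_pM2r ?invr_gt0 ?exprn_gt0 // ler_pM2l //.
(* [(1 - kappa)^2 + 2 (1 + kappa) = 3 + kappa^2 <= 5], while [(1 + gamma)^2 <= 4]. *)
apply: (@le_trans _ _ 5); first nra.
rewrite ler_pdivlMr; last by rewrite exprn_gt0 //; lra.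
nra.
Qed.

End Inequalities.

(** [128] comes from anticoncentration, [1/4] from the mean of the minorant and
    [Delta / (Delta - 1)] from the second moment of the normalised generation size. The new level
    has scale [kappa^((l+1)/2)], whence the factor [sqrt kappa]. *)
Definition flip_const {R : realType} (gamma Delta kappa vt st beta : R) : R :=
  beta * st * Num.sqrt kappa / 128 / (4 * (Delta / (Delta - 1))).

(** The first condition makes [2 gamma^n t] close enough to [llr_term] at level [n] to secure its
    variance; the second caps the correction that the minorant carries for small generations. *)
Definition flip_level_ok {R : realType} (gamma Delta st : R) (n : nat) : Prop :=
  [/\ gamma ^+ n / (1 - gamma) <= st / 2 &
      4 * (2 / (1 - gamma)) ^+ 2 / st ^+ 2 / Delta ^+ n <= 1 / 8].

Lemma flip_level_ex {R : realType} (gamma Delta st : R) :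
  0 < gamma < 1 -> 1 < Delta -> 0 < st ->
  exists n0 : nat, forall n, (n0 <= n)%N -> flip_level_ok gamma Delta st n.
Proof.
move=> /andP[g0 g1] D1 st0.
have dg : 0 < 1 - gamma by rewrite subr_gt0.
have gi : 1 < gamma^-1 by rewrite invf_gt1.
have e1 : 0 < 2 / (1 - gamma) / st by rewrite !divr_gt0.
pose e2 := 8 * (4 * (2 / (1 - gamma)) ^+ 2 / st ^+ 2).
have e20 : 0 < e2 by rewrite !mulr_gt0 // ?invr_gt0 ?exprn_gt0 // divr_gt0.
have [n1 H1] := power_le_eventually gi e1.
have [n2 H2] := power_le_eventually D1 e20.
exists (maxn n1 n2) => n; rewrite geq_max => /andP[h1 h2]; split.
  have := H1 n h1; rewrite exprVn => h.
  have gn : 0 < gamma ^+ n by rewrite exprn_gt0.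
  rewrite ler_pdivrMr //.
  move: h; rewrite -[gamma ^- n]div1r ler_pdivlMr // => h.
  rewrite (_ : gamma ^+ n = 2 / (1 - gamma) / st * gamma ^+ n * (st / 2 * (1 - gamma))).
    by rewrite ler_piMl // mulr_ge0 // ltW // divr_gt0.
  by field; rewrite !lt0r_neq0.
have := H2 n h2; rewrite /e2 => h.
have Dn : 0 < Delta ^+ n by rewrite exprn_gt0 //; lra.
rewrite ler_pdivrMr //; lra.
Qed.

(** * The lower bound on the tree *)

(* [n] is the size of generation [l + 1], of mean [D], and [s0] is
   [min (n / D) 1 * st * kappa^((l+1)/2)], a lower bound for the conditional standard
   deviation of that level; the term [4 b^2 / st^2 / D] makes the minorant negative
   for the small [n] where the fourth moment is not controlled. *)
Lemma flip_scale_ex {R : realType} (st beta sk kl G n D b rho Q : R) :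
  0 < st <= 1 -> 0 < beta -> 0 < sk <= 1 -> 0 < kl <= 1 -> 0 < D -> 0 <= n ->
  (sk * kl) ^+ 2 = G ^+ 2 * D -> 0 <= rho -> 1 <= Q ->
  n / D - 3 / 8 * (n / D) ^+ 2 / Q - 2 * Q * rho - 4 * b ^+ 2 / st ^+ 2 / D <= 0 \/
  exists s0, [/\ 0 < s0 <= 1, s0 ^+ 2 <= n * (G ^+ 2 * st ^+ 2),
    (2 * b * G) ^+ 2 <= n * (G ^+ 2 * st ^+ 2) &
    beta * st * sk / 128 * kl / Q *
      (n / D - 3 / 8 * (n / D) ^+ 2 / Q - 2 * Q * rho - 4 * b ^+ 2 / st ^+ 2 / D)
    <= beta * (s0 / 128 * (1 - rho))].
Proof.
move=> /andP[st0 st1] beta0 /andP[sk0 sk1] /andP[kl0 kl1] D0 n0 skE rho0 Q1.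
have Q0 : 0 < Q by lra.
have W0 : 0 <= n / D by rewrite divr_ge0 // ltW.
set W := n / D in W0 *.
have cD0 : 0 <= 4 * b ^+ 2 / st ^+ 2 / D.
  by rewrite divr_ge0 ?(ltW D0) // divr_ge0 ?sqr_ge0 // mulr_ge0 ?sqr_ge0.
have [nb|nb] := lerP n (4 * b ^+ 2 / st ^+ 2).
  left; have h1 : W <= 4 * b ^+ 2 / st ^+ 2 / D by rewrite ler_pM2r ?invr_gt0.
  have h2 : 0 <= 3 / 8 * W ^+ 2 / Q.
    by rewrite divr_ge0 ?(ltW Q0) // mulr_ge0 ?sqr_ge0 // divr_ge0.
  have h3 : 0 <= 2 * Q * rho by rewrite mulr_ge0 // mulr_ge0 // ltW.
  lra.
have n1 : 0 < n.
  by apply: le_lt_trans nb; rewrite divr_ge0 ?sqr_ge0 // mulr_ge0 ?sqr_ge0.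
have W1 : 0 < W by rewrite divr_gt0.
case: (quadratic_minorant W0 rho0 Q1) => hq; first by left; lra.
right; exists (st * sk * kl * Num.min W 1); set m := Num.min W 1 in hq *.
have m0 : 0 < m by rewrite lt_min W1 ltr01.
have m1 : m <= 1 by rewrite ge_min lexx orbT.
have mW : m <= W by rewrite ge_min lexx.
have G2 := sqr_ge0 G.
split.
- rewrite !mulr_gt0 //=; apply: mulr_ile1 => //; try exact: ltW.
    by rewrite mulr_ge0 ?mulr_ge0 // ltW.
  apply: mulr_ile1 => //; try exact: ltW.
    by rewrite mulr_ge0 // ltW.
  by apply: mulr_ile1 => //; exact: ltW.
- rewrite -[st * _ * _]mulrA exprMn exprMn skE.
  rewrite (_ : n = W * D); last by rewrite /W divfK // gt_eqF.
  have : m ^+ 2 <= W by nra.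
  have : 0 <= st ^+ 2 * (G ^+ 2 * D).
    by rewrite mulr_ge0 ?sqr_ge0 // mulr_ge0 // ltW.
  move: (st ^+ 2) => u h1 h2.
  have := ler_wpM2l h1 h2; move: (m ^+ 2) (G ^+ 2) => ? ?; lra.
- rewrite ltr_pdivrMr ?exprn_gt0 // in nb.
  rewrite [X in X <= _](_ : _ = G ^+ 2 * (4 * b ^+ 2)); last by ring.
  rewrite [X in _ <= X](_ : _ = G ^+ 2 * (n * st ^+ 2)); last by ring.
  by apply: ler_wpM2l => //; exact: ltW.
pose c := beta * st * sk / 128 * kl.
have c0 : 0 <= c by rewrite /c !mulr_ge0 // ?ltW.
have -> : beta * (st * sk * kl * m / 128 * (1 - rho)) = c / Q * (Q * (m * (1 - rho))).
  by rewrite /c; field; rewrite gt_eqF.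
rewrite -/c; apply: ler_wpM2l; first by rewrite divr_ge0 // ltW.
lra.
Qed.

Lemma powR_half_sqr {R : realType} (k : R) l : 0 <= k -> (k `^ (l%:R / 2)) ^+ 2 = k ^+ l.
Proof.
by move=> k0; rewrite -(powR_mulrn 2) ?powR_ge0 // -powRrM divfK // powR_mulrn.
Qed.

Section LowerBound.
Context {R : realType} {d : nat} {dO : measure_display}
  {Omega : measurableType dO}.
Variables (mu : {measure set (d.-tuple R) -> \bar R})
  (Pp Pm : probability (d.-tuple R) R) (rhop rhom : d.-tuple R -> R)
  (P : probability Omega R) (Delta gamma beta : R)
  (C : vertex -> Omega -> nat) (y : vertex -> Omega -> bool)
  (X : vertex -> Omega -> d.-tuple R).

Let kappa := snr gamma Delta.
Let vt := theta Pp rhop rhom.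
Let st := sigma_t Pp rhop rhom.
Let t := tstat rhop rhom.
Let b : R := 2 / (1 - gamma).
Let Q : R := Delta / (Delta - 1).
Let K : R := K0 gamma Delta vt.
(** Halfway between [kappa] and [1]: the geometric series of ratios [q] and [kappa / q] both
    converge, with [1 - q = q - kappa = (1 - kappa) / 2]. This yields the cube of [1 - kappa]
    present in [C1]. *)
Let q : R := (1 + kappa) / 2.

Hypothesis Delta_gt1 : 1 < Delta.
Hypothesis gamma01 : 0 < gamma < 1.
Hypothesis kappa_lt1 : kappa < 1.
Hypothesis tree : is_broadcast_tree P Delta gamma Pp Pm C y X.
Hypothesis sym : symmetric_densities mu Pp Pm rhop rhom.
Hypothesis vt_gt0 : 0 < vt.
Hypothesis var_gt0 : 0 < var_t Pp rhop rhom.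
Hypothesis beta_gt0 : 0 < beta.
Hypothesis dens : log_psi_density_ge Pp rhop rhom K beta.

Let mp : measurable_fun setT rhop. Proof. by case: sym => _ _ []. Qed.
Let mm : measurable_fun setT rhom. Proof. by case: sym => _ _ _ []. Qed.
Let p0 x : 0 <= rhop x. Proof. by case: sym => _ _ [_ H _] _ _; exact: H. Qed.
Let m0 x : 0 <= rhom x. Proof. by case: sym => _ _ _ [_ H _] _; exact: H. Qed.
Let mt : measurable_fun setT t. Proof. exact: tstat_measurable. Qed.
Let t1 x : `|t x| <= 1. Proof. exact: tstat_le1. Qed.
Let tsym A : measurable A -> Pm [set x | A (- t x)] = Pp [set x | A (t x)].
Proof. exact: tstat_symmetry sym. Qed.
Let Delta_gt0 : 0 < Delta. Proof. exact: lt_trans Delta_gt1. Qed.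

Let Z := tree_rv tree (@mt).
Let indepZ : mutually_independent P Z.
Proof. apply: (tree_independent tree (@mt) (@tsym) Delta_gt0). Qed.

Let T (v : vertex) : {mfun Omega >-> R} := Z (ftr v).
Let indepT : mutually_independent P T.
Proof. by apply: (mutually_independent_comp indepZ) => u v []. Qed.

Let countE v w : Z (cnt v) w = (C v w)%:R. Proof. by []. Qed.
Let flip_sqr v w : Z (flp v) w ^+ 2 = 1.
Proof. by rewrite /Z /=; case: (flip _ _ _); rewrite ?sqrrN expr1n. Qed.

Let spinE v w : spin Z v w = if y v w then 1 else -1.
Proof.
elim: v => [|i u IH]; rewrite /spin /=; first by [].
rewrite -/(spin Z u w) IH; case: (y (i :: u) w); case: (y u w) => /=;
  by rewrite ?mulr1 ?mul1r ?mulrN1 ?opprK.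
Qed.

Let N := gen_size (R := R) C.
Let S := gen_spin Z C.

Let t_mean : exists m1, has_mean Pp t m1.
Proof. exact: has_mean_bounded (@mt) t1. Qed.

Let t_sqr_mean : has_mean Pp (fun x => t x ^+ 2) vt.
Proof.
have [s hs] : exists s, has_mean Pp (fun x => t x ^+ 2) s.
  apply: (@has_mean_bounded _ _ _ _ _ 1); first exact: measurable_funX.
  by move=> x; rewrite normrX exprn_ile1.
by rewrite /vt /theta (has_mean_expectation hs).
Qed.

Let st_gt0 : 0 < st.
Proof. by rewrite sqrtr_gt0. Qed.

Let st_sqr m1 : has_mean Pp t m1 -> st ^+ 2 = vt - m1 ^+ 2.
Proof.
move=> hm1; rewrite /st /sigma_t sqr_sqrtr ?(ltW var_gt0) //.
by rewrite /var_t (has_mean_variance hm1 t_sqr_mean).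
Qed.

Let vt_le1 : vt <= 1.
Proof.
apply: le_has_mean t_sqr_mean (has_mean_cst Pp 1) => x.
by rewrite -[_ ^+ 2]ger0_norm ?sqr_ge0 // normrX exprn_ile1.
Qed.

Let st_le1 : st <= 1.
Proof.
have [m1 hm1] := t_mean.
rewrite -(@ler_pXn2r _ 2) ?nnegrE ?expr1n ?(ltW st_gt0) // (st_sqr hm1).
by apply: le_trans vt_le1; rewrite gerBl sqr_ge0.
Qed.

Let Q_ge1 : 1 <= Q.
Proof. by rewrite /Q ler_pdivlMr ?subr_gt0 // mul1r gerBl ler01. Qed.

Let kappa_gt0 : 0 < kappa.
Proof. by case/andP: gamma01 => g0 _; rewrite /kappa /snr mulr_gt0 // exprn_gt0. Qed.

Let K_sqr : (K - 1) ^+ 2 = 64 * (3 * (2 / (1 - gamma ^+ 2)) ^+ 2 * vt / (1 - kappa) ^+ 3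
     * kappa * Q).
Proof.
have dk : 0 < 1 - kappa by rewrite subr_gt0.
rewrite /K /K0 addrC addKr exprMn sqr_sqrtr; last first.
  rewrite /C1 -/kappa; apply: divr_ge0; last by rewrite subr_ge0 ltW.
  apply: mulr_ge0; last exact: ltW.
  apply: mulr_ge0; last exact: ltW.
  apply: divr_ge0; last by rewrite exprn_ge0 // ltW.
  by rewrite mulr_ge0 ?(ltW vt_gt0) // mulr_ge0 // sqr_ge0.
rewrite /C1 /c_gamma -/kappa /Q.
by move: (2 / (1 - gamma ^+ 2)) (((1 - kappa) ^+ 3)^-1) (Delta - 1)^-1 => ? ? ?; ring.
Qed.

Let K_gt1 : 1 < K.
Proof.
have dk : 0 < 1 - kappa by rewrite subr_gt0.
case/andP: gamma01 => g0 g1.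
have dg : 0 < 1 - gamma ^+ 2 by rewrite subr_gt0 expr_lt1 // ltW.
rewrite /K /K0 ltrDl mulr_gt0 // sqrtr_gt0 /C1 -/kappa /c_gamma.
apply: divr_gt0; last by rewrite subr_gt0.
apply: mulr_gt0 => //; apply: mulr_gt0 => //.
apply: divr_gt0; last by rewrite exprn_gt0.
by apply: mulr_gt0 => //; apply: mulr_gt0 => //; rewrite exprn_gt0 // divr_gt0.
Qed.

(* Cauchy-Schwarz with the weights [q^(k+1)], [kappa < q < 1], turns the square of the
   sum over the levels into a sum of squares with a convergent mean. *)
Let rbar l w : R := b ^+ 2 * vt *
  (\sum_(k < l) gamma ^+ (2 * k.+1) * N k.+1 w +
   (\sum_(k < l) q ^+ k.+1) *
   \sum_(k < l) gamma ^+ (2 * k.+1) / q ^+ k.+1 * S k.+1 w ^+ 2).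

Let spin_mean k : has_mean P (fun w => S k w ^+ 2)
  (Delta ^+ k * (1 - kappa ^+ k.+1) / (1 - kappa)).
Proof.
apply: (gen_spin_sqr_mean (gamma := gamma) (Delta := Delta)) => //.
- exact: (count_mean tree (@mt) (@tsym) Delta_gt0).
- exact: (count_sqr_mean tree (@mt) (@tsym) Delta_gt0).
- exact: (flip_mean tree (@mt) (@tsym) Delta_gt0).
- by move: kappa_lt1; rewrite /kappa /snr => /lt_eqF ->.
Qed.

Let size_mean k : has_mean P (N k) (Delta ^+ k).
Proof.
apply: (gen_size_mean indepZ countE).
exact: (count_mean tree (@mt) (@tsym) Delta_gt0).
Qed.

Let size_sqr_mean k : has_mean P (fun w => N k w ^+ 2)
    (Q * Delta ^+ (2 * k) - Delta ^+ k / (Delta - 1)).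
Proof.
apply: (gen_size_sqr_mean indepZ countE).
- exact: (count_mean tree (@mt) (@tsym) Delta_gt0).
- exact: (count_sqr_mean tree (@mt) (@tsym) Delta_gt0).
- by rewrite gt_eqF.
Qed.

Let rbar_mean l : exists2 r, has_mean P (rbar l) r & r <= 5 / (48 * Q) * (K - 1) ^+ 2.
Proof.
have dk : 0 < 1 - kappa by rewrite subr_gt0.
have q01 : 0 < q < 1 by move: kappa_gt0 kappa_lt1; rewrite /q => h1 h2; apply/andP; split; lra.
have kq : kappa < q by move: kappa_lt1; rewrite /q; lra.
case/andP: q01 => q0 q1.
have h1 := has_mean_sum (s := enum 'I_l)
  (fun k _ => has_meanZ (gamma ^+ (2 * k.+1)) (size_mean k.+1)).
have h2 := has_mean_sum (s := enum 'I_l)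
  (fun k _ => has_meanZ (gamma ^+ (2 * k.+1) / q ^+ k.+1) (spin_mean k.+1)).
have h := has_meanZ (b ^+ 2 * vt) (has_meanD h1 (has_meanZ (\sum_(k < l) q ^+ k.+1) h2)).
eexists.
  apply: eq_has_mean h => w; rewrite /rbar !big_enum //.
rewrite K_sqr !big_enum /=.
apply: le_trans (inner_ratio_le (q := q) gamma01 _ vt_gt0 Q_ge1 erefl); last first.
  by rewrite kappa_gt0.
have b2 : 0 <= b ^+ 2 * vt by rewrite mulr_ge0 ?sqr_ge0 // ltW.
apply: ler_wpM2l => //; apply: lerD.
  apply: le_trans (geometric_sum_le l _); last by rewrite (ltW kappa_gt0).
  apply: ler_sum => k _; apply: le_of_eq.
  by rewrite /kappa /snr exprMn -exprM.
apply: ler_pM.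
- by apply: sumr_ge0 => k _; rewrite exprn_ge0 // ltW.
- apply: sumr_ge0 => k _; rewrite mulr_ge0 //.
    by rewrite divr_ge0 // exprn_ge0 // ltW //; case/andP: gamma01.
  rewrite mulr_ge0 ?invr_ge0 ?(ltW dk) // mulr_ge0 ?exprn_ge0 ?(ltW Delta_gt0) //.
  by rewrite subr_ge0 exprn_ile1 // ltW.
- by apply: geometric_sum_le; rewrite (ltW q0).
apply: (@le_trans _ _ (\sum_(k < l) (kappa / q) ^+ k.+1 / (1 - kappa))).
  apply: ler_sum => k _.
  have -> : (kappa / q) ^+ k.+1 / (1 - kappa) =
     gamma ^+ (2 * k.+1) / q ^+ k.+1 * (Delta ^+ k.+1 / (1 - kappa)).
    rewrite expr_div_n {1}/kappa /snr exprMn -exprM; ring.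
  rewrite ler_wpM2l //.
    by rewrite divr_ge0 // exprn_ge0 // ltW //; case/andP: gamma01.
  rewrite ler_pM2r ?invr_gt0 // ler_piMr ?exprn_ge0 ?(ltW Delta_gt0) //.
  by rewrite gerBl exprn_ge0 // ltW.
rewrite -mulr_suml ler_pM2r ?invr_gt0 //; apply: geometric_sum_le.
by rewrite divr_ge0 ?(ltW kappa_gt0) ?(ltW q0) //= ltr_pdivrMr // mul1r.
Qed.

Let feature_le1 v w : `|T v w| <= 1.
Proof. by rewrite /T /Z /= /feature; case: (y v w); rewrite ?normrN; exact: t1. Qed.

(** Since [artanh] is odd, the label sign in front cancels the one inside the signed feature. The
    tree and the labels now enter through [generation] and [spin] only, apart from the features. *)
Let hE l w : h gamma rhop rhom C X l w =
  Num.sg (\sum_(k < l.+1) \sum_(v <- generation (C ^~ w) k)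
    spin Z v w * llr_term gamma k (T v w)).
Proof.
case/andP: gamma01 => g0 g1.
rewrite /h /T_stat; congr Num.sg; apply: eq_bigr => k _; apply: eq_bigr => v _.
rewrite spinE /T /Z /= /feature /llr_term /M; case: (y v w); first by rewrite mul1r.
rewrite mulrN artanhN ?mulrN ?mulN1r ?opprK // normrM -/(t _).
by rewrite mulr_ile1 // ger0_norm ?exprn_ile1 ?exprn_ge0 // ltW.
Qed.

Let moments : exists ms : nat -> R * R, forall k, (0 < k)%N ->
  [/\ has_mean Pp (fun x => llr_term gamma k (t x)) (ms k).1,
      has_mean Pp (fun x => llr_term gamma k (t x) ^+ 2) (ms k).2,
      (ms k).2 <= b ^+ 2 * gamma ^+ (2 * k) * vt,
      (ms k).1 ^+ 2 <= (ms k).2 & `|(ms k).1| <= b * gamma ^+ k] /\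
  (gamma ^+ k / (1 - gamma) <= st / 2 ->
    gamma ^+ (2 * k) * st ^+ 2 <= (ms k).2 - (ms k).1 ^+ 2).
Proof.
pose Pr k (p : R * R) := (0 < k)%N ->
  [/\ has_mean Pp (fun x => llr_term gamma k (t x)) p.1,
      has_mean Pp (fun x => llr_term gamma k (t x) ^+ 2) p.2,
      p.2 <= b ^+ 2 * gamma ^+ (2 * k) * vt,
      p.1 ^+ 2 <= p.2 & `|p.1| <= b * gamma ^+ k] /\
  (gamma ^+ k / (1 - gamma) <= st / 2 ->
    gamma ^+ (2 * k) * st ^+ 2 <= p.2 - p.1 ^+ 2).
suff H : forall k, exists p, Pr k p by have [ms hms] := choice H; exists ms.
(* Level 0 is excluded by [0 < k], so the pair chosen there is arbitrary. *)
case=> [|k]; first by exists (0, 0).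
have [m1 hm1] := t_mean.
have [mk [sk [H1 H2]]] := llr_term_moments (@mt) t1 gamma01 hm1 t_sqr_mean (k := k.+1) isT.
exists (mk, sk) => _; split; first exact: H1.
move=> e; apply: H2 => //; [exact: ltW|exact: st_sqr].
Qed.

(** By symmetry the signed root feature has the law of [t] under [Pp] whatever the root label, so a
    density known under [Pp] suffices. *)
Let root_density : exists f : R -> R,
  [/\ measurable_fun setT f, (forall z, 0 <= f z),
      (forall A : set R, measurable A -> P [set w | A (llr_term gamma 0 (T [::] w))] =
        (\int[lebesgue_measure]_(z in A) (f z)%:E)%E) &
      forall z, - K <= z <= K -> beta <= f z].
Proof.
have [f [mf f0 fl fb]] := dens; exists f; split=> // A mA.
have mlA : measurable (llr_term gamma 0 @^-1` A).
  by rewrite -[X in measurable X]setTI; exact: measurable_llr_term.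
have mtA : measurable [set x | A (llr_term gamma 0 (t x))].
  rewrite -[X in measurable X]setTI.
  exact: (measurableT_comp (measurable_llr_term gamma 0) (@mt)).
transitivity (P (T [::] @^-1` (llr_term gamma 0 @^-1` A))); first by [].
rewrite (tree_var_law tree (@mt) (@tsym) Delta_gt0) //= /feature_law fineK ?fin_num_measure //.
rewrite -fl //; congr (Pp _); apply/seteqP; split=> x /=; by rewrite (llr_term0_tstat).
Qed.

(** Both kinds of coefficients, second moments and squared means, are at most [b^2 gamma^(2k) vt];
    the weighted Cauchy-Schwarz inequality then separates the levels. *)
Let inner_bound_le ms l w : (forall k, (0 < k)%N ->
    (ms k).2 <= b ^+ 2 * gamma ^+ (2 * k) * vt /\ (ms k).1 ^+ 2 <= (ms k).2) ->
  inner_bound (fun k => (ms k).1) (fun k => (ms k).2) (C ^~ w) (spin Z ^~ w) l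
    <= rbar l w.
Proof.
move=> hms; have q0 : 0 < q by move: kappa_gt0; rewrite /q; lra.
rewrite /inner_bound /rbar mulrDr; apply: lerD.
  rewrite mulr_sumr; apply: ler_sum => k _.
  have [h _] := hms k.+1 isT.
  have := ler_wpM2l (ler0n R (size (generation (C ^~ w) k.+1))) h.
  rewrite /N /gen_size; move: (_%:R) (gamma ^+ _) ((ms _).2) => x u v h'.
  by apply: le_trans h' _; apply: le_of_eq; ring.
apply: le_trans (sqr_sum_weighted _ _ (q := fun k : 'I_l => q ^+ k.+1) _) _ => [k|].
  exact: exprn_gt0.
rewrite mulrCA; apply: ler_wpM2l.
  by apply: sumr_ge0 => k _; rewrite exprn_ge0 // ltW.
rewrite mulr_sumr; apply: ler_sum => k _.
have [h1 h2] := hms k.+1 isT.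
rewrite exprMn -/(gen_spin Z C k.+1 w) -/(S k.+1 w).
have h3 := le_trans h2 h1.
have : 0 <= S k.+1 w ^+ 2 / q ^+ k.+1 by rewrite divr_ge0 ?sqr_ge0 // exprn_ge0 // ltW.
move=> /ler_wpM2r /(_ _ _ h3).
move: (S k.+1 w ^+ 2) ((q ^+ k.+1)^-1) (gamma ^+ _) ((ms _).1 ^+ 2) => u v x z h'.
by apply: le_trans (le_of_eq _) (le_trans h' (le_of_eq _)); ring.
Qed.

Let K1_gt0 : 0 < (K - 1) ^+ 2.
Proof. by rewrite exprn_gt0 // subr_gt0 K_gt1. Qed.

Let minorant l w : R :=
  N l.+1 w / Delta ^+ l.+1 - 3 / 8 * (N l.+1 w / Delta ^+ l.+1) ^+ 2 / Q
  - 2 * Q * (rbar l w / (K - 1) ^+ 2) - 4 * b ^+ 2 / st ^+ 2 / Delta ^+ l.+1.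

(** The terms add up to at least [1 - 3/8 - 5/24 - 1/8 = 7/24]: the normalised size has mean 1 and
    second moment at most [Q], and [2 Q] times the mean Chebyshev loss is at most [5/24]. *)
Let minorant_mean l : flip_level_ok gamma Delta st l.+1 ->
  exists2 r, has_mean P (minorant l) r & 1 / 4 <= r.
Proof.
move=> [_ hD].
have D0 : 0 < Delta ^+ l.+1 by rewrite exprn_gt0.
have [r hr rle] := rbar_mean l.
have hW := has_meanZ (Delta ^+ l.+1)^-1 (size_mean l.+1).
have hW2 := has_meanZ (3 / 8 / Q * (Delta ^+ l.+1) ^- 2) (size_sqr_mean l.+1).
have hR := has_meanZ (2 * Q / (K - 1) ^+ 2) hr.
eexists.
  apply: eq_has_mean (has_meanB (has_meanB (has_meanB hW hW2) hR)
    (has_mean_cst P (4 * b ^+ 2 / st ^+ 2 / Delta ^+ l.+1))) => w.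
  rewrite /minorant [(N _ _ / _) ^+ 2]exprMn exprVn.
  move: (N l.+1 w) ((Delta ^+ l.+1)^-1) ((Delta ^+ l.+1) ^- 2) (((K - 1) ^+ 2)^-1)
    (4 * b ^+ 2 / st ^+ 2) => ? ? ? ? ?; ring.
have Q0 : 0 < Q by apply: lt_le_trans Q_ge1.
have h1 : 2 * Q / (K - 1) ^+ 2 * r <= 5 / 24.
  have -> : 5 / 24 = 2 * Q / (K - 1) ^+ 2 * (5 / (48 * Q) * (K - 1) ^+ 2).
    by field; rewrite !gt_eqF // subr_gt0 K_gt1.
  by apply: ler_wpM2l rle; rewrite divr_ge0 ?(ltW K1_gt0) // mulr_ge0 // ltW.
have h2 : 3 / 8 / Q * Delta ^+ l.+1 ^- 2 *
    (Q * Delta ^+ (2 * l.+1) - Delta ^+ l.+1 / (Delta - 1)) <= 3 / 8.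
  have E : 3 / 8 = 3 / 8 / Q * Delta ^+ l.+1 ^- 2 * (Q * Delta ^+ (2 * l.+1)).
    rewrite mulnC exprM; move: (Delta ^+ l.+1) D0 => x x0.
    by field; rewrite !gt_eqF.
  rewrite [X in _ <= X]E; apply: ler_wpM2l.
    by rewrite mulr_ge0 ?invr_ge0 ?sqr_ge0 // divr_ge0 ?(ltW Q0).
  by rewrite gerBl divr_ge0 ?(ltW D0) // subr_ge0 ltW.
rewrite mulVf ?gt_eqF //.
have hb : 4 * b ^+ 2 / st ^+ 2 / Delta ^+ l.+1 <= 1 / 8 := hD.
move: h1 h2 hb; set x := _ * r; set z := _ / Delta ^+ l.+1.
set u := 3 / 8 / Q * _ * _; lra.
Qed.

Let conditional_flip l w1 : flip_level_ok gamma Delta st l.+1 ->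
  ((beta * st * Num.sqrt kappa / 128 * kappa `^ (l%:R / 2) / Q * minorant l w1)%:E <=
   P [set w | Num.sg (\sum_(k < l.+1) \sum_(v <- generation (C ^~ w1) k)
      spin Z v w1 * llr_term gamma k (T v w))%R <>
     Num.sg (\sum_(k < l.+2) \sum_(v <- generation (C ^~ w1) k)
      spin Z v w1 * llr_term gamma k (T v w))%R])%E.
Proof.
move=> [hg _]; have [ms hms] := moments.
have [f [mf f0 fl fb]] := root_density.
case/andP: gamma01 => g0 g1.
have sk0 : 0 < Num.sqrt kappa by rewrite sqrtr_gt0.
have sk1 : Num.sqrt kappa <= 1 by rewrite -sqrtr1 ler_wsqrtr // ltW.
have kl0 : 0 < kappa `^ (l%:R / 2) by rewrite powR_gt0.
have kl1 : kappa `^ (l%:R / 2) <= 1.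
  have k01 : 0 < kappa <= 1 by rewrite kappa_gt0 ltW.
  have l0 : 0 <= l%:R / 2 :> R by rewrite divr_ge0.
  by have := ger_powR k01 l0; rewrite powRr0.
(* [kappa^(l+1)] is the squared coefficient [gamma^(2(l+1))] times the mean size [Delta^(l+1)]: the
   variance scale of the new level. *)
have skE : (Num.sqrt kappa * kappa `^ (l%:R / 2)) ^+ 2 = (gamma ^+ l.+1) ^+ 2 * Delta ^+ l.+1.
  rewrite exprMn sqr_sqrtr ?(ltW kappa_gt0) // (powR_half_sqr _ (ltW kappa_gt0)) -exprS.
  by rewrite {1}/kappa /snr exprMn -!exprM mulnC.
have rho0 : 0 <= rbar l w1 / (K - 1) ^+ 2.
  rewrite divr_ge0 ?(ltW K1_gt0) //.
  have ib := @inner_bound_le ms l w1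
    (fun k k0 => let: conj (And5 _ _ x y _) _ := hms k k0 in conj x y).
  apply: le_trans ib; rewrite addr_ge0 ?sqr_ge0 //; apply: sumr_ge0 => k _.
  rewrite mulr_ge0 //; have [[_ _ _ h _] _] := hms k.+1 isT.
  by apply: le_trans h; exact: sqr_ge0.
have D0 : 0 < Delta ^+ l.+1 by rewrite exprn_gt0.
have N0 : 0 <= N l.+1 w1 by [].
have sk01 : 0 < Num.sqrt kappa <= 1 by rewrite sk0.
have kl01 : 0 < kappa `^ (l%:R / 2) <= 1 by rewrite kl0.
have st01 : 0 < st <= 1 by rewrite st_gt0 st_le1.
have := @flip_scale_ex _ st beta _ _ (gamma ^+ l.+1) _ _ b _ _ st01 beta_gt0 sk01 kl01
  D0 N0 skE rho0 Q_ge1.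
rewrite -/(minorant l w1) => -[neg|[s0 [s01 s0V BV le]]].
  apply: le_trans (measure_ge0 _ _); rewrite lee_fin mulr_ge0_le0 //.
  by rewrite divr_ge0 ?(le_trans ler01 Q_ge1) // !mulr_ge0 // ltW.
have var_ge : N l.+1 w1 * ((gamma ^+ l.+1) ^+ 2 * st ^+ 2) <=
    N l.+1 w1 * ((ms l.+1).2 - (ms l.+1).1 ^+ 2).
  apply: ler_wpM2l => //; have [_ /(_ hg)] := hms l.+1 isT.
  by rewrite -exprM mulnC.
have T_mean v k : (0 < k)%N -> has_mean P (fun w => llr_term gamma k (T v w)) (ms k).1.
  move=> k0; have [[h _ _ _ _] _] := hms k k0.
  exact: (feature_mean tree (@mt) (@tsym) Delta_gt0 v (measurable_llr_term gamma k) h).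
have T_sqr_mean v k : (0 < k)%N ->
    has_mean P (fun w => llr_term gamma k (T v w) ^+ 2) (ms k).2.
  move=> k0; have [[_ h _ _ _] _] := hms k k0.
  apply: (feature_mean tree (@mt) (@tsym) Delta_gt0 v (f := fun x => llr_term gamma k x ^+ 2)) h.
  by apply: measurable_funX; exact: measurable_llr_term.
have hB v w : `|llr_term gamma l.+1 (T v w) - (ms l.+1).1| <= 2 * b * gamma ^+ l.+1.
  have [[_ _ _ _ h] _] := hms l.+1 isT.
  apply: le_trans (ler_normB _ _) _.
  have := llr_term_le gamma01 (k := l.+1) isT (feature_le1 v w).
  have : b * gamma ^+ l.+1 * `|T v w| <= b * gamma ^+ l.+1.
    rewrite ler_piMr // mulr_ge0 ?exprn_ge0 ?(ltW g0) // divr_ge0 // subr_ge0 ltW //.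
  move: h; rewrite -/b; move: (gamma ^+ _) => ?; lra.
have := conditional_flip_prob_ge indepT T_mean T_sqr_mean mf f0 fl fb (ltW beta_gt0) K_gt1
  (c := C ^~ w1) (sgn := spin Z ^~ w1) (l := l) (fun v => spin_sqr flip_sqr v w1)
  hB s01 (le_trans s0V var_ge) (le_trans BV var_ge).
apply: le_trans; rewrite lee_fin; apply: (le_trans le).
have s00 : 0 <= s0 by case/andP: s01 => /ltW.
apply: ler_wpM2l; first exact: ltW.
apply: ler_wpM2l; first by rewrite divr_ge0.
rewrite lerD2l lerN2 ler_pM2r ?invr_gt0 //.
by apply: inner_bound_le => k k0; have [[_ _ u v _] _] := hms k k0.
Qed.

Lemma flip_probability_ge l : flip_level_ok gamma Delta st l.+1 ->
  ((flip_const gamma Delta kappa vt st beta * kappa `^ (l%:R / 2))%:E <=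
   P [set w | h gamma rhop rhom C X l w <> h gamma rhop rhom C X l.+1 w])%E.
Proof.
move=> ok; have [r hr rge] := minorant_mean ok.
(* [J] carries the offspring numbers and flips, [J'] the signed features. [Y] reads them at separate
   points, and the event of the statement lies on the diagonal. *)
pose J : set index := [set j | if j is inl _ then True else False].
pose J' : set index := [set j | if j is inr _ then True else False].
have JJ' : J `&` J' = set0 by rewrite -subset0; case=> [j|j] [].
pose Y n (z : sub_space Z J * sub_space Z J') : R :=
  \sum_(k < n) \sum_(v <- generation (C ^~ z.1) k) spin Z v z.1 * llr_term gamma k (T v z.2).
have mY n : measurable_fun setT (Y n).
  rewrite /Y; apply: measurable_sum => k.
  apply: (measurable_gen_sum2 countE (a := spin Z) (b := fun v w => llr_term gamma k (T v w))) => //.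
    by move=> v _; apply: sub_spin.
  move=> v _; apply: measurableT_comp; first exact: measurable_llr_term.
  exact: (@sub_space_measurable _ _ _ _ Z J' (ftr v) I).
have mV : measurable [set z | Num.sg (Y l.+1 z) <> Num.sg (Y l.+2 z)].
  by apply: measurable_neqr; apply: measurableT_comp (mY _); exact: measurable_sgr.
rewrite (_ : [set w | _] =
    [set w | [set z | Num.sg (Y l.+1 z) <> Num.sg (Y l.+2 z)] (w, w)]); last first.
  by apply/seteqP; split=> w /=; rewrite !hE.
have := sub_indep_prob_ge indepZ JJ' mV
  (has_meanZ (beta * st * Num.sqrt kappa / 128 * kappa `^ (l%:R / 2) / Q) hr)
  (fun w1 => conditional_flip w1 ok).
apply: le_trans; rewrite lee_fin /flip_const -/Q.
set c := beta * st * _ / 128.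
have c0 : 0 <= c * kappa `^ (l%:R / 2) / Q.
  rewrite divr_ge0 ?(le_trans ler01 Q_ge1) // !mulr_ge0 ?powR_ge0 ?sqrtr_ge0 //; exact: ltW.
have := ler_wpM2l c0 rge; apply: le_trans; apply: le_of_eq.
by rewrite invfM; move: (Q^-1) (kappa `^ _) => ? ?; field.
Qed.

End LowerBound.

(** * Densities and normal laws *)

Section Density.
Context {R : realType} {d : measure_display} {T : measurableType d}.
Variables (mu P : {measure set T -> \bar R}) (rho : T -> R).
Hypothesis mrho : measurable_fun setT rho.
Hypothesis rho0 : forall x, 0 <= rho x.
Hypothesis density : forall A, measurable A -> P A = (\int[mu]_(x in A) (rho x)%:E)%E.

Import HBNNSimple.
Local Open Scope ereal_scope.

Let integral_density_nnsfun (h : {nnsfun T >-> R}) :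
  \int[mu]_x ((h x)%:E * (rho x)%:E) = \int[P]_x (h x)%:E.
Proof.
have mE r : measurable (h @^-1` [set r]).
  by rewrite -[X in measurable X]setTI; exact: measurable_funP.
rewrite integralT_nnsfun sintegralE.
under eq_integral => x _.
  rewrite fimfunE -fsumEFin // ge0_mule_fsuml; last by move=> y; exact: nnfun_muleindic_ge0.
  over.
rewrite ge0_integral_fsum //; first last.
- by move=> y x _; apply: mule_ge0; [exact: nnfun_muleindic_ge0|rewrite lee_fin].
- move=> y; apply: emeasurable_funM; apply/measurable_EFinP => //.
  by apply: measurable_funM => //; exact: measurable_indic.
apply: eq_fsbigr => r /set_mem[x _ <-].
under eq_integral do rewrite EFinM -muleA.
rewrite ge0_integralZl //; first last.
- by rewrite lee_fin.
- by move=> y _; rewrite mule_ge0 // lee_fin.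
- apply: emeasurable_funM; apply/measurable_EFinP => //; exact: measurable_indic.
rewrite density // [in RHS]integral_mkcond; congr (_ * _); apply: eq_integral => y _.
by rewrite epatch_indic muleC.
Qed.

Lemma integral_density (f : T -> \bar R) : measurable_fun setT f ->
  (forall x, 0 <= f x) -> \int[P]_x f x = \int[mu]_x (f x * (rho x)%:E).
Proof.
move=> mf f0; pose h := nnsfun_approx measurableT mf.
have hf x : (h n x)%:E @[n --> \oo] --> f x by apply: cvg_nnsfun_approx.
transitivity (limn (fun n => \int[P]_x (h n x)%:E)).
  rewrite -monotone_convergence //.
  - by apply: eq_integral => x _; apply/esym/cvg_lim.
  - by move=> n; exact/measurable_EFinP/measurable_funTS.
  - by move=> n x _; rewrite lee_fin.
  - by move=> x _ m n mn; rewrite lee_fin; exact/lefP/nd_nnsfun_approx.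
transitivity (limn (fun n => \int[mu]_x ((h n x)%:E * (rho x)%:E))).
  by congr (limn _); apply/funext => n; rewrite integral_density_nnsfun.
rewrite -monotone_convergence //.
- by apply: eq_integral => x _; apply/cvg_lim => //; apply: cvgeZr.
- by move=> n; apply: emeasurable_funM; apply/measurable_EFinP.
- by move=> n x _; rewrite mule_ge0 // lee_fin.
- move=> x _ m n mn; rewrite lee_wpmul2r ?lee_fin //; exact/lefP/nd_nnsfun_approx.
Qed.

Lemma integral_density_in (f : T -> \bar R) A : measurable A -> measurable_fun setT f ->
  (forall x, 0 <= f x) ->
  \int[P]_(x in A) f x = \int[mu]_(x in A) (f x * (rho x)%:E).
Proof.
move=> mA mf f0; rewrite integral_mkcond integral_density.
- rewrite [RHS]integral_mkcond; apply: eq_integral => x _.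
  by rewrite !patchE; case: ifP => // _; rewrite mul0e.
- by apply/(measurable_restrictT _ mA).1; exact: measurable_funTS.
- by move=> x; rewrite patchE; case: ifP.
Qed.

End Density.

Section AffineLebesgue.
Context {R : realType}.
Local Notation leb := (@lebesgue_measure R).

(** Uniqueness of Lebesgue measure, tested on half-open intervals; a negative [c] swaps the included
    endpoint, which leaves the length unchanged. *)
Lemma lebesgue_measure_affine (c e : R) (A : set R) : c != 0 -> measurable A ->
  leb A = (`|c|%:E * leb [set y | A (c * y + e)%R])%E.
Proof.
move=> c0 mA.
have mphi : @measurable_fun _ _ (measurableTypeR R) (measurableTypeR R) setT
    (fun y : R => c * y + e).
  have h : measurable_fun setT (fun y : R => c * y + e).
    by apply: measurable_funD => //; exact: measurable_funM.
  exact: h.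
pose phi : measurableTypeR R -> measurableTypeR R := fun y => c * y + e.
pose m : {measure set (measurableTypeR R) -> \bar R} :=
  mscale (NngNum (normr_ge0 c)) (pushforward leb phi).
pose m' := m mphi.
transitivity (m' A); last by [].
apply: lebesgue_measure_unique => // _ [[a b]] _ <- /=.
rewrite /m' /m /mscale /= /pushforward /=.
have [cp|cn|cz] := ltgtP c 0; last by rewrite cz eqxx in c0.
  rewrite (_ : _ @^-1` _ = `[(b - e) / c, (a - e) / c[%classic); last first.
    apply/seteqP; split=> y /=; rewrite /phi !in_itv /= ler_ndivrMr // ltr_ndivlMr //.
      by move=> /andP[h1 h2]; apply/andP; split; lra.
    by move=> /andP[h1 h2]; apply/andP; split; lra.
  rewrite !lebesgue_measure_itv /= !lte_fin ltr_nM2r ?invr_lt0 //.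
  rewrite ltrD2r; case: ifP => _; last by rewrite mule0.
  by rewrite !EFinN -!EFinB -EFinM ltr0_norm //; congr EFin; field.
rewrite (_ : _ @^-1` _ = `](a - e) / c, (b - e) / c]%classic); last first.
  apply/seteqP; split=> y /=; rewrite /phi !in_itv /= ler_pdivlMr // ltr_pdivrMr //.
    by move=> /andP[h1 h2]; apply/andP; split; lra.
  by move=> /andP[h1 h2]; apply/andP; split; lra.
rewrite !lebesgue_measure_itv /= !lte_fin ltr_pM2r ?invr_gt0 //.
rewrite ltrD2r; case: ifP => _; last by rewrite mule0.
by rewrite !EFinN -!EFinB -EFinM gtr0_norm //; congr EFin; field; rewrite gt_eqF.
Qed.

Lemma integral_affine (c e : R) (f : R -> \bar R) (A : set R) : c != 0 ->
  measurable A -> measurable_fun setT f -> (forall x, 0 <= f x)%E ->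
  (\int[leb]_(x in A) f x =
   `|c|%:E * \int[leb]_(y in [set y | A (c * y + e)%R]) f (c * y + e)%R)%E.
Proof.
move=> c0 mA mf f0.
have mphi : @measurable_fun _ _ (measurableTypeR R) (measurableTypeR R) setT
    (fun y : R => c * y + e).
  have h : measurable_fun setT (fun y : R => c * y + e).
    by apply: measurable_funD => //; exact: measurable_funM.
  exact: h.
pose phi : measurableTypeR R -> measurableTypeR R := fun y => c * y + e.
pose m : {measure set (measurableTypeR R) -> \bar R} :=
  mscale (NngNum (normr_ge0 c)) (pushforward leb phi).
pose m' := m mphi.
transitivity (\int[m']_(x in A) f x)%E.
  apply: eq_measure_integral => B mB _.
  exact: (lebesgue_measure_affine e c0 mB).
rewrite ge0_integral_mscale //; last exact: measurable_funTS.
by rewrite ge0_integral_pushforward //; exact: measurable_funTS.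
Qed.

End AffineLebesgue.

Section NormalDensity.
Context {R : realType}.
Implicit Types a c e m s u x : R.
Local Notation leb := (@lebesgue_measure R).

Lemma normal_pdf_expR m s x : s != 0 ->
  normal_pdf m s x = normal_peak s * expR (- (x - m) ^+ 2 / (s ^+ 2 *+ 2)).
Proof. by move=> s0; rewrite normal_pdfE. Qed.

Lemma normal_pdf_gt0 m s x : s != 0 -> 0 < normal_pdf m s x.
Proof.
by move=> s0; rewrite normal_pdf_expR // mulr_gt0 ?normal_peak_gt0 // expR_gt0.
Qed.

Lemma le_normal_pdf m s x x' : s != 0 -> `|x - m| <= `|x' - m| ->
  normal_pdf m s x' <= normal_pdf m s x.
Proof.
move=> s0 h; rewrite !normal_pdf_expR // ler_pM2l ?normal_peak_gt0 // ler_expR.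
rewrite ler_pM2r; last by rewrite invr_gt0 mulrn_wgt0 // exprn_even_gt0.
by rewrite lerN2 -[leLHS]real_normK ?num_real // -[leRHS]real_normK ?num_real // lerXn2r ?nnegrE.
Qed.

Lemma normal_peakM s c : s != 0 -> c != 0 -> `|c| * normal_peak (`|c| * s) = normal_peak s.
Proof.
move=> s0 c0; rewrite /normal_peak exprMn -mulrA -mulrnAr sqrtrM ?sqr_ge0 // sqrtr_sqr.
by rewrite normr_id invfM mulrA divff ?normr_eq0 // mul1r.
Qed.

Lemma normal_pdf_affine m s c e x : s != 0 -> c != 0 ->
  `|c| * normal_pdf (c * m + e) (`|c| * s) (c * x + e) = normal_pdf m s x.
Proof.
move=> s0 c0; have cs0 : `|c| * s != 0 by rewrite mulf_neq0 // normr_eq0.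
rewrite !normal_pdf_expR // mulrA normal_peakM //; congr (_ * expR _).
have c2 : `|c| ^+ 2 = c ^+ 2 by rewrite real_normK ?num_real.
have -> : (`|c| * s) ^+ 2 = c ^+ 2 * s ^+ 2 by rewrite exprMn c2.
have -> : c * x + e - (c * m + e) = c * (x - m) by ring.
move: (x - m) {c2 cs0} => y; field.
by rewrite c0 s0.
Qed.

Lemma normal_prob_affine m s c e (A : set R) : s != 0 -> c != 0 -> measurable A ->
  normal_prob m s [set y | A (c * y + e)] = normal_prob (c * m + e) (`|c| * s) A.
Proof.
move=> s0 c0 mA.
have mpdf : measurable_fun setT (EFin \o normal_pdf (c * m + e) (`|c| * s)).
  by apply/measurable_EFinP; exact: measurable_normal_pdf.
have mB : measurable [set y : R | A (c * y + e)].
  rewrite -[X in measurable X]setTI.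
  have h : measurable_fun setT (fun y : R => c * y + e).
    by apply: measurable_funD => //; exact: measurable_funM.
  exact: h.
rewrite /normal_prob (integral_affine e c0 mA mpdf); last first.
  by move=> x; rewrite lee_fin normal_pdf_ge0.
rewrite -ge0_integralZl //; first last.
- by move=> y _; rewrite lee_fin normal_pdf_ge0.
- apply/measurable_EFinP/measurable_funTS.
  apply: (measurableT_comp (measurable_normal_pdf _ _)).
  by apply: measurable_funD => //; exact: measurable_funM.
by apply: eq_integral => y _; rewrite /= -EFinM normal_pdf_affine.
Qed.

(** Exponential tilting, from [(x + m)^2 - (x - m)^2 = 4 m x]; the exponent is minus the
    log-likelihood ratio of one coordinate. *)
Lemma normal_pdf_tilt m s x : s != 0 ->
  expR (- (2 * m / s ^+ 2 * x)) * normal_pdf m s x = normal_pdf (- m) s x.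
Proof.
move=> s0; rewrite !normal_pdf_expR // mulrCA -expRD; congr (_ * expR _).
by field.
Qed.

Definition conv_std (s1 s2 : R) : R := Num.sqrt (s1 ^+ 2 + s2 ^+ 2).

Lemma conv_std_gt0 s1 s2 : 0 < s1 -> 0 < conv_std s1 s2.
Proof. by move=> h; rewrite sqrtr_gt0 ltr_pwDl ?exprn_gt0 // sqr_ge0. Qed.

Lemma conv_std_sqr s1 s2 : conv_std s1 s2 ^+ 2 = s1 ^+ 2 + s2 ^+ 2.
Proof. by rewrite sqr_sqrtr // addr_ge0 ?sqr_ge0. Qed.

Let normal_peak_mul s1 s2 s3 s4 : s1 * s2 = s3 * s4 ->
  normal_peak s1 * normal_peak s2 = normal_peak s3 * normal_peak s4.
Proof.
have H x y : normal_peak x * normal_peak y = (Num.sqrt ((x * y) ^+ 2 * (pi *+ 2) ^+ 2))^-1.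
  rewrite /normal_peak -invfM -sqrtrM; last by rewrite mulrn_wge0 // mulr_ge0 ?sqr_ge0 ?pi_ge0.
  congr (Num.sqrt _)^-1; move: pi => p.
  ring.
by move=> E; rewrite !H E.
Qed.

Let conv_exponent (a m u x D1 D2 : R) : 0 < D1 -> 0 < D2 ->
  - (u - (a + x)) ^+ 2 / (D1 *+ 2) + - (x - m) ^+ 2 / (D2 *+ 2) =
  - (u - (a + m)) ^+ 2 / ((D1 + D2) *+ 2) +
  - (x - (D2 * (u - a) + D1 * m) / (D1 + D2)) ^+ 2 / ((D1 * D2 / (D1 + D2)) *+ 2).
Proof.
move=> h1 h2.
have n1 : D1 != 0 by rewrite gt_eqF.
have n2 : D2 != 0 by rewrite gt_eqF.
have n3 : D1 + D2 != 0 by rewrite gt_eqF // addr_gt0.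
field.
by rewrite n1 n2 n3.
Qed.

(* Completing the square in [x]. *)
Lemma normal_pdf_conv a m s1 s2 u x : 0 < s1 -> 0 < s2 ->
  normal_pdf (a + x) s1 u * normal_pdf m s2 x =
  normal_pdf (a + m) (conv_std s1 s2) u *
  normal_pdf ((s2 ^+ 2 * (u - a) + s1 ^+ 2 * m) / conv_std s1 s2 ^+ 2)
    (s1 * s2 / conv_std s1 s2) x.
Proof.
move=> s10 s20; have S0 := conv_std_gt0 s2 s10; have SE := conv_std_sqr s1 s2.
move: (conv_std s1 s2) S0 SE => S S0 SE.
have n1 : s1 != 0 by rewrite gt_eqF.
have n2 : s2 != 0 by rewrite gt_eqF.
have nS : S != 0 by rewrite gt_eqF.
have nt : s1 * s2 / S != 0 by rewrite !mulf_neq0 // invr_eq0.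
rewrite !normal_pdf_expR // mulrACA [RHS]mulrACA -!expRD; congr (_ * expR _).
  by apply: normal_peak_mul; rewrite [S * _]mulrC divfK.
have -> : (s1 * s2 / S) ^+ 2 = s1 ^+ 2 * s2 ^+ 2 / (s1 ^+ 2 + s2 ^+ 2).
  by rewrite !exprMn exprVn SE.
by rewrite SE; apply: conv_exponent; rewrite exprn_gt0.
Qed.

Lemma normal_prob_itv_gt0 m s x : s != 0 -> (0 < normal_prob m s `[x, (x + 1)%R])%E.
Proof.
(* The chosen point is at least as far from [m] as any point of [[x, x + 1]], so [e] bounds the
   density below on that interval. *)
move=> s0; pose e := normal_pdf m s (m + (`|x - m| + 1)).
have e0 : 0 < e by exact: normal_pdf_gt0.
have mI : measurable (`[x, x + 1] : set R) by exact: measurable_itv.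
apply: (@lt_le_trans _ _ (e%:E * leb `[x, (x + 1)%R])%E).
  rewrite lebesgue_measure_itv /= lte_fin ltrDl ltr01 EFinN -EFinB -EFinM lte_fin.
  by rewrite mulr_gt0 // subr_gt0 ltrDl.
rewrite /normal_prob -integral_cst //; apply: ge0_le_integral => //.
- by move=> y _; rewrite lee_fin ltW.
- by apply/measurable_EFinP/measurable_funTS; exact: measurable_normal_pdf.
move=> y; rewrite /= in_itv /= => /andP[xy yx]; rewrite lee_fin; apply: le_normal_pdf => //.
rewrite [m + _]addrC addrK [leRHS]ger0_norm; last by rewrite addr_ge0.
rewrite (_ : y - m = (x - m) + (y - x)); last by ring.
apply: (le_trans (ler_normD _ _)); rewrite lerD2l ger0_norm; lra.
Qed.

End NormalDensity.

Section NormalConvolution.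
Context {R : realType}.
Local Notation leb := (@lebesgue_measure R).
Local Notation RR := (measurableTypeR R).

Let measurable_normal_pdf2 (a s : R) : s != 0 ->
  measurable_fun setT (fun z : RR * RR => normal_pdf (a + z.1) s z.2).
Proof.
move=> s0; rewrite (_ : (fun _ => _) = fun z : RR * RR =>
    normal_peak s * expR (- (z.2 - (a + z.1)) ^+ 2 / (s ^+ 2 *+ 2))); last first.
  by apply/funext => z; rewrite normal_pdf_expR.
apply: measurable_funM => //; apply: measurableT_comp => //; apply: measurable_funM => //.
apply: measurableT_comp => //; apply: measurable_funX; apply: measurable_funB => //.
by apply: measurable_funD.
Qed.

Section Fixed.
Variables (a m s1 s2 : R) (A : set R).
Hypothesis s10 : 0 < s1.
Hypothesis s20 : 0 < s2.
Hypothesis mA : measurable A.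

Let n1 : s1 != 0. Proof. by rewrite gt_eqF. Qed.

Let F (z : RR * RR) : \bar R := (\1_A z.2 * normal_pdf (a + z.1) s1 z.2)%:E.

Let mF : measurable_fun setT F.
Proof.
apply/measurable_EFinP; apply: measurable_funM; last exact: measurable_normal_pdf2.
by apply: (measurableT_comp (f := \1_A : RR -> R)) => //; exact: measurable_indic.
Qed.

Let F0 z : (0 <= F z)%E.
Proof. by rewrite lee_fin mulr_ge0 // normal_pdf_ge0. Qed.

Let normal_probE x : normal_prob (a + x) s1 A = fubini_F leb F x.
Proof.
rewrite /normal_prob [LHS]integral_mkcond; apply: eq_integral => u _.
by rewrite /F /= patchE indicE; case: (u \in A); rewrite ?mul1r ?mul0r.
Qed.

Lemma measurable_normal_prob :
  measurable_fun setT (fun x : R => normal_prob (a + x) s1 A).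
Proof.
rewrite (_ : (fun _ => _) = fubini_F leb F); last by apply/funext => x; rewrite normal_probE.
by apply: (@measurable_fun_fubini_tonelli_F _ _ RR RR R leb F).
Qed.

(** After exchanging the integrals, the completed square leaves a factor free of [x] times a normal
    density in [x], of integral 1. *)
Lemma normal_prob_conv :
  (\int[normal_prob m s2]_x normal_prob (a + x)%R s1 A =
   normal_prob (a + m)%R (conv_std s1 s2) A)%E.
Proof.
have mp := measurable_normal_pdf m s2.
rewrite (integral_density (mu := leb) mp (normal_pdf_ge0 m s2)) //; last exact: measurable_normal_prob.
pose G (z : RR * RR) : \bar R := (F z * (normal_pdf m s2 z.1)%:E)%E.
have mG : measurable_fun setT G.
  apply: emeasurable_funM => //; apply/measurable_EFinP.
  exact: (measurableT_comp mp).
have G0 z : (0 <= G z)%E by rewrite mule_ge0 // lee_fin normal_pdf_ge0.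
transitivity (\int[leb]_x \int[leb]_u G (x, u))%E.
  apply: eq_integral => x _; rewrite normal_probE /fubini_F -ge0_integralZr //.
  - exact: (measurableT_comp mF).
  - by rewrite lee_fin normal_pdf_ge0.
rewrite (fubini_tonelli G) // /normal_prob [RHS]integral_mkcond.
apply: eq_integral => u _.
pose k := (\1_A u * normal_pdf (a + m) (conv_std s1 s2) u)%R.
transitivity (\int[leb]_x (k%:E * (normal_pdf
    ((s2 ^+ 2 * (u - a) + s1 ^+ 2 * m) / conv_std s1 s2 ^+ 2)
    (s1 * s2 / conv_std s1 s2) x)%:E))%E.
  apply: eq_integral => x _; rewrite /G /F /= -!EFinM /k -[in LHS]mulrA normal_pdf_conv //.
  by rewrite mulrA.
rewrite ge0_integralZl //; first last.
- by rewrite lee_fin mulr_ge0 // normal_pdf_ge0.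
- by move=> x _; rewrite lee_fin normal_pdf_ge0.
- by apply/measurable_EFinP; exact: measurable_normal_pdf.
rewrite integral_normal_pdf mule1 patchE /k indicE.
by case: (u \in A); rewrite ?mul1r ?mul0r.
Qed.

End Fixed.
End NormalConvolution.

Section NormalSum.
Context {R : realType} {d : measure_display} {Omega : measurableType d}.
Variables (P : probability Omega R) (I : eqType) (Z : I -> {mfun Omega >-> R}).
Hypothesis indepZ : mutually_independent P Z.
Variables (m c : I -> R) (s : R).
Hypothesis s0 : 0 < s.
Hypothesis lawZ : forall i (A : set R), measurable A ->
  P [set w | A (Z i w)] = normal_prob (m i) s A.

Let S (F : seq I) (w : Omega) : R := \sum_(i <- F) c i * Z i w.

Let sub_S F : sub_measurable Z [set` F] (S F).
Proof.
apply: sub_measurable_sum => i iF; apply: measurable_funM => //.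
exact: (@sub_space_measurable _ _ _ _ Z [set` F] i iF).
Qed.

Let law_scale i e (A : set R) : c i != 0 -> measurable A ->
  P [set w | A (c i * Z i w + e)] = normal_prob (c i * m i + e) (`|c i| * s) A.
Proof.
move=> ci mA; have n0 : s != 0 by rewrite gt_eqF.
rewrite -(normal_prob_affine _ _ n0 ci mA) -lawZ // -[X in measurable X]setTI.
have h : measurable_fun setT (fun y : R => c i * y + e).
  by apply: measurable_funD => //; exact: measurable_funM.
exact: h.
Qed.

(** One coordinate is added at a time by convolution. The list is nonempty and the coefficients are
    nonzero, so every standard deviation met is positive. *)
Lemma normal_sum_law i F (A : set R) : uniq (i :: F) ->
  (forall j, j \in i :: F -> c j != 0) -> measurable A ->
  P [set w | A (\sum_(j <- i :: F) c j * Z j w)] =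
  normal_prob (\sum_(j <- i :: F) c j * m j)
    (Num.sqrt (\sum_(j <- i :: F) (c j * s) ^+ 2)) A.
Proof.
elim: F i A => [|j F IH] i A.
  move=> _ ci mA; rewrite !big_seq1 sqrtr_sqr normrM (gtr0_norm s0).
  rewrite -[c i * m i]addr0 -law_scale ?ci ?mem_head //.
  by congr (P _); apply/seteqP; split=> w /=; rewrite big_seq1 addr0.
rewrite cons_uniq => /andP[iF uF] cF mA.
have ci : c i != 0 by rewrite cF ?mem_head.
have s10 : 0 < `|c i| * s by rewrite mulr_gt0 // normr_gt0.
set V := \sum_(k <- j :: F) (c k * s) ^+ 2.
set M := \sum_(k <- j :: F) c k * m k.
have V0 : 0 < V.
  rewrite /V big_cons ltr_pwDl //; last by apply: sumr_ge0 => k _; exact: sqr_ge0.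
  by rewrite exprn_even_gt0 //= mulf_neq0 ?(gt_eqF s0) // cF // !inE eqxx orbT.
have s20 : 0 < Num.sqrt V by rewrite sqrtr_gt0.
have IHF B : measurable B -> P [set w | B (S (j :: F) w)] = normal_prob M (Num.sqrt V) B.
  by move=> mB; apply: IH => // k kF; apply: cF; rewrite in_cons kF orbT.
have disj : [set` j :: F] `&` [set i] = set0.
  by rewrite -subset0 => k /= [kF ki]; rewrite ki (negbTE iF) in kF.
have mS := sub_measurableW (@sub_S (j :: F)).
have mB : measurable [set w | A (\sum_(k <- [:: i, j & F]) c k * Z k w)].
  rewrite -[X in measurable X]setTI.
  have h := sub_measurableW (@sub_S [:: i, j & F]); exact: h.
pose f (z : sub_space Z [set` j :: F] * sub_space Z [set i]) : \bar R :=
  (\1_A (c i * Z i z.2 + S (j :: F) z.1))%:E.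
have mf : measurable_fun setT f.
  apply/measurable_EFinP; apply: measurableT_comp; first exact: measurable_indic.
  apply: measurable_funD.
    apply: measurable_funM => //.
    exact: (measurableT_comp (@sub_space_measurable _ _ _ _ Z [set i] i erefl) measurable_snd).
  exact: (measurableT_comp (@sub_S (j :: F)) measurable_fst).
have prob_indic (B : set Omega) : measurable B -> P B = (\int[P]_w (\1_B w)%:E)%E.
  by move=> mB'; rewrite integral_indic // setIT.
transitivity (\int[P]_w f (w, w))%E.
  rewrite prob_indic //; apply: eq_integral => w _; rewrite /f /= !indicE.
  by congr (_%:R%:E); congr nat_of_bool; apply/idP/idP; rewrite !inE /= big_cons.
rewrite (integral_sub_indep indepZ disj mf); last by move=> z; rewrite lee_fin.
transitivity (\int[P]_w normal_prob (c i * m i + S (j :: F) w)%R (`|c i| * s) A)%E.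
  apply: eq_integral => w1 _; rewrite -law_scale // prob_indic; last first.
    rewrite -[X in measurable X]setTI.
    have h : measurable_fun setT (fun w => c i * Z i w + S (j :: F) w1).
      by apply: measurable_funD => //; exact: measurable_funM.
    exact: h.
  apply: eq_integral => w _; rewrite /f /= !indicE.
  by congr (_%:R%:E); congr nat_of_bool; apply/idP/idP; rewrite !inE.
have mS' : @measurable_fun _ _ Omega (measurableTypeR R) setT (S (j :: F)) := mS.
pose S' : {mfun Omega >-> measurableTypeR R} :=
  HB.pack (S (j :: F)) (isMeasurableFun.Build _ _ _ _ _ mS').
transitivity (\int[distribution P S']_x normal_prob (c i * m i + x)%R (`|c i| * s) A)%E.
  rewrite ge0_integral_distribution //; exact: measurable_normal_prob.
rewrite (eq_measure_integral (normal_prob M (Num.sqrt V))); last first.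
  by move=> B mB' _; exact: IHF.
rewrite [\sum_(k <- [:: i, j & F]) c k * m k]big_cons.
rewrite [\sum_(k <- [:: i, j & F]) (c k * s) ^+ 2]big_cons -/M -/V.
have -> : Num.sqrt ((c i * s) ^+ 2 + V) = conv_std (`|c i| * s) (Num.sqrt V).
  have c2 : `|c i| ^+ 2 = c i ^+ 2 by rewrite real_normK ?num_real.
  by rewrite /conv_std (sqr_sqrtr (ltW V0)) [in RHS]exprMn c2 -exprMn.
exact: normal_prob_conv.
Qed.

End NormalSum.

(** * Gaussian mixtures *)

Section GaussianVector.
Context {R : realType} {d : nat}.
Implicit Types (A : 'I_d -> set R) (F : seq 'I_d).

Definition coord (i : 'I_d) : {mfun d.-tuple R >-> R} :=
  HB.pack (fun x : d.-tuple R => tnth x i)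
    (isMeasurableFun.Build _ _ _ _ (fun x : d.-tuple R => tnth x i) (measurable_tnth i)).

Definition box A : set (d.-tuple R) := [set x | forall i, A i (tnth x i)].

Lemma measurable_box A : (forall i, measurable (A i)) -> measurable (box A).
Proof.
move=> mA; rewrite (_ : box A = [set x | forall i, i \in enum 'I_d -> A i (coord i x)]).
  apply: measurable_forall_seq => i _; rewrite -[X in measurable X]setTI.
  by apply: (measurable_funP (coord i)).
by apply/seteqP; split=> x /= H i; have := H i; rewrite mem_enum; [|exact].
Qed.

(** Boxes are stable under intersection and include the preimages of coordinate sets, which generate
    the product sigma-algebra. *)
Lemma tuple_measure_unique (m1 m2 : {measure set (d.-tuple R) -> \bar R}) :
  (m1 setT < +oo)%E ->
  (forall A, (forall i, measurable (A i)) -> m1 (box A) = m2 (box A)) ->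
  forall B, measurable B -> m1 B = m2 B.
Proof.
move=> m1oo m12 B mB.
pose G : set_system (d.-tuple R) := [set C | exists2 A, forall i, measurable (A i) & C = box A].
have GT : G setT by exists (fun=> setT) => //; apply/seteqP; split.
apply: (g_sigma_algebra_measure_unique G _ (fun=> setT)) => //.
- by move=> _ [A mA ->]; exact: measurable_box.
- by rewrite bigcup_const.
- move=> _ _ [A mA ->] [A' mA' ->]; exists (fun i => A i `&` A' i).
    by move=> i; exact: measurableI.
  apply/seteqP; split=> x /=; first by move=> [h h'] i; split; [exact: h|exact: h'].
  by move=> h; split=> i; have [] := h i.
- by move=> _ [A mA ->]; exact: m12.
move: B mB; apply: smallest_sub; first exact: smallest_sigma_algebra.
elim/big_ind : _ => [C []|H H' h h' C [/h|/h']//|i _ _ [C mC <-]].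
rewrite setTI; apply: sub_sigma_algebra; exists (fun j => if j == i then C else setT).
  by move=> j; case: ifP.
apply/seteqP; split=> x /=; first by move=> Cx j; case: eqP => // ->.
by move=> /(_ i); rewrite eqxx.
Qed.

Section Coordinates.
Variables (m : d.-tuple R) (sigma : R) (P : probability (d.-tuple R) R).
Hypothesis gauss : isotropic_gaussian m sigma P.

Lemma gaussian_cylinder F A : uniq F -> (forall i, measurable (A i)) ->
  P [set x | forall i, i \in F -> A i (coord i x)] =
  (\prod_(i <- F) fine (normal_prob (tnth m i) sigma (A i)))%:E.
Proof.
move=> uF mA; pose A' i := if i \in F then A i else setT.
have mA' i : measurable (A' i) by rewrite /A'; case: ifP.
transitivity (P (box A')).
  congr (P _); apply/seteqP; split=> x /= H i.
    by rewrite /A'; case: ifP => // /H.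
  by move=> iF; have := H i; rewrite /A' iF.
rewrite gauss //; congr _%:E.
rewrite [RHS]big_uniq //= [RHS]big_mkcond /=; apply: eq_bigr => i _.
by rewrite /A'; case: ifP => // _; rewrite probability_setT.
Qed.

Lemma gaussian_coord_law i (A : set R) : measurable A ->
  P [set x | A (coord i x)] = normal_prob (tnth m i) sigma A.
Proof.
move=> mA; have := @gaussian_cylinder [:: i] (fun=> A) isT (fun=> mA).
rewrite big_seq1 fineK ?fin_num_measure // => <-; congr (P _).
apply/seteqP; split=> x /=; first by move=> Ax j; rewrite inE => /eqP->.
by apply; rewrite mem_head.
Qed.

Lemma gaussian_independent : mutually_independent P coord.
Proof.
move=> F A uF mA; rewrite gaussian_cylinder //; congr _%:E.
by apply: eq_bigr => i _; rewrite -gaussian_coord_law.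
Qed.

End Coordinates.
End GaussianVector.

Section GaussianMixture.
Context {R : realType} {d : nat}.
Variables (m : d.-tuple R) (sigma : R) (mu : {measure set (d.-tuple R) -> \bar R})
  (Pp Pm : probability (d.-tuple R) R) (rhop rhom : d.-tuple R -> R).
Hypothesis sigma_gt0 : 0 < sigma.
Hypothesis gaussp : isotropic_gaussian m sigma Pp.
Hypothesis gaussm : isotropic_gaussian (map_tuple -%R m) sigma Pm.
Hypothesis densp : has_density mu Pp rhop.
Hypothesis densm : has_density mu Pm rhom.

Let sigma_neq0 : sigma != 0. Proof. by rewrite gt_eqF. Qed.

Let c (i : 'I_d) : R := 2 * tnth m i / sigma ^+ 2.

Definition gauss_llr (x : d.-tuple R) : R :=
  \sum_(i < d) 2 * tnth m i / sigma ^+ 2 * tnth x i.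

Lemma measurable_gauss_llr : measurable_fun setT gauss_llr.
Proof.
apply: measurable_sum => i; apply: measurable_funM => //; exact: measurable_tnth.
Qed.

(** Factor of coordinate [i] in the indicator of a box times [expR (- gauss_llr)]. By the tilting
    identity its mean is the mass that coordinate [i] under [Pm] gives to [A i]. *)
Let g (A : 'I_d -> set R) i (y : R) : R := \1_(A i) y * expR (- (c i * y)).

Let mg A i : (forall i, measurable (A i)) -> measurable_fun setT (g A i).
Proof.
move=> mA; apply: measurable_funM; first exact: measurable_indic.
apply: measurableT_comp => //; apply: measurableT_comp => //; exact: measurable_funM.
Qed.

Let g0 A i y : 0 <= g A i y.
Proof. by rewrite /g mulr_ge0 ?expR_ge0. Qed.

Let g_mean A i : (forall i, measurable (A i)) ->
  has_mean Pp (fun x => g A i (coord i x)) (fine (normal_prob (- tnth m i) sigma (A i))).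
Proof.
move=> mA; apply: ge0_has_mean => //.
  exact: (measurableT_comp (@mg A i mA) (measurable_funP (coord i))).
have mgE : measurable_fun setT (EFin \o g A i) by apply/measurable_EFinP; exact: mg.
have mi : @measurable_fun _ _ _ (measurableTypeR R) setT (fun x : d.-tuple R => tnth x i).
  exact: measurable_tnth.
pose Z : {mfun d.-tuple R >-> measurableTypeR R} :=
  HB.pack (fun x : d.-tuple R => tnth x i) (isMeasurableFun.Build _ _ _ _ _ mi).
transitivity (\int[distribution Pp Z]_y (g A i y)%:E)%E.
  rewrite ge0_integral_distribution // => y; by rewrite lee_fin.
rewrite (eq_measure_integral (normal_prob (tnth m i) sigma)); last first.
  by move=> B mB _; exact: (gaussian_coord_law gaussp).
rewrite (integral_density (mu := lebesgue_measure) (measurable_normal_pdf (tnth m i) sigma)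
  (normal_pdf_ge0 (tnth m i) sigma)) //; last by move=> y; rewrite lee_fin.
rewrite fineK; last by apply: fin_num_measure; exact: mA.
rewrite /normal_prob [RHS]integral_mkcond.
apply: eq_integral => y _; rewrite patchE /g indicE.
case: (y \in A i); last by rewrite !mul0r mul0e.
by rewrite mul1r -EFinM normal_pdf_tilt.
Qed.

Let g_prod_mean A F : (forall i, measurable (A i)) -> uniq F ->
  has_mean Pp (fun x => \prod_(i <- F) g A i (coord i x))
    (\prod_(i <- F) fine (normal_prob (- tnth m i) sigma (A i))).
Proof.
move=> mA; elim: F => [|i F IH] /=.
  move=> _; rewrite big_nil; apply: eq_has_mean (has_mean_cst Pp 1) => x.
  by rewrite big_nil.
move=> /andP[iF uF]; rewrite big_cons.
apply: (@eq_has_mean _ _ _ _ (fun x => g A i (coord i x) * \prod_(j <- F) g A j (coord j x))).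
  by move=> x; rewrite big_cons.
have sg (J : set 'I_d) j : J j -> sub_measurable coord J (fun x => g A j (coord j x)).
  move=> Jj; apply: (measurableT_comp (@mg A j mA)).
  exact: (@sub_space_measurable _ _ _ _ coord J j Jj).
apply: (ge0_has_meanM (gaussian_independent gaussp) (J := [set i]) (J' := [set` F])) => //.
- by rewrite -subset0 => j /= [-> jF]; rewrite jF in iF.
- exact: sg.
- rewrite /sub_measurable; apply: measurable_prod => j jF; exact: sg.
- by move=> x; apply: prodr_ge0.
- exact: g_mean.
- exact: IH.
Qed.

Let tilt (B : set (d.-tuple R)) : \bar R := (\int[Pp]_(x in B) (expR (- gauss_llr x))%:E)%E.

Let measurable_exp_llr : measurable_fun setT (fun x => expR (- gauss_llr x)).
Proof.
by apply: measurableT_comp => //; apply: measurableT_comp => //; exact: measurable_gauss_llr.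
Qed.

Let tilt_box A : (forall i, measurable (A i)) -> tilt (box A) = Pm (box A).
Proof.
move=> mA; have [_] := g_prod_mean mA (enum_uniq 'I_d).
rewrite gaussm // => E.
transitivity ((\prod_(i <- enum 'I_d) fine (normal_prob (- tnth m i) sigma (A i)))%:E); last first.
  by rewrite big_enum /=; congr _%:E; apply: eq_bigr => i _; rewrite tnth_map.
rewrite -E /tilt integral_mkcond; apply: eq_integral => x _.
rewrite patchE big_enum /= /g big_split /=.
have -> : \prod_(i < d) expR (- (c i * coord i x)) = expR (- gauss_llr x).
  by rewrite -sumrN expR_sum.
case: ifPn => [/set_mem xA|/negP xA].
  by rewrite big1 ?mul1r // => i _; rewrite indicE mem_set //; exact: xA.
have [i nAi] : exists i, ~ A i (tnth x i).
  by apply: contrapT => H; apply: xA; apply/mem_set => i; apply: contrapT => nA; apply: H; exists i.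
by rewrite (bigD1 i) //= indicE memNset // !mul0r.
Qed.

(** Once packaged as a measure, [tilt] is determined by its values on boxes. *)
Let tiltE B : measurable B -> tilt B = Pm B.
Proof.
have bT : box (fun=> setT) = [set: d.-tuple R] by apply/seteqP; split.
have tT : tilt setT = 1%E by rewrite -bT tilt_box // bT probability_setT.
have t0 : tilt set0 = 0%E by rewrite /tilt integral_set0.
have tge0 C : (0 <= tilt C)%E by apply: integral_ge0 => x _; rewrite lee_fin expR_ge0.
have ti : Pp.-integrable setT (fun x => (expR (- gauss_llr x))%:E).
  apply/integrableP; split; first exact/measurable_EFinP.
  under eq_integral do rewrite /= ger0_norm ?expR_ge0 //.
  by rewrite -/(tilt setT) tT ltry.
have tsa : semi_sigma_additive tilt.
  move=> C mC tC mUC; rewrite /tilt integral_bigcup //; last first.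
    exact: integrableS ti.
  by apply: is_cvg_ereal_nneg_natsum_cond => n _ _; exact: tge0.
pose T : {measure set (d.-tuple R) -> \bar R} :=
  HB.pack tilt (isMeasure.Build _ _ _ tilt t0 tge0 tsa).
move=> mB; apply: (tuple_measure_unique (m1 := T) (m2 := Pm)) => //.
by rewrite [X in (X < _)%E]tT ltry.
Qed.

(** Both [rhom] and [expR (- gauss_llr) * rhop] are densities of [Pm] with respect to [mu], hence
    equal [mu]-almost everywhere, and [mu]-null sets are [Pp]-null. The zeros of [rhop] form a
    [Pp]-null set. *)
Let densities_ae : {ae Pp, forall x, 0 < rhop x /\ rhom x = expR (- gauss_llr x) * rhop x}.
Proof.
case: densp densm => mp p0 pE [mm m0 mE].
have rhom_int : mu.-integrable setT (fun x => (rhom x)%:E).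
  apply/integrableP; split; first exact/measurable_EFinP.
  under eq_integral do rewrite /= ger0_norm ?m0 //.
  by rewrite -mE // probability_setT ltry.
have : ae_eq mu setT (fun x => (rhom x)%:E) (fun x => (expR (- gauss_llr x) * rhop x)%:E).
  apply: integral_ae_eq rhom_int _ _ => //.
    by apply/measurable_EFinP; exact: measurable_funM.
  have me : measurable_fun setT (fun x => (expR (- gauss_llr x))%:E).
    exact/measurable_EFinP.
  have e0 x : (0 <= (expR (- gauss_llr x))%:E)%E by rewrite lee_fin expR_ge0.
  by move=> B _ mB; rewrite -mE // -tiltE // /tilt (integral_density_in mp p0 pE mB me e0).
move=> [N [mN muN HN]].
pose N0 := [set x | rhop x = 0].
have mN0 : measurable N0.
  by rewrite (_ : N0 = rhop @^-1` [set 0]) // -[X in measurable X]setTI; exact: mp.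
have PN : Pp N = 0%E.
  rewrite pE //; apply: null_set_integral => //.
  exact/measurable_EFinP/measurable_funTS.
have PN0 : Pp N0 = 0%E.
  by rewrite pE // (eq_integral (cst 0%E)) ?integral0 // => x /set_mem /= ->.
exists (N `|` N0); split; [exact: measurableU|by rewrite measureU0|].
move=> x /= H; have [p0x|px] := eqVneq (rhop x) 0; first by right.
left; apply: HN => /= E; apply: H; split; first by rewrite lt_neqAle eq_sym px p0.
by have [] := E Logic.I.
Qed.

Definition tanh_half (z : R) : R := (expR z - 1) / (expR z + 1).

Lemma log_psi_ae : {ae Pp, forall x, ln (psi rhop rhom x) = gauss_llr x}.
Proof.
have [N [mN PN HN]] := densities_ae; exists N; split=> // x /= H; apply: HN => -[px mx].
apply: H; rewrite /psi mx invfM mulrCA divff ?gt_eqF // mulr1 -expRN opprK expRK.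
by [].
Qed.

Lemma tstat_ae : {ae Pp, forall x, tstat rhop rhom x = tanh_half (gauss_llr x)}.
Proof.
have [N [mN PN HN]] := densities_ae; exists N; split=> // x /= H; apply: HN => -[px mx].
apply: H; rewrite /tstat /tanh_half mx expRN.
have := expR_gt0 (gauss_llr x); move: (expR _) => e e0; field.
by rewrite !gt_eqF // addr_gt0 // mulr_gt0.
Qed.

Lemma gauss_llr_law (A : set R) : (exists i, tnth m i != 0) -> measurable A ->
  Pp [set x | A (gauss_llr x)] =
  normal_prob (2 * (eucl_norm m / sigma) ^+ 2) (2 * (eucl_norm m / sigma)) A.
Proof.
(* Coordinates with zero mean contribute nothing and are dropped, as [normal_sum_law] wants nonzero
   coefficients; [i0] shows that some coordinate remains. *)
move=> [i0 mi0] mA; pose F := [seq i <- enum 'I_d | c i != 0].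
have c0 i : (c i != 0) = (tnth m i != 0).
  by rewrite /c !mulf_eq0 invr_eq0 sqrf_eq0 (negbTE sigma_neq0) orbF pnatr_eq0.
have sumF (f : 'I_d -> R) : (forall i, c i = 0 -> f i = 0) -> \sum_(i <- F) f i = \sum_(i < d) f i.
  move=> f0; rewrite big_filter big_mkcond big_enum /=; apply: eq_bigr => i _.
  by case: eqP => // /f0 ->.
have uF : uniq F by rewrite filter_uniq ?enum_uniq.
have cF j : j \in F -> c j != 0 by rewrite mem_filter => /andP[].
have i0F : i0 \in F by rewrite mem_filter c0 mi0 mem_enum.
have r2 : (eucl_norm m / sigma) ^+ 2 = \sum_(i < d) tnth m i ^+ 2 / sigma ^+ 2.
  rewrite exprMn sqr_sqrtr ?exprVn ?mulr_suml //.
  by apply: sumr_ge0 => i _; exact: sqr_ge0.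
have := @normal_sum_law _ _ _ Pp _ coord (gaussian_independent gaussp) (tnth m) c sigma sigma_gt0
  (fun i B mB => gaussian_coord_law gaussp i mB).
case: F uF cF i0F sumF => [//|i F] uF cF _ sumF /(_ i F A uF cF mA).
rewrite sumF; last by move=> j ->; rewrite mul0r.
rewrite sumF; last by move=> j ->; rewrite mul0r expr0n.
have -> : \sum_(i < d) c i * tnth m i = 2 * (eucl_norm m / sigma) ^+ 2.
  rewrite r2 mulr_sumr; apply: eq_bigr => j _; rewrite /c; field; exact: sigma_neq0.
have -> : \sum_(i < d) (c i * sigma) ^+ 2 = (2 * (eucl_norm m / sigma)) ^+ 2.
  rewrite exprMn r2 mulr_sumr; apply: eq_bigr => j _; rewrite /c; field; exact: sigma_neq0.
rewrite sqrtr_sqr ger0_norm; last by rewrite mulr_ge0 // divr_ge0 ?sqrtr_ge0 // ltW.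
move=> <-; congr (Pp _); apply/seteqP; split=> x /=; rewrite sumF // => j ->; by rewrite mul0r.
Qed.

End GaussianMixture.

Section AlmostEverywhere.
Context {R : realType} {d : measure_display} {T : measurableType d}.
Variable P : probability T R.

Lemma ae_eq_has_mean (f g : T -> R) m : measurable_fun setT g ->
  {ae P, forall x, f x = g x} -> has_mean P f m -> has_mean P g m.
Proof.
move=> mg fg [fi fm]; have mf := measurable_int _ fi.
have mgE : measurable_fun setT (EFin \o g) by exact/measurable_EFinP.
have fgE : ae_eq P setT (EFin \o f) (EFin \o g).
  by case: fg => N [mN PN HN]; exists N; split=> // x /= H; apply: HN => /= E; apply: H => _; rewrite E.
split; last by rewrite -fm; apply/esym/ae_eq_integral.
apply/integrableP; split=> //; case/integrableP: fi => _; congr (_ < _)%E.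
apply: ae_eq_integral => //; try exact: measurableT_comp.
by case: fg => N [mN PN HN]; exists N; split=> // x /= H; apply: HN => E; apply: H => _; rewrite E.
Qed.

Lemma ae_eq_prob (f g : T -> R) (A : set R) : measurable_fun setT f ->
  measurable_fun setT g -> measurable A -> {ae P, forall x, f x = g x} ->
  P [set x | A (f x)] = P [set x | A (g x)].
Proof.
move=> mf mg mA fg.
have mB (u : T -> R) : measurable_fun setT u -> measurable [set x | A (u x)].
  by move=> mu; rewrite -[X in measurable X]setTI; exact: mu.
have H (u : T -> R) : measurable_fun setT u ->
    has_mean P (fun x => \1_A (u x)) (fine (P [set x | A (u x)])).
  move=> mu; apply: ge0_has_mean => //.
    exact: (measurableT_comp (measurable_indic mA)).
  rewrite fineK ?fin_num_measure //; last exact: mB.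
  transitivity (\int[P]_x (\1_[set x | A (u x)] x)%:E)%E; last first.
    by rewrite integral_indic ?setIT //; exact: mB.
  by apply: eq_integral => x _; rewrite !indicE; congr (_%:R%:E); congr nat_of_bool;
    apply/idP/idP; rewrite !inE.
have H1 := H f mf; have H2 := H g mg.
have : has_mean P (fun x => \1_A (g x)) (fine (P [set x | A (f x)])).
  apply: ae_eq_has_mean H1; first exact: (measurableT_comp (measurable_indic mA)).
  by case: fg => N [mN PN HN]; exists N; split=> // x /= h; apply: HN => /= E; apply: h; rewrite E.
move=> /(has_mean_uniq H2) E.
have fin u : measurable_fun setT u -> P [set x | A (u x)] \is a fin_num.
  by move=> mu; apply: fin_num_measure; exact: mB.
by rewrite -(fineK (fin f mf)) -E fineK ?fin.
Qed.

End AlmostEverywhere.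

Section GaussianStatistic.
Context {R : realType}.

Lemma tanh_halfE (z : R) : tanh_half z = 1 - 2 / (expR z + 1).
Proof. by rewrite /tanh_half; field; rewrite gt_eqF // addr_gt0 // expR_gt0. Qed.

Lemma tanh_half_le1 (z : R) : `|tanh_half z| <= 1.
Proof.
rewrite /tanh_half; have := expR_gt0 z; move: (expR z) => e e0.
rewrite normrM normfV (gtr0_norm (_ : 0 < e + 1)) ?addr_gt0 // ler_pdivrMr ?addr_gt0 //.
by rewrite mul1r ler_norml; apply/andP; split; lra.
Qed.

Lemma le_tanh_half (x y : R) : x <= y -> tanh_half x <= tanh_half y.
Proof.
move=> xy; rewrite !tanh_halfE lerD2l lerN2 ler_pM2l // lef_pV2 ?posrE ?addr_gt0 ?expR_gt0 //.
by rewrite lerD2r ler_expR.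
Qed.

Lemma measurable_tanh_half : measurable_fun setT (@tanh_half R).
Proof.
apply: measurable_funM; first exact: measurable_funB.
by apply: measurableT_comp; [exact: measurable_invr|exact: measurable_funD].
Qed.

Lemma tanh_half_variance_gt0 (m s v m1 : R) : s != 0 ->
  has_mean (normal_prob m s) tanh_half m1 ->
  has_mean (normal_prob m s) (fun z => tanh_half z ^+ 2) v -> 0 < v - m1 ^+ 2.
Proof.
move=> s0 hm hv.
have hV : has_mean (normal_prob m s) (fun z => (tanh_half z - m1) ^+ 2) (v - m1 ^+ 2).
  have -> : v - m1 ^+ 2 = v - 2 * m1 * m1 + m1 ^+ 2 by ring.
  apply: eq_has_mean (has_meanD (has_meanB hv (has_meanZ (2 * m1) hm))
    (has_mean_cst (normal_prob m s) (m1 ^+ 2))) => z; ring.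
(* [tanh_half] takes both signs, so it stays away from its mean [m1] on a unit interval: [[1, 2]] if
   [m1 <= 0], [[-2, -1]] otherwise. Such an interval has positive mass. *)
have [x [k [k0 H]]] : exists x k : R, 0 < k /\
    forall z, x <= z <= x + 1 -> k <= (tanh_half z - m1) ^+ 2.
  have e1 : 1 < expR 1 :> R by rewrite -expR0 ltr_expR.
  have p1 : 0 < tanh_half 1 :> R by rewrite /tanh_half divr_gt0 ?subr_gt0 ?addr_gt0 ?expR_gt0.
  have n1 : tanh_half (- 1) < 0 :> R.
    have e2 : expR (- 1) < 1 :> R by rewrite -[ltRHS]expR0 ltr_expR oppr_lt0.
    by rewrite /tanh_half ltr_pdivrMr ?mul0r ?subr_lt0 // addr_gt0 // expR_gt0.
  have [m0|m0] := lerP m1 0.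
    exists 1, (tanh_half 1 ^+ 2); split; first exact: exprn_gt0.
    move=> z /andP[/le_tanh_half h _]; rewrite lerXn2r ?nnegrE; lra.
  exists (- 2), (tanh_half (- 1) ^+ 2); split; first by rewrite exprn_even_gt0 //= lt_eqF.
  move=> z /andP[_ h]; have {}h : tanh_half z <= tanh_half (- 1) by apply: le_tanh_half; lra.
  by rewrite -sqrrN -[leRHS]sqrrN lerXn2r ?nnegrE; lra.
have mI : measurable (`[x, x + 1]%classic : set R) by exact: measurable_itv.
pose q : R := fine (normal_prob m s `[x, (x + 1)%R]).
have qE : (q%:E = normal_prob m s `[x, (x + 1)%R])%E.
  by rewrite fineK // fin_num_measure.
have q0 : 0 < q by rewrite -lte_fin qE; exact: normal_prob_itv_gt0.
have hI : has_mean (normal_prob m s) (fun z => k * \1_(`[x, x + 1]%classic : set R) z) (k * q).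
  have mI1 : measurable_fun setT (\1_(`[x, x + 1]%classic : set R) : R -> R).
    exact: measurable_indic.
  apply: has_meanZ; apply: ge0_has_mean; [exact: mI1|by []|].
  by rewrite integral_indic // setIT qE.
apply: lt_le_trans (le_has_mean _ hI hV); first exact: mulr_gt0.
move=> z; rewrite indicE; case: (boolP (z \in _)) => [|_]; last by rewrite mulr0 sqr_ge0.
by rewrite inE /= in_itv /= => /H; rewrite mulr1.
Qed.

End GaussianStatistic.

Section GaussianRegularity.
Context {R : realType} {d : nat}.
Variables (m : d.-tuple R) (sigma : R) (mu : {measure set (d.-tuple R) -> \bar R})
  (Pp Pm : probability (d.-tuple R) R) (rhop rhom : d.-tuple R -> R).
Hypothesis m_neq0 : exists i, tnth m i != 0.
Hypothesis sigma_gt0 : 0 < sigma.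
Hypothesis gaussp : isotropic_gaussian m sigma Pp.
Hypothesis gaussm : isotropic_gaussian (map_tuple -%R m) sigma Pm.
Hypothesis densp : has_density mu Pp rhop.
Hypothesis densm : has_density mu Pm rhom.

Let r : R := eucl_norm m / sigma.
Local Notation N := (normal_prob (2 * r ^+ 2) (2 * r)).

Let mp : measurable_fun setT rhop. Proof. by case: densp. Qed.
Let mm : measurable_fun setT rhom. Proof. by case: densm. Qed.
Let p0 x : 0 <= rhop x. Proof. by case: densp => _ + _; apply. Qed.
Let m0 x : 0 <= rhom x. Proof. by case: densm => _ + _; apply. Qed.

Let r_gt0 : 0 < r.
Proof.
case: m_neq0 => i mi; rewrite divr_gt0 // sqrtr_gt0 (bigD1 i) //= ltr_pwDl //.
  by rewrite exprn_even_gt0.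
by apply: sumr_ge0 => j _; exact: sqr_ge0.
Qed.

Let r2_neq0 : 2 * r != 0. Proof. by rewrite gt_eqF // mulr_gt0. Qed.

Let stat_mean (f : R -> R) v : measurable_fun setT f ->
  has_mean N (fun z => f (tanh_half z)) v ->
  has_mean Pp (fun x => f (tstat rhop rhom x)) v.
Proof.
move=> mf hv.
have mid : @measurable_fun _ _ (measurableTypeR R) R setT (fun z => z) by exact: measurable_id.
pose Z : {mfun measurableTypeR R >-> R} :=
  HB.pack (fun z : R => z) (isMeasurableFun.Build _ _ _ _ _ mid).
have ml := measurable_gauss_llr m sigma.
pose L : {mfun d.-tuple R >-> R} :=
  HB.pack (gauss_llr m sigma) (isMeasurableFun.Build _ _ _ _ _ ml).
have mft : measurable_fun setT (fun z => f (tanh_half z)).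
  by apply: measurableT_comp => //; exact: measurable_tanh_half.
have h : has_mean Pp (fun x => f (tanh_half (L x))) v.
  apply: (@has_mean_same_law _ _ _ _ _ N Pp Z L (fun z => f (tanh_half z))) => // A mA.
  by apply/esym; exact: (gauss_llr_law sigma_gt0 gaussp).
apply: ae_eq_has_mean h.
  by apply: measurableT_comp => //; exact: tstat_measurable.
have [M [mM PM HM]] := tstat_ae sigma_gt0 gaussp gaussm densp densm.
by exists M; split=> // x /= H; apply: HM => /= E; apply: H; rewrite E.
Qed.

Lemma gaussian_regularity (K : R) : 0 <= K ->
  [/\ 0 < var_t Pp rhop rhom, var_t Pp rhop rhom = gauss_var_t r,
      0 < gauss_beta r K & log_psi_density_ge Pp rhop rhom K (gauss_beta r K)].
Proof.
move=> K0.
have mt2 : measurable_fun setT (fun z : R => tanh_half z ^+ 2).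
  by apply: measurable_funX; exact: measurable_tanh_half.
have [m1 hm] := has_mean_bounded N measurable_tanh_half (@tanh_half_le1 R).
have [v hv] : exists v, has_mean N (fun z => tanh_half z ^+ 2) v.
  apply: (@has_mean_bounded _ _ _ _ _ 1) => // z.
  by rewrite normrX exprn_ile1 // tanh_half_le1.
have hm' := stat_mean (f := id) (@measurable_id _ _ _) hm.
have hv' := stat_mean (f := fun x => x ^+ 2) (measurable_funX _ (@measurable_id _ _ _)) hv.
have varE : var_t Pp rhop rhom = v - m1 ^+ 2 by rewrite /var_t (has_mean_variance hm' hv').
split.
- by rewrite varE; exact: tanh_half_variance_gt0 r2_neq0 hm hv.
- by rewrite varE /gauss_var_t (has_mean_variance hm hv).
- exact: normal_pdf_gt0.
exists (normal_pdf (2 * r ^+ 2) (2 * r)); split.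
- exact: measurable_normal_pdf.
- exact: normal_pdf_ge0.
- move=> A mA; rewrite -[RHS]/(N A) -(gauss_llr_law sigma_gt0 gaussp m_neq0 mA).
  apply: ae_eq_prob => //; last exact: (log_psi_ae sigma_gt0 gaussp gaussm densp densm).
    apply: measurableT_comp; first exact: measurable_ln.
    apply: measurable_funM => //; apply: measurableT_comp => //; exact: measurable_invr.
  exact: measurable_gauss_llr.
move=> z /andP[z1 z2]; apply: le_normal_pdf => //.
have := sqr_ge0 r; move: (r ^+ 2) => u u0.
rewrite -[leRHS]normrN ler_norml ger0_norm; last lra.
by apply/andP; split; lra.
Qed.

End GaussianRegularity.

(** The theorem quantifies the threshold before the model, so it has to be a function of the
    constants: a witness is selected by choice, with [0] as default where none exists. *)
Definition flip_start {R : realType} (gamma Delta st : R) : nat :=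
  if pselect (exists n0 : nat, forall n, (n0 <= n)%N -> flip_level_ok gamma Delta st n)
  is left ex then sval (cid ex) else 0.

Lemma flip_startP {R : realType} (gamma Delta st : R) n :
  0 < gamma < 1 -> 1 < Delta -> 0 < st -> (flip_start gamma Delta st <= n)%N ->
  flip_level_ok gamma Delta st n.
Proof.
move=> g D s; rewrite /flip_start; case: pselect => [ex|]; last by case; exact: flip_level_ex.
by case: cid => n0 H /=; exact: H.
Qed.

Lemma edge_corr01 {R : realType} (a b : R) : 0 < b -> b < a -> 0 < edge_corr a b < 1.
Proof.
move=> b0 ba; have ab : 0 < a + b by lra.
by rewrite /edge_corr divr_gt0 ?subr_gt0 // ltr_pdivrMr // mul1r; lra.
Qed.

Lemma flip_const_gt0 {R : realType} (gamma Delta kappa vt st beta : R) :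
  1 < Delta -> 0 < kappa -> 0 < st -> 0 < beta ->
  0 < flip_const gamma Delta kappa vt st beta.
Proof.
move=> D k s b; have D0 : 0 < Delta by lra.
by rewrite /flip_const divr_gt0 // ?mulr_gt0 ?invr_gt0 ?sqrtr_gt0 ?subr_gt0.
Qed.

Theorem theorem3p2 (R : realType) :
  (exists (c : R -> R -> R -> R -> R -> R -> R)
          (l0 : R -> R -> R -> R -> R -> R -> nat),
    forall (a b : R) (d : nat)
      (mu : {measure set (d.-tuple R) -> \bar R})
      (Pp Pm : probability (d.-tuple R) R) (rhop rhom : d.-tuple R -> R)
      (beta : R)
      (dO : measure_display) (Omega : measurableType dO)
      (P : probability Omega R)
      (C : vertex -> Omega -> nat) (y : vertex -> Omega -> bool)
      (X : vertex -> Omega -> d.-tuple R),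
      let Delta := mean_degree a b in
      let gamma := edge_corr a b in
      let kappa := snr gamma Delta in
      let vt := theta Pp rhop rhom in
      let st := sigma_t Pp rhop rhom in
      0 < b -> b < a -> 1 < Delta -> kappa < 1 ->
      is_broadcast_tree P Delta gamma Pp Pm C y X ->
      symmetric_densities mu Pp Pm rhop rhom ->
      0 < vt ->
      0 < var_t Pp rhop rhom ->
      0 < beta ->
      log_psi_density_ge Pp rhop rhom (K0 gamma Delta vt) beta ->
      0 < c gamma Delta kappa vt st beta /\
      forall l : nat, (l0 gamma Delta kappa vt st beta <= l)%N ->
        ((c gamma Delta kappa vt st beta * kappa `^ (l%:R / 2))%:E
         <= P [set w | h gamma rhop rhom C X l w
                       <> h gamma rhop rhom C X l.+1 w])%E)
  /\
  (forall (a b : R) (d : nat) (m : d.-tuple R) (sigma : R)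
      (mu : {measure set (d.-tuple R) -> \bar R})
      (Pp Pm : probability (d.-tuple R) R) (rhop rhom : d.-tuple R -> R),
      let Delta := mean_degree a b in
      let gamma := edge_corr a b in
      let kappa := snr gamma Delta in
      let r := eucl_norm m / sigma in
      let K := K0 gamma Delta (theta Pp rhop rhom) in
      0 < b -> b < a -> 1 < Delta -> kappa < 1 ->
      (exists i, tnth m i != 0) -> 0 < sigma ->
      isotropic_gaussian m sigma Pp ->
      isotropic_gaussian (map_tuple -%R m) sigma Pm ->
      has_density mu Pp rhop -> has_density mu Pm rhom ->
      [/\ 0 < var_t Pp rhop rhom,
          var_t Pp rhop rhom = gauss_var_t r,
          0 < gauss_beta r K &
          log_psi_density_ge Pp rhop rhom K (gauss_beta r K)]).

Proof.
split.
  exists flip_const, (fun gamma Delta kappa vt st beta => flip_start gamma Delta st).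
  move=> a b d mu Pp Pm rhop rhom beta dO Omega P C y X Delta gamma kappa vt st.
  move=> b0 ba D1 k1 tree sym vt0 var0 beta0 dens.
  have g01 : 0 < gamma < 1 by exact: edge_corr01.
  have st0 : 0 < st by rewrite sqrtr_gt0.
  have k0 : 0 < kappa.
    by case/andP: g01 => g0 _; rewrite /kappa /snr mulr_gt0 ?exprn_gt0 // (lt_trans _ D1).
  split; first exact: flip_const_gt0.
  move=> l ll0; apply: (flip_probability_ge D1 g01 k1 tree sym vt0 var0 beta0 dens).
  (* The conditions are needed at level [l + 1], the level that separates the two classifiers. *)
  by apply: flip_startP => //; exact: leqW.
move=> a b d m sigma mu Pp Pm rhop rhom Delta gamma kappa r K b0 ba D1 k1 m0 s0 gp gm dp dm.
apply: (gaussian_regularity m0 s0 gp gm dp dm).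
by rewrite /K /K0 addr_ge0 // mulr_ge0 // sqrtr_ge0.
Qed.
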